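(* Suppose that $\mathbb{E}(\log\omega_0(-1))>-\infty$, $\mathbb{E}(\log\omega_0(2))>-\infty$ and $\gamma_2>0$. Then there exists a constant $\theta\in(0,1)$ such that, $P$-almost surely, $$\lim_{x\to\infty}\frac{\#\{X_n:\ 0\le X_n\le x,\ n\ge 0\}}{x}=\theta .$$
   Context: Environment and walk. For $i\in\mathbb{Z}$ let $\omega_i=(\omega_i(-1),\omega_i(1),\omega_i(2))$ be a probability vector (giving jump probabilities from $i$ to $i-1$, $i+1$, $i+2$). $\Omega$ is the space of all $\omega=(\omega_i)_{i\in\mathbb{Z}}$ with its Borel $\sigma$-algebra $\mathcal{F}$, and $\mathbb{P}$ is a probability measure on $(\Omega,\mathcal{F})$ under which $(\omega_i)_{i\in\mathbb{Z}}$ is i.i.d.; $\mathbb{E}$ is its expectation. Given $\omega$, $(X_n)_{n\ge0}$ is the Markov chain on $\mathbb{Z}$ with $P_\omega^{x_0}(X_0=x_0)=1$ and $P_\omega^{x_0}(X_{n+1}=i+\ell\mid X_n=i)=\omega_i(\ell)$ for $\ell\in\{-1,1,2\}$ (quenched law). The annealed law is $P^{x_0}(\cdot)=\int P_\omega^{x_0}(\cdot)\,\mathbb{P}(d\omega)$. The superscript is omitted when $x_0=0$, so $P$ is the annealed law of the walk started at $0$. Lyapunov exponent. Let $a_i(1)=\frac{\omega_i(1)+\omega_i(2)}{\omega_i(-1)}$, $a_i(2)=\frac{\omega_i(2)}{\omega_i(-1)}$ and $A_i=\begin{pmatrix}a_i(1)&a_i(2)\\1&0\end{pmatrix}$. Then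 $\gamma_2$ is the top Lyapunov exponent of $(A_i)$, i.e. the $\mathbb{P}$-a.s. constant limit $\gamma_2=\lim_{n\to\infty}\frac1n\log\|A_0A_1\cdots A_{n-1}\|$. $\#S$ denotes the number of elements of the set $S$; thus $\#\{X_n:0\le X_n\le x,\ n\ge0\}$ is the number of distinct sites in $[0,x]$ ever visited by the walk. *)

(* Defs.v *)
From HB Require Import structures.
From mathcomp Require Import all_boot all_order all_algebra.
From mathcomp Require Import finmap.
From mathcomp Require Import all_classical all_reals all_analysis.

Set Implicit Arguments.
Unset Strict Implicit.
Unset Printing Implicit Defensive.

Import Order.TTheory GRing.Theory Num.Theory.
Import numFieldNormedType.Exports.

Local Open Scope classical_set_scope.
Local Open Scope ring_scope.

(** Random walk in random environment on the integers, with jumps in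
    {-1, 1, 2}. *)

(* A probability vector on {-1, 1, 2} is encoded as a function of the jump
   [l : int] that vanishes off {-1, 1, 2}; thus [w i l] is $\omega_i(\ell)$ and
   the transition probability from [i] to [j] is [w i (j - i)]. *)
Definition jump_law (R : realType) (p : int -> R) : Prop :=
  [/\ forall l, 0 <= p l,
      forall l, l \notin [:: -1; 1; 2] -> p l = 0
    & p (-1) + p 1 + p 2 = 1].

Record env (R : realType) := Env {
  env_fun :> int -> int -> R ;
  env_jump_law : forall i, jump_law (env_fun i) }.

Section env_point.
Context (R : realType).

Let point_fun (i l : int) : R := (l == 1)%:R.

Let point_jump_law i : jump_law (point_fun i).
Proof.
split=> [l|l|]; rewrite /point_fun ?ler0n//; last by rewrite add0r addr0.
by rewrite !inE !negb_or => /and3P[_ /negbTE ->].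
Qed.

HB.instance Definition _ := gen_eqMixin (env R).
HB.instance Definition _ := gen_choiceMixin (env R).
HB.instance Definition _ := isPointed.Build (env R) (Env point_jump_law).

End env_point.

(* The sigma-algebra on environments is the product one, generated by the real
   coordinates [w i l]. Since there are countably many of them, it is the Borel
   sigma-algebra of the product topology. *)
Definition env_cylinders (R : realType) : set (set (env R)) :=
  [set A | exists i l (B : set R),
    measurable B /\ A = [set w : env R | B (w i l)]].

Definition Omega (R : realType) := g_sigma_algebraType (@env_cylinders R).

HB.instance Definition _ := isPointed.Build int 0.

Definition path_cylinders : set (set (nat -> int)) :=
  [set A | exists n k, A = [set X : nat -> int | X n = k]].

Definition Path := g_sigma_algebraType path_cylinders.

Section iid.
Context (R : realType) (P : probability (Omega R) R).

Definition site (i : int) (w : Omega R) : R * R * R :=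
  (w i (-1), w i 1, w i 2).

Definition iid_sites : Prop :=
  (forall (i : int) (B : set (R * R * R)), measurable B ->
     P (site i @^-1` B) = P (site 0 @^-1` B)) /\
  (forall (s : seq int) (B : int -> set (R * R * R)), uniq s ->
     (forall i, measurable (B i)) ->
     P (\bigcap_(i in [set` s]) (site i @^-1` B i))
     = (\prod_(i <- s) P (site i @^-1` B i))%E).

End iid.

Section lyapunov.
Context (R : realType).

Definition a1 (w : env R) (i : int) : R := (w i 1 + w i 2) / w i (-1).

Definition a2 (w : env R) (i : int) : R := w i 2 / w i (-1).

Definition A_mx (w : env R) (i : int) : 'M[R]_2 :=
  \matrix_(j < 2, k < 2)
    if j == 0 then (if k == 0 then a1 w i else a2 w i) else (k == 0)%:R.

(* [\prod_(i < n)] in the matrix ring is $A_0 A_1 \cdots A_{n-1}$ in this order.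
   The norm is the entrywise maximum; all norms on 2x2 matrices are equivalent,
   so the limit does not depend on this choice. *)
Definition top_lyapunov (P : probability (Omega R) R) (gamma : R) : Prop :=
  {ae P, forall w : Omega R,
    (n%:R^-1 * ln `|\prod_(i < n) A_mx w (i%:Z)|) @[n --> \oo] --> gamma}.

End lyapunov.

Section walk.
Context (R : realType).

(* [K w] is the law of the Markov chain started at [x0] with transition
   probabilities [w i l]: the Markov property is written with the conditional
   probabilities multiplied out, over full past trajectories. These conditions
   determine [K w]. *)
Definition quenched_law (K : R.-pker (Omega R) ~> Path) (x0 : int) : Prop :=
  forall w : Omega R,
    K w [set X : Path | X 0%N = x0] = 1%E /\
    forall (n : nat) (x : nat -> int),
      K w [set X : Path | forall k, (k <= n.+1)%N -> X k = x k]
      = (K w [set X : Path | forall k, (k <= n)%N -> X k = x k]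
         * (w (x n) (x n.+1 - x n))%:E)%E.

Definition annealed (P : probability (Omega R) R)
    (K : R.-pker (Omega R) ~> Path) (A : set Path) : \bar R :=
  (\int[P]_w K w A)%E.

Section annealed_probability.
Variables (P : probability (Omega R) R) (K : R.-pker (Omega R) ~> Path).
Local Open Scope ereal_scope.

Let annealed0 : annealed P K set0 = 0.
Proof. by apply: integral0_eq => w _; rewrite measure0. Qed.

Let annealed_ge0 A : 0 <= annealed P K A.
Proof. exact: integral_ge0. Qed.

Let annealed_sigma_additive : semi_sigma_additive (annealed P K).
Proof.
move=> F mF tF mUF; rewrite [X in _ --> X](_ : _ =
    \int[P]_w (\sum_(n <oo) K w (F n))); last first.
  apply: eq_integral => w _.
  by apply/esym/cvg_lim => //; exact: measure_semi_sigma_additive.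
apply/cvg_closeP; split.
  by apply: is_cvg_nneseries => n _ _; exact: integral_ge0.
rewrite closeE// integral_nneseries// => n.
exact: measurable_kernel.
Qed.

HB.instance Definition _ := isMeasure.Build _ _ _
  (annealed P K) annealed0 annealed_ge0 annealed_sigma_additive.

Let annealed_setT : annealed P K [set: Path] = 1.
Proof.
rewrite /annealed (eq_integral (cst 1)); last first.
  by move=> w _; rewrite /= prob_kernel.
by rewrite integral_cst//= mul1e probability_setT.
Qed.

HB.instance Definition _ := Measure_isProbability.Build _ _ _
  (annealed P K) annealed_setT.

End annealed_probability.

Definition visited (X : Path) (x : R) : set int :=
  [set y | exists n, X n = y /\ 0 <= X n /\ (X n)%:~R <= x].

(* [visited X x] is finite, so that [fset_set] is its actual set of elements. *)
Definition num_visited (X : Path) (x : R) : nat :=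
  #|` fset_set (visited X x)|%fset.

End walk.

(* Main.v *)
Require Import Defs.
From HB Require Import structures.
From mathcomp Require Import all_boot all_order all_algebra.
From mathcomp Require finmap.
From mathcomp Require Import all_classical all_reals all_analysis.
From mathcomp Require Import measurable_realfun.
From mathcomp Require Import ring lra zify.

Set Implicit Arguments.
Unset Strict Implicit.
Unset Printing Implicit Defensive.

Import Order.TTheory GRing.Theory Num.Theory.
Import numFieldNormedType.Exports.

Local Open Scope classical_set_scope.
Local Open Scope ring_scope.

(** The diagonal entries D_n of A_0 ... A_(n-1) are the increments of quenched
    harmonic functions, and gamma_2 > 0 makes the sum of the 1 / D_n finite; so
    the walk almost surely exceeds every level, and with positive annealed
    probability it stays above its starting level for ever. A site k > 0 is
    skipped exactly when, at some time, the walk reaches k + 1 for the first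
    time without having visited k, and never returns to k. The past of that
    event only involves sites below k and its future only sites above k, so
    independence of the environment makes the skipped sites a regeneration
    structure: after the first skip, the gaps between successive skipped sites
    are i.i.d. under the Palm measure, the law of the path after a skip. Each
    time the walk reaches a new maximum, a skip occurs within two sites with
    probability rho > 0, so the renewal equation bounds the mean gap mu by
    1 + 2 / rho. A maximal inequality then gives that the m-th skipped site is
    asymptotic to mu m. Hence the skipped sites have density 1 / mu, where
    mu >= 2, and theta = 1 - 1 / mu. *)

(** Independence is given for finitely many sites, while escape and passage probabilities depend on
    infinitely many. A finite-horizon probability is therefore written as a polynomial in the jump
    probabilities, where independence and stationarity become identities between expectations of
    monomials; infinite horizons are monotone limits of such polynomials. An upward jump may
    overshoot by one, so the upper end of an interval consists of two sites. A function that
    vanishes on both and is harmonic below them is fixed by one number, and its increments obey the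
    recursion of the top-left entries of the matrix products; this is the origin of D_n. The
    exponent gamma_2 is only known for products that start at site 0, so estimates at other levels
    are obtained in mean, by translation. The maximal inequality stands in for the strong law: the
    event that the partial sums are unbounded above is shift invariant, hence independent of the
    first gap, and this makes it null when the drift is negative. The site just after a skipped one
    is visited, so mu >= 2 and theta > 0; that mu is finite gives theta < 1. *)

Section mixed_independence.
Local Open Scope ereal_scope.
Import HBNNSimple.

(** The hypothesis is the case of indicators of [Y]; linearity gives simple functions, and monotone
    convergence along [nnsfun_approx] gives [phi]. It is applied with [Y] a site of the environment
    and with [Y] the length of a gap. *)
Lemma ge0_integral_indep d d' (T : measurableType d) (U : measurableType d')
    (R : realType) (mu : {measure set T -> \bar R}) (D : set T)
    (Phi : T -> R) (Y : T -> U) (c : R) (phi : U -> R) :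
  measurable D -> measurable_fun [set: T] Phi -> (forall x, (0 <= Phi x)%R) ->
  measurable_fun [set: T] Y -> (0 <= c)%R ->
  (forall B, measurable B ->
     \int[mu]_(x in D `&` Y @^-1` B) (Phi x)%:E = c%:E * mu (Y @^-1` B)) ->
  measurable_fun [set: U] phi -> (forall u, (0 <= phi u)%R) ->
  \int[mu]_(x in D) (Phi x * phi (Y x))%:E = c%:E * \int[mu]_x (phi (Y x))%:E.
Proof.
move=> mD mPhi Phi0 mY c0 H mphi phi0.
have mphi' : measurable_fun [set: U] (EFin \o phi) by exact/measurable_EFinP.
pose g := nnsfun_approx measurableT mphi'.
have mgY n : measurable_fun [set: T] (fun x => (g n (Y x))%:E).
  by apply/measurable_EFinP; exact: measurableT_comp.
have gY0 n x : 0 <= (g n (Y x))%:E by rewrite lee_fin.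
have ndg x : nondecreasing_seq (fun n => (g n (Y x))%:E).
  by move=> m n mn; rewrite lee_fin; exact/lefP/nd_nnsfun_approx.
have phi0' u : [set: U] u -> 0 <= (EFin \o phi) u by rewrite lee_fin.
have cvgg x : (g n (Y x))%:E @[n --> \oo] --> (phi (Y x))%:E.
  exact: (cvg_nnsfun_approx measurableT mphi' phi0' Logic.I).
have step n : \int[mu]_(x in D) ((Phi x)%:E * (g n (Y x))%:E) =
    c%:E * \int[mu]_x (g n (Y x))%:E.
  have gE x : (g n (Y x))%:E =
      \sum_(v \in range (g n)) (v%:E * (\1_(g n @^-1` [set v]) (Y x))%:E).
    by rewrite fimfunE -fsumEFin//.
  have mind v : measurable_fun [set: T]
      (fun x => (\1_(g n @^-1` [set v]) (Y x) : R)%:E).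
    by apply/measurable_EFinP/measurableT_comp => //; exact: measurable_indic.
  have sub0 v x : v \in range (g n) -> 0 <= v%:E * (\1_(g n @^-1` [set v]) (Y x))%:E.
    rewrite inE => -[u _ <-]; apply: mule_ge0; rewrite lee_fin//.
  have indE v : \int[mu]_x (\1_(g n @^-1` [set v]) (Y x))%:E = mu (Y @^-1` (g n @^-1` [set v])).
    transitivity (\int[mu]_x (\1_(Y @^-1` (g n @^-1` [set v])) x)%:E) => //.
    by rewrite integral_indic ?setIT// -[X in measurable X]setTI; exact: mY.
  have rfin := fimfunP (g n).
  pose s : seq R := finmap.enum_fset (fset_set (range (g n))).
  have sE v : v \in s -> v \in range (g n) by rewrite -(in_fset_set rfin).
  (* The test [v \in s] keeps every term nonnegative, also for a negative [v], which is not a value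
     of [g n]; [ge0_integral_sum] asks this of all indices. *)
  have gE' x : (g n (Y x))%:E =
      \sum_(v <- s) (if v \in s then v%:E * (\1_(g n @^-1` [set v]) (Y x))%:E else 0).
    rewrite gE fsbig_finite// -/s.
    by rewrite big_seq [RHS]big_seq; apply: eq_bigr => v ->.
  have mterm v : measurable_fun [set: T] (fun x =>
      if v \in s then v%:E * (\1_(g n @^-1` [set v]) (Y x))%:E else 0).
    by case: (v \in s) => //; exact: measurable_funeM.
  have term0 v x : 0 <= (if v \in s then v%:E * (\1_(g n @^-1` [set v]) (Y x))%:E else 0).
    by case: ifPn => // vs; apply: sub0; exact: sE.
  transitivity (\int[mu]_(x in D) (\sum_(v <- s) ((Phi x)%:E *
     (if v \in s then v%:E * (\1_(g n @^-1` [set v]) (Y x))%:E else 0)))).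
    by apply: eq_integral => x _; rewrite gE' ge0_sume_distrr.
  rewrite ge0_integral_sum//; last 2 first.
  - move=> v; apply: (measurable_funS measurableT) => //.
    by apply: emeasurable_funM => //; exact/measurable_EFinP.
  - by move=> v x _; apply: mule_ge0 => //; rewrite lee_fin.
  under [in RHS]eq_integral do rewrite gE'.
  rewrite ge0_integral_sum// ge0_sume_distrr; last first.
    by move=> v _; apply: integral_ge0.
  apply: eq_bigr => v _; have [vs|_] := boolP (v \in s); last first.
    by rewrite integral0_eq ?integral0 ?mule0// => x _; rewrite mule0.
  have v0 : (0 <= v)%R by move/sE: vs; rewrite inE => -[u _ <-].
  rewrite [in RHS]ge0_integralZl// indE.
  rewrite muleCA -H//.
  under eq_integral do rewrite muleCA.
  rewrite ge0_integralZl//.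
  - congr (_ * _); rewrite integral_mkcondr; apply: eq_integral => x _.
    by rewrite epatch_indic.
  - apply: (measurable_funS measurableT) => //.
    by apply: emeasurable_funM => //; exact/measurable_EFinP.
  - by move=> x _; apply: mule_ge0; rewrite lee_fin.
have mPhi' : measurable_fun [set: T] (EFin \o Phi) by exact/measurable_EFinP.
have cvgL : \int[mu]_(x in D) ((Phi x)%:E * (g n (Y x))%:E) @[n --> \oo] -->
    \int[mu]_(x in D) (Phi x * phi (Y x))%:E.
  have -> : \int[mu]_(x in D) (Phi x * phi (Y x))%:E =
      \int[mu]_(x in D) limn (fun n => (Phi x)%:E * (g n (Y x))%:E).
    apply: eq_integral => x _; apply/esym/cvg_lim => //.
    by rewrite EFinM; apply: cvgeZl.
  apply: cvg_monotone_convergence => //.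
  - move=> n; apply: (measurable_funS measurableT) => //.
    exact: emeasurable_funM.
  - by move=> n x _; apply: mule_ge0; rewrite ?lee_fin.
  - move=> x _ m n mn; apply: lee_wpmul2l; rewrite ?lee_fin//.
    exact: ndg.
have cvgR : \int[mu]_x (g n (Y x))%:E @[n --> \oo] --> \int[mu]_x (phi (Y x))%:E.
  have -> : \int[mu]_x (phi (Y x))%:E = \int[mu]_x limn (fun n => (g n (Y x))%:E).
    by apply: eq_integral => x _; apply/esym/cvg_lim.
  by apply: cvg_monotone_convergence.
have cvgR' : c%:E * \int[mu]_x (g n (Y x))%:E @[n --> \oo] -->
    c%:E * \int[mu]_x (phi (Y x))%:E by apply: cvgeZl.
rewrite -(cvg_lim _ cvgL)// -(cvg_lim _ cvgR')//.
by congr (limn _); apply/funext => n; exact: step.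
Qed.
End mixed_independence.

(** * Monomials in the environment and their factorization over sites *)

Section environment.
Context (R : realType).
Implicit Types (w : Omega R) (i l c : int).

Lemma jump_ge0 (w : env R) i l : 0 <= w i l.
Proof. by have [] := env_jump_law w i. Qed.

Lemma jump_sum1 (w : env R) i : w i (-1) + w i 1 + w i 2 = 1.
Proof. by have [] := env_jump_law w i. Qed.

Lemma jump_out (w : env R) i l : l \notin [:: -1; 1; 2] -> w i l = 0.
Proof. by have [_ + _] := env_jump_law w i; apply. Qed.

Lemma jump_le1 (w : env R) i l : w i l <= 1.
Proof.
have := jump_sum1 w i.
have := jump_ge0 w i (-1); have := jump_ge0 w i 1; have := jump_ge0 w i 2.
have [|/jump_out->//] := boolP (l \in [:: -1; 1; 2]).
by rewrite !inE => /or3P[] /eqP ->; lra.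
Qed.

Lemma measurable_jump i l : measurable_fun [set: Omega R] (fun w : Omega R => w i l).
Proof.
move=> _ B mB; rewrite setTI; apply: sub_sigma_algebra.
by exists i, l, B; split.
Qed.

Lemma measurable_site i : measurable_fun [set: Omega R] (@site R i).
Proof.
by apply: measurable_fun_pair; [apply: measurable_fun_pair|];
  exact: measurable_jump.
Qed.

(* A pair (i, l) stands for the variable w i l, a list of pairs for a monomial and
   a list of monomials for a polynomial in the environment. *)
Definition mono (w : env R) (L : seq (int * int)) : R :=
  \prod_(a <- L) w a.1 a.2.

Lemma mono_ge0 (w : env R) L : 0 <= mono w L.
Proof. by apply: prodr_ge0 => a _; exact: jump_ge0. Qed.

Lemma mono_le1 (w : env R) L : mono w L <= 1.
Proof. by apply: prodr_ile1 => a _; rewrite jump_ge0 jump_le1. Qed.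

Lemma mono_cat (w : env R) L1 L2 : mono w (L1 ++ L2) = mono w L1 * mono w L2.
Proof. by rewrite /mono big_cat. Qed.

Lemma measurable_mono L : measurable_fun [set: Omega R] (fun w : Omega R => mono w L).
Proof. by apply: measurable_prod => a _; exact: measurable_jump. Qed.

(** The absolute values give nonnegativity on all of [R * R * R], as nonnegative integration
    requires; on values of [site] they change nothing. *)
Definition coordm (l : int) (p : R * R * R) : R :=
  if l == -1 then `|p.1.1| else if l == 1 then `|p.1.2| else
  if l == 2 then `|p.2| else 0.

Lemma coordm_site w i l : w i l = coordm l (site i w).
Proof.
rewrite /coordm /site /=.
case: eqP => [->|/eqP n1]; first by rewrite ger0_norm ?jump_ge0.
case: eqP => [->|/eqP n2]; first by rewrite ger0_norm ?jump_ge0.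
case: eqP => [->|/eqP n3]; first by rewrite ger0_norm ?jump_ge0.
by rewrite jump_out// !inE !negb_or n1 n2.
Qed.

Lemma coordm_ge0 l p : 0 <= coordm l p.
Proof. by rewrite /coordm; do 3 case: ifP => _ //. Qed.

Lemma measurable_coordm l : measurable_fun [set: R * R * R] (coordm l).
Proof.
rewrite /coordm; case: (l == -1); last case: (l == 1); last case: (l == 2) => //.
- by do 2 apply: measurableT_comp => //; exact: measurable_fst.
- apply: measurableT_comp => //.
  by apply: measurableT_comp measurable_snd measurable_fst.
- by apply: measurableT_comp => //; exact: measurable_snd.
Qed.

Definition mono_at (L : seq (int * int)) (i : int) (p : R * R * R) : R :=
  \prod_(a <- L | a.1 == i) coordm a.2 p.

Lemma mono_at_ge0 L i p : 0 <= mono_at L i p.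
Proof. by apply: prodr_ge0 => a _; exact: coordm_ge0. Qed.

Lemma mono_at_le1 L i w : mono_at L i (site i w) <= 1.
Proof. by apply: prodr_ile1 => a _; rewrite coordm_ge0 -coordm_site jump_le1. Qed.

Lemma measurable_mono_at L i : measurable_fun [set: R * R * R] (mono_at L i).
Proof.
rewrite /mono_at; under eq_fun do rewrite -big_filter.
by apply: measurable_prod => a _; exact: measurable_coordm.
Qed.

(** The list [s] may contain more sites than [L], so that two monomials can be factored over a
    common list. *)
Lemma mono_atE (s : seq int) w L : uniq s -> {subset map fst L <= s} ->
  mono w L = \prod_(i <- s) mono_at L i (site i w).
Proof.
move=> us sub; elim: L sub => [_|a L IH sub].
  by rewrite /mono big_nil big1// => i _; rewrite /mono_at big_nil.
have as_ : a.1 \in s by apply: sub; rewrite /= mem_head.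
rewrite /mono big_cons -/(mono w L) IH; last first.
  by move=> x xL; apply: sub; rewrite /= inE xL orbT.
rewrite [in RHS](bigD1_seq a.1)//= [in LHS](bigD1_seq a.1)//= mulrA.
rewrite {3}/mono_at big_cons eqxx coordm_site; congr (_ * _ * _).
rewrite big_seq_cond [RHS]big_seq_cond; apply: eq_bigr => i /andP[_ ia].
by rewrite [in RHS]/mono_at big_cons eq_sym (negbTE ia).
Qed.
End environment.

(** * Independence and translation invariance of expected polynomials *)

Section iid_environment.
Context (R : realType) (P : probability (Omega R) R).
Hypothesis hiid : iid_sites P.
Local Open Scope ereal_scope.

Lemma integral_le1_fin (f : Omega R -> R) : measurable_fun [set: Omega R] f ->
  (forall w, (0 <= f w)%R) -> (forall w, (f w <= 1)%R) ->
  \int[P]_w (f w)%:E \is a fin_num.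
Proof.
move=> mf f0 f1; rewrite ge0_fin_numE; last by apply: integral_ge0 => w _; rewrite lee_fin.
apply: (@le_lt_trans _ _ (\int[P]_w (cst 1 w))).
  apply: ge0_le_integral => //; first by move=> w _; rewrite lee_fin.
    exact/measurable_EFinP.
  by move=> w _; rewrite lee_fin.
rewrite integral_cst// mul1e.
apply: le_lt_trans (probability_le1 P measurableT) _; exact: ltry.
Qed.

Lemma site_prob_fin i B : measurable B -> P (site i @^-1` B) \is a fin_num.
Proof.
move=> mB; apply: fin_num_measure.
by rewrite -[X in measurable X]setTI; exact: measurable_site.
Qed.

(** Sites in [s1] carry functions, sites in [s2] carry events. Without functions this is the
    independence in [iid_sites]; each induction step turns the event at one site into a function by
    [ge0_integral_indep]. *)
Lemma site_prod (phi : int -> R * R * R -> R)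
    (mphi : forall i, measurable_fun [set: R * R * R] (phi i))
    (phi0 : forall i p, (0 <= phi i p)%R)
    (phi1 : forall i w, (phi i (site i w) <= 1)%R)
    (s1 : seq int) : forall (s2 : seq int) (B : int -> set (R * R * R)),
  uniq (s1 ++ s2) -> (forall i, measurable (B i)) ->
  \int[P]_(w in \bigcap_(i in [set` s2]) (site i @^-1` B i))
     (\prod_(i <- s1) phi i (site i w))%:E
  = \prod_(i <- s1) (\int[P]_w (phi i (site i w))%:E)
    * \prod_(i <- s2) P (site i @^-1` B i).
Proof.
have mps i : measurable_fun [set: Omega R] (fun w => phi i (site i w)).
  by apply: measurableT_comp => //; exact: measurable_site.
have mC (s2 : seq int) (B : int -> set (R * R * R)) :
    (forall i, measurable (B i)) ->
    measurable (\bigcap_(i in [set` s2]) (@site R i @^-1` B i)).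
  move=> mB; apply: fin_bigcap_measurable => // i _.
  by rewrite -[X in measurable X]setTI; exact: measurable_site.
elim: s1 => [|j s1 IH] s2 B us mB.
  rewrite big_nil mul1e -hiid.2//.
  under eq_integral do rewrite big_nil.
  rewrite integral_cst ?mul1e//.
  exact: mC.
move: us; rewrite cat_cons cons_uniq mem_cat negb_or => /andP[/andP[js1 js2] us].
rewrite big_cons.
under eq_integral do rewrite big_cons mulrC.
set D := \bigcap_(_ in _) _.
set c' := (X in _ = _ * X * _).
have cf : c' * \prod_(i <- s2) P (site i @^-1` B i) \is a fin_num.
  apply: fin_numM; apply: prode_fin_num => i _; last exact: site_prob_fin.
  exact: integral_le1_fin.
have c0 : 0 <= c' * \prod_(i <- s2) P (site i @^-1` B i).
  by apply: mule_ge0; apply: prode_ge0 => // i _; apply: integral_ge0 => w _; rewrite lee_fin.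
pose c := fine (c' * \prod_(i <- s2) P (site i @^-1` B i)).
have cE : c%:E = c' * \prod_(i <- s2) P (site i @^-1` B i) by rewrite fineK.
rewrite (@ge0_integral_indep _ _ _ _ _ _ _ (fun w => \prod_(i <- s1) phi i (site i w))%R (@site R j) c)//.
- by rewrite cE muleC muleA.
- exact: mC.
- by apply: measurable_prod => i _; exact: mps.
- by move=> w; apply: prodr_ge0.
- exact: measurable_site.
- by rewrite fine_ge0.
move=> B0 mB0.
(* The hypothesis of [ge0_integral_indep] is the induction hypothesis for [j :: s2], with site [j]
   still carrying an event. *)
pose B' i := if i == j then B0 else B i.
have eqB i : i \in s2 -> B' i = B i.
  by rewrite /B'; case: eqP => // ->; rewrite (negbTE js2).
have Bj : B' j = B0 by rewrite /B' eqxx.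
have := IH (j :: s2) B'.
have -> : uniq (s1 ++ j :: s2).
  by rewrite -cat1s uniq_catCA /= mem_cat negb_or js1 js2.
move=> /(_ erefl); rewrite cE -/c' big_cons Bj => IH'.
rewrite muleAC -muleA (_ : \prod_(i <- s2) _ = \prod_(i <- s2) P (site i @^-1` B' i)).
  rewrite -IH'; last by move=> i; rewrite /B'; case: ifP.
  congr (\int[_]_(x in _) _).
  apply/seteqP; split => w.
    move=> [H1 H2] i /=; rewrite inE => /orP[/eqP->|is2]; first by rewrite Bj.
    by rewrite eqB//; exact: H1.
  move=> H; split=> [i /= is2|].
    by rewrite -eqB//; apply: H; rewrite /= inE is2 orbT.
  by have := H j; rewrite /= mem_head Bj; exact.
by rewrite big_seq [RHS]big_seq; apply: eq_bigr => i /eqB ->.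
Qed.

Definition emono (L : seq (int * int)) : \bar R := \int[P]_w (mono w L)%:E.

Lemma emono_fin L : emono L \is a fin_num.
Proof.
apply: integral_le1_fin => [|w|w]; [exact: measurable_mono|exact: mono_ge0|].
exact: mono_le1.
Qed.

(** Independence splits the expectation and identical distribution moves every factor to site 0.
    Both [emono_indep] and [emono_shift] are read off this formula. *)
Lemma emono_prod L (s : seq int) : uniq s -> {subset map fst L <= s} ->
  emono L = \prod_(i <- s) \int[P]_w (mono_at L i (site 0 w))%:E.
Proof.
move=> us sub; rewrite /emono.
under eq_integral do rewrite (mono_atE _ us sub).
have := @site_prod (mono_at L) (@measurable_mono_at R L) (@mono_at_ge0 R L)
  (@mono_at_le1 R L) s [::] (fun=> setT).
rewrite cats0 => /(_ us (fun=> measurableT)).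
rewrite big_nil mule1 set_nil bigcap_set0 => ->.
apply: eq_bigr => i _.
have mL : measurable_fun [set: R * R * R] (fun p => (mono_at L i p)%:E).
  apply/measurable_EFinP.
  apply (@measurable_mono_at R L i).
have L0 : {in [set: R * R * R], forall p, 0 <= (mono_at L i p)%:E}.
  by move=> p _; rewrite lee_fin mono_at_ge0.
have := ge0_integral_pushforward (measurable_site i) P measurableT mL L0.
rewrite preimage_setT => /= <-.
have := ge0_integral_pushforward (measurable_site 0) P measurableT mL L0.
rewrite preimage_setT => /= <-.
apply: eq_measure_integral => [||m1 m2 A mA _]; try exact: measurable_site.
by apply: (proj1 hiid i A mA).
Qed.

Lemma mono_at_notin L i (p : R * R * R) : i \notin map fst L -> mono_at L i p = 1%R.
Proof.
move=> iL; rewrite /mono_at big_seq_cond big_pred0// => a.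
by apply/negP => /andP[aL /eqP ai]; move/negP: iL; apply; rewrite -ai map_f.
Qed.

(** Over a common list of sites, at each site at least one of the two monomials contributes the
    factor 1. *)
Lemma emono_indep L1 L2 : (forall i, i \in map fst L1 -> i \notin map fst L2) ->
  emono (L1 ++ L2) = emono L1 * emono L2.
Proof.
move=> dis; pose s := undup (map fst (L1 ++ L2)).
have us : uniq s by exact: undup_uniq.
have sub : {subset map fst (L1 ++ L2) <= s} by move=> i; rewrite mem_undup.
have sub1 : {subset map fst L1 <= s}.
  by move=> i iL; apply: sub; rewrite map_cat mem_cat iL.
have sub2 : {subset map fst L2 <= s}.
  by move=> i iL; apply: sub; rewrite map_cat mem_cat iL orbT.
rewrite (emono_prod us sub) (emono_prod us sub1) (emono_prod us sub2).
rewrite -big_split/=; apply: eq_bigr => i _.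
have catE w : mono_at (L1 ++ L2) i (site 0 w) =
    (mono_at L1 i (site 0 w) * mono_at L2 i (site 0 w))%R :> R.
  by rewrite /mono_at big_cat.
under eq_integral do rewrite catE.
have int1 : \int[P]_w 1%:E = 1 by rewrite integral_cst// mul1e; exact: probability_setT.
have [i1|i1] := boolP (i \in map fst L1).
  under eq_integral do rewrite (mono_at_notin _ (dis _ i1)) mulr1.
  under [in X in _ = _ * X]eq_integral do rewrite (mono_at_notin _ (dis _ i1)).
  by rewrite int1 mule1.
under eq_integral do rewrite (mono_at_notin _ i1) mul1r.
under [in X in _ = X * _]eq_integral do rewrite (mono_at_notin _ i1).
by rewrite int1 mul1e.
Qed.

Definition shift_mono (c : int) (L : seq (int * int)) :=
  [seq ((a.1 + c)%R, a.2) | a <- L].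

Lemma emono_shift c L : emono (shift_mono c L) = emono L.
Proof.
pose s := undup (map fst L).
have sub : {subset map fst L <= s} by move=> i; rewrite mem_undup.
have sub' : {subset map fst (shift_mono c L) <= map (+%R^~ c) s}.
  move=> i; rewrite /shift_mono -map_comp => /mapP[a aL ->]/=.
  by apply/mapP; exists a.1 => //; apply: sub; exact: map_f.
rewrite (emono_prod _ sub) ?undup_uniq// (emono_prod _ sub'); last first.
  by rewrite map_inj_uniq ?undup_uniq//; exact: addIr.
rewrite big_map; apply: eq_bigr => i _; apply: eq_integral => w _.
rewrite /mono_at /shift_mono big_map; congr (_%:E).
by apply: eq_bigl => a /=; rewrite (inj_eq (@addIr _ c)).
Qed.

Definition peval (s : seq (seq (int * int))) (w : env R) : R :=
  (\sum_(L <- s) mono w L)%R.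

Definition psites (s : seq (seq (int * int))) : seq int :=
  flatten [seq map fst L | L <- s].

Definition epoly s : \bar R := \int[P]_w (peval s w)%:E.

Lemma peval_ge0 s w : (0 <= peval s w)%R.
Proof. by apply: sumr_ge0 => L _; exact: mono_ge0. Qed.

Lemma measurable_peval s : measurable_fun [set: Omega R] (peval s).
Proof. by apply: measurable_sum => L; exact: measurable_mono. Qed.

Lemma epolyE s : epoly s = \sum_(L <- s) emono L.
Proof.
rewrite /epoly -ge0_integral_sum//.
- by apply: eq_integral => w _; rewrite sumEFin.
- by move=> L; apply/measurable_EFinP; apply: measurable_mono.
- by move=> L w _; rewrite lee_fin mono_ge0.
Qed.

Lemma emono_ge0 L : 0 <= emono L.
Proof. by apply: integral_ge0 => w _; rewrite lee_fin mono_ge0. Qed.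

Lemma epoly_indep L s :
  (forall i, i \in map fst L -> i \notin psites s) ->
  \int[P]_w (mono w L * peval s w)%:E = emono L * epoly s.
Proof.
move=> dis; transitivity (epoly [seq L ++ L' | L' <- s]).
  apply: eq_integral => w _; congr (_%:E).
  by rewrite /peval big_map mulr_sumr; apply: eq_bigr => L' _; rewrite mono_cat.
rewrite !epolyE big_map ge0_sume_distrr; last by move=> L' _; exact: emono_ge0.
rewrite big_seq [RHS]big_seq; apply: eq_bigr => L' L's.
apply: emono_indep => i /dis; apply: contra => iL'.
by apply/flattenP; exists (map fst L') => //; exact: map_f.
Qed.

Definition shift_poly c s := [seq shift_mono c L | L <- s].

Lemma epoly_shift c s : epoly (shift_poly c s) = epoly s.
Proof. by rewrite !epolyE big_map; apply: eq_bigr => L _; exact: emono_shift. Qed.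

End iid_environment.

(** * Countable combinations of events and countable partitions *)

Section measurable_events.
Context d (T : measurableType d).
Implicit Types (A B : T -> Prop) (F : nat -> T -> Prop).

Lemma mset_and A B : measurable [set x | A x] -> measurable [set x | B x] ->
  measurable [set x | A x /\ B x].
Proof. exact: measurableI. Qed.

Lemma mset_forall F : (forall n, measurable [set x | F n x]) ->
  measurable [set x | forall n, F n x].
Proof.
move=> mF; rewrite (_ : mkset _ = \bigcap_n [set x | F n x]).
  exact: bigcapT_measurable.
by apply/seteqP; split => x /= Fx n; [move=> _; exact: Fx|exact: (Fx n Logic.I)].
Qed.

Lemma mset_exists F : (forall n, measurable [set x | F n x]) ->
  measurable [set x | exists n, F n x].
Proof.
move=> mF; rewrite (_ : mkset _ = \bigcup_n [set x | F n x]).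
  exact: bigcupT_measurable.
by apply/seteqP; split => x /= [n]; exists n.
Qed.

Lemma mset_existsc (I : countType) (F : I -> T -> Prop) :
  (forall i, measurable [set x | F i x]) -> measurable [set x | exists i, F i x].
Proof.
move=> mF; rewrite (_ : mkset _ = \bigcup_i [set x | F i x]).
  by apply: countable_bigcupT_measurable => //; exact: countableP.
by apply/seteqP; split => x /= [i]; exists i.
Qed.

Lemma mset_cst (Q : Prop) : measurable [set _ : T | Q].
Proof.
have [q|q] := pselect Q.
  by rewrite (_ : mkset _ = setT)//; apply/seteqP; split.
by rewrite (_ : mkset _ = set0)//; apply/seteqP; split.
Qed.

Lemma mset_imply (Q : Prop) A : measurable [set x | A x] ->
  measurable [set x | Q -> A x].
Proof.
move=> mA; have [q|q] := pselect Q.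
  rewrite (_ : mkset _ = [set x | A x])//.
  by apply/seteqP; split => x /= => [|H _]//; exact.
rewrite (_ : mkset _ = setT)//.
by apply/seteqP; split => // x _ /= /q.
Qed.
End measurable_events.

Section countable_partitions.
Context d (T : measurableType d) (R : realType).
Local Open Scope ereal_scope.

Lemma pickle_fiberE (I : countType) (Z : T -> I) k :
  (exists z, [set x | pickle (Z x) = k] = [set x | Z x = z]) \/
  [set x | pickle (Z x) = k] = set0.
Proof.
have [[x xk]|no] := pselect (exists x, pickle (Z x) = k); [left|right].
  exists (Z x); rewrite -xk; apply/seteqP; split => y /=; last by move->.
  exact: (pcan_inj pickleK).
by apply/seteqP; split => // x /= xk; apply: no; exists x.
Qed.

Lemma measure_fibers (I : countType) (mu : {measure set T -> \bar R})
    (Z : T -> I) (A : set T) : measurable A ->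
  (forall z, measurable [set x | Z x = z]) ->
  mu A = \sum_(k <oo) mu (A `&` [set x | pickle (Z x) = k]).
Proof.
move=> mA mZ.
have mk k : measurable (A `&` [set x | pickle (Z x) = k]).
  by apply: measurableI => //; have [[z ->]|->] := pickle_fiberE Z k.
have cov : \bigcup_k (A `&` [set x | pickle (Z x) = k]) = A.
  apply/seteqP; split => x; first by case => k _ [].
  by move=> Ax; exists (pickle (Z x)).
rewrite -[in LHS]cov measure_semi_bigcup ?cov//.
by apply/trivIsetP => i j _ _; apply: contra_neqP => /eqP/set0P [x [[_ /= <-] [_ <-]]].
Qed.

(** The law of total probability as a tool: an identity between two scaled measures need only be
    checked where a countable statistic, such as the history of the path or its first gap, has a
    fixed value. *)
Lemma eq_measure_fibers (I : countType) (mu1 mu2 : {measure set T -> \bar R})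
    (Z1 Z2 : T -> I) (A1 A2 : set T) (c1 c2 : R) :
  measurable A1 -> measurable A2 ->
  (forall z, measurable [set x | Z1 x = z]) ->
  (forall z, measurable [set x | Z2 x = z]) ->
  (forall z, c1%:E * mu1 (A1 `&` [set x | Z1 x = z]) =
             c2%:E * mu2 (A2 `&` [set x | Z2 x = z])) ->
  c1%:E * mu1 A1 = c2%:E * mu2 A2.
Proof.
move=> mA1 mA2 mZ1 mZ2 H.
rewrite (measure_fibers _ mA1 mZ1) (measure_fibers _ mA2 mZ2).
rewrite -!nneseriesZl//; apply: eq_eseriesr => k _.
case E : (unpickle k : option I) => [z|].
  have [pz|pz] := eqVneq (pickle z) k.
    have e (Z : T -> I) : [set x | pickle (Z x) = k] = [set x | Z x = z].
      apply/seteqP; split => y /=; last by move->.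
      by rewrite -pz; exact: (pcan_inj pickleK).
    by rewrite !e.
  have e (Z : T -> I) : [set x | pickle (Z x) = k] = set0.
    apply/seteqP; split => // y /= yk; move: E; rewrite -yk pickleK => -[zE].
    by move: pz; rewrite -zE yk eqxx.
  by rewrite !e !setI0 !measure0 !mule0.
have e (Z : T -> I) : [set x | pickle (Z x) = k] = set0.
  by apply/seteqP; split => // y /= yk; move: E; rewrite -yk pickleK.
by rewrite !e !setI0 !measure0 !mule0.
Qed.

End countable_partitions.

(** * Cylinders, histories and events of the past *)

Section path_events.
Implicit Types (X x : nat -> int) (n t : nat).

Lemma measurable_coord n (Q : int -> Prop) :
  measurable [set X : Path | Q (X n)].
Proof.
rewrite (_ : mkset _ = [set X : Path | exists k, Q k /\ X n = k]); last first.
  by apply/seteqP; split => X /= => [QX|[k [Qk ->]]//]; exists (X n).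
apply: mset_existsc => k; apply: mset_and; first exact: mset_cst.
by apply: sub_sigma_algebra; exists n, k.
Qed.

Definition cyl n x : set Path := [set X | forall k, (k <= n)%N -> X k = x k].

Definition stays (D : int -> bool) n t : set Path :=
  [set X | forall j, (n <= j <= n + t)%N -> D (X j)].

Definition hist n (X : nat -> int) : seq int := [seq X k | k <- iota 0 n.+1].

Lemma measurable_cyl n x : measurable (cyl n x).
Proof.
apply: mset_forall => k; apply: mset_imply.
exact: (measurable_coord k (fun z => z = x k)).
Qed.

Lemma measurable_stays D n t : measurable (stays D n t).
Proof.
apply: mset_forall => k; apply: mset_imply.
exact: (measurable_coord k (fun z => is_true (D z))).
Qed.

Lemma histE n X x : (hist n X = hist n x) <-> cyl n x X.
Proof.
split=> [/eq_in_map e k kn|e]; first by apply: e; rewrite mem_iota add0n ltnS.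
by apply/eq_in_map => k; rewrite mem_iota add0n ltnS => /e.
Qed.

Lemma hist_fiber n s : [set X : Path | hist n X = s] =
  if size s == n.+1 then cyl n (nth 0 s) else set0.
Proof.
case: eqP => [ss|ss]; apply/seteqP; split => X //=.
- move=> <- k kn; rewrite (nth_map 0%N) ?size_iota ?ltnS//.
  by rewrite nth_iota ?ltnS// add0n.
- move=> e; apply: (@eq_from_nth _ 0); first by rewrite size_map size_iota ss.
  rewrite size_map size_iota => i; rewrite ltnS => iN.
  by rewrite (nth_map 0%N) ?size_iota ?ltnS// nth_iota ?ltnS// add0n; exact: e.
- by move=> h; apply: ss; rewrite -h size_map size_iota.
Qed.

Lemma measurable_hist n s : measurable [set X : Path | hist n X = s].
Proof. by rewrite hist_fiber; case: ifP => // _; exact: measurable_cyl. Qed.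

Definition past n (B : set Path) :=
  forall X Y : Path, (forall k, (k <= n)%N -> X k = Y k) -> B X -> B Y.

(** Histories are finite lists of integers, so an event determined by the history is a countable
    union of its fibres. *)
Lemma measurable_past n B : past n B -> measurable B.
Proof.
move=> pB; rewrite (_ : B = [set X | exists s, (exists2 x, B x & hist n x = s) /\ hist n X = s]).
  apply: mset_existsc => s; apply: mset_and; first exact: mset_cst.
  exact: measurable_hist.
apply/seteqP; split => X /= => [BX|[s [[x Bx <-] /histE Xx]]].
  by exists (hist n X); split => //; exists X.
by apply: (pB x) => // k kn; rewrite Xx.
Qed.

End path_events.

(* The quenched probability, as a polynomial in the environment, that in t steps
   from x the walk enters A, having stayed in D before, or stays in D throughout. *)
Fixpoint apoly (D A : int -> bool) (t : nat) (x : int) : seq (seq (int * int)) :=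
  if A x then [:: [::]] else if ~~ D x then [::] else
  if t is t'.+1 then [seq (x, l) :: L | l <- [:: -1; 1; 2], L <- apoly D A t' (x + l)]
  else [:: [::]].

(** * Recursion, monotonicity, locality and translation of the survival polynomials *)

Section absorbing_polynomials.
Context (R : realType).
Implicit Types (w : env R) (D A : int -> bool).

Lemma pevalS D A t x w : peval (apoly D A t.+1 x) w =
  if A x then 1 else if D x then
  \sum_(l <- [:: -1; 1; 2]) w x l * peval (apoly D A t (x + l)) w else 0.
Proof.
rewrite [apoly _ _ _ _]/=; case: (A x); last case: (D x) => /=.
- by rewrite /peval big_seq1 /mono big_nil.
- rewrite /peval big_cat big_cat/= big_cat/= !big_map big_nil !big_cons big_nil.
  by rewrite !mulr_sumr; do ![congr (_ + _)]; apply: eq_bigr => L _; rewrite /mono big_cons.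
- by rewrite /peval big_nil.
Qed.

Lemma peval0 D A x w : peval (apoly D A 0 x) w = (A x || D x)%:R.
Proof.
rewrite /peval /=; case: (A x); last case: (D x) => /=.
- by rewrite big_seq1 /mono big_nil.
- by rewrite big_seq1 /mono big_nil.
- by rewrite big_nil.
Qed.

Lemma jump_sum w x : \sum_(l <- [:: -1; 1; 2]) w x l = 1.
Proof. by rewrite !big_cons big_nil addr0 addrA jump_sum1. Qed.

Lemma peval_le1 D A t x w : peval (apoly D A t x) w <= 1.
Proof.
elim: t x => [|t IH] x; first by rewrite peval0 lern1 leq_b1.
rewrite pevalS; case: ifP => // _; case: ifP => // _.
rewrite -(jump_sum w x); apply: ler_sum => l _.
by rewrite ler_piMr ?jump_ge0.
Qed.

(** A longer horizon shrinks the event. This monotonicity is what makes the limit [apot] exist. *)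
Lemma peval_nonincr D A t x w :
  peval (apoly D A t.+1 x) w <= peval (apoly D A t x) w.
Proof.
elim: t x => [|t IH] x.
  rewrite pevalS peval0; case: (A x) => //; case: (D x) => //=.
  rewrite -(jump_sum w x); apply: ler_sum => l _.
  by rewrite ler_piMr ?jump_ge0//; exact: (peval_le1 D A 0).
rewrite pevalS [in leRHS]pevalS; case: (A x) => //; case: (D x) => //.
by apply: ler_sum => l _; rewrite ler_wpM2l// jump_ge0.
Qed.

(** Only sites from which a jump is made enter the polynomial. This locality is the source of all
    independence between past and future. *)
Lemma psites_apoly D A t x i : i \in psites (apoly D A t x) -> D i.
Proof.
elim: t x => [|t IH] x.
  by rewrite /psites/=; case: (A x) => //; case: (D x).
rewrite /psites/=; case: (A x) => //; case Dx : (D x) => //=.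
rewrite cats0 !map_cat !flatten_cat !mem_cat -!map_comp.
have sub l : i \in flatten [seq ((map fst) \o cons (x, l)) L | L <- apoly D A t (x + l)] -> D i.
  move=> /flattenP [s /mapP[L Lin ->]] /=; rewrite inE => /orP[/eqP->//|iL].
  apply: (IH (x + l)); apply/flattenP; exists (map fst L) => //.
  exact: map_f.
by move=> /or3P[]; exact: sub.
Qed.

Lemma apoly_shift (c : int) D A D' A' : (forall i, D' (i + c) = D i) ->
  (forall i, A' (i + c) = A i) ->
  forall t x, apoly D' A' t (x + c) = shift_poly c (apoly D A t x).
Proof.
move=> HD HA; elim => [|t IH] x; rewrite /= HD HA.
  by case: ifP => //; case: ifP.
case: ifP => // _; case: ifP => // _.
rewrite /shift_poly !map_cat /=; do ![congr (_ ++ _)];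
  by rewrite addrAC IH /shift_poly -!map_comp; apply: eq_map => L.
Qed.

End absorbing_polynomials.

Definition path_mono (x : nat -> int) n : seq (int * int) :=
  [seq (x i, x i.+1 - x i) | i <- iota 0 n].

Definition upd (x : nat -> int) n y : nat -> int := fun k => if k == n then y else x k.

Lemma path_monoS x n :
  path_mono x n.+1 = rcons (path_mono x n) (x n, x n.+1 - x n).
Proof. by rewrite /path_mono -[in LHS]addn1 iotaD map_cat /= cats1. Qed.

Lemma path_mono_upd x n y :
  path_mono (upd x n.+1 y) n.+1 = rcons (path_mono x n) (x n, y - x n).
Proof.
rewrite path_monoS; congr (rcons _ _).
  apply/eq_in_map => i; rewrite mem_iota add0n => /= iN; have iN' : (i.+1 < n.+1)%N by [].
  by rewrite /upd (ltn_eqF iN') (ltn_eqF (ltnW iN')).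
by rewrite /upd eqxx ltn_eqF.
Qed.

(** * The quenched law of finite trajectories *)

Section quenched.
Context (R : realType) (K : R.-pker (Omega R) ~> Path).
Hypothesis hK : quenched_law K 0.
Local Open Scope ereal_scope.
Implicit Types (w : Omega R) (x : nat -> int) (n t : nat).

Lemma K_cyl w n x : x 0%N = 0%R -> K w (cyl n x) = (mono w (path_mono x n))%:E.
Proof.
move=> x0; elim: n => [|n IH].
  rewrite /mono big_nil -(hK w).1; congr (K w _); apply/seteqP; split => X /=.
    by move=> /(_ 0%N erefl); rewrite x0.
  by move=> X0 k; rewrite leqn0 => /eqP->; rewrite x0.
rewrite /cyl (hK w).2 -/(cyl n x) IH -EFinM; congr (_%:E).
by rewrite path_monoS -cats1 mono_cat [in RHS]/mono big_seq1.
Qed.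

Lemma K_cyl0 w n x : x 0%N != 0%R -> K w (cyl n x) = 0.
Proof.
move=> x0; apply/eqP; rewrite eq_le measure_ge0 andbT.
have mA : measurable [set X : Path | X 0%N <> 0%R].
  exact: (measurable_coord 0 (fun z => z <> 0%R)).
have <- : K w [set X : Path | X 0%N <> 0%R] = 0.
  have KT : K w [set: Path] = 1 by exact: prob_kernel.
  have : K w [set: Path] = K w ([set: Path] `\` [set X : Path | X 0%N = 0%R]) +
      K w ([set: Path] `&` [set X : Path | X 0%N = 0%R]).
    by apply: measureDI => //; exact: (measurable_coord 0 (fun z => z = 0%R)).
  rewrite KT setTI (hK w).1 setTD (_ : ~` _ = [set X : Path | X 0%N <> 0%R])//.
  by case: (K w _) => [r| |]//; rewrite -EFinD => -[H]; congr (_%:E); lra.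
apply: le_measure; rewrite ?inE//; first exact: measurable_cyl.
by move=> X /(_ 0%N (leq0n _)) /= ->; exact/eqP.
Qed.

Lemma measurable_jumps n :
  measurable [set X : Path | (X n.+1 - X n)%R \notin [:: -1; 1; 2]%R].
Proof.
rewrite (_ : mkset _ = [set X : Path | exists k : int, X n = k /\ (X n.+1 - k)%R \notin [:: -1; 1; 2]%R]).
  apply: mset_existsc => k.
  have H1 := measurable_coord n (fun z => z = k).
  have H2 := measurable_coord n.+1 (fun z => is_true ((z - k)%R \notin [:: -1; 1; 2]%R)).
  exact: (mset_and H1 H2).
by apply/seteqP; split => X /=; [exists (X n)|case=> k [->]].
Qed.

(** Summing over histories, each cylinder with a forbidden jump has a monomial with a vanishing
    factor. *)
Lemma K_jumps w n :
  K w [set X : Path | (X n.+1 - X n)%R \notin [:: -1; 1; 2]%R] = 0.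
Proof.
set A := mkset _; have mA : measurable A by exact: measurable_jumps.
rewrite (@measure_fibers _ _ _ _ (K w) (hist n.+1) A mA (measurable_hist _)).
apply: eseries0 => k _ _.
have [[s ->]|->] := pickle_fiberE (hist n.+1 : Path -> seq int) k; last first.
  by rewrite setI0 measure0.
rewrite hist_fiber; case: ifP => _; last by rewrite setI0 measure0.
set x := nth 0%R s; have [j|j] := boolP ((x n.+1 - x n)%R \in [:: -1; 1; 2]%R).
  rewrite (_ : _ `&` _ = set0) ?measure0//; apply/seteqP; split => // X [Xj H].
  by move: Xj; rewrite /A /= !H// j.
apply/eqP; rewrite eq_le measure_ge0 andbT.
have <- : K w (cyl n.+1 x) = 0.
  have [x0|x0] := eqVneq (x 0%N) 0%R; last exact: K_cyl0.
  rewrite K_cyl//; congr (_%:E).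
  by rewrite path_monoS -cats1 mono_cat {2}/mono big_seq1/= jump_out ?mulr0.
apply: le_measure; rewrite ?inE//; [apply: measurableI => //|]; exact: measurable_cyl.
Qed.

(** The Markov property in the form used below. The induction on [t] lengthens the prescribed
    history by the next jump and matches the recursion [pevalS]. *)
Lemma K_stays w (D : int -> bool) t n x : x 0%N = 0%R ->
  K w (cyl n x `&` stays D n t) =
  (mono w (path_mono x n) * peval (apoly D xpred0 t (x n)) w)%:E.
Proof.
elim: t n x => [|t IH] n x x0.
  rewrite peval0/=; case Dx : (D (x n)).
    rewrite mulr1 -K_cyl//; congr (K w _); apply/seteqP; split => X /=; [by case|move=> H1].
    by split => // j; rewrite addn0 -eqn_leq => /eqP <-; rewrite H1.
  rewrite mulr0 (_ : _ `&` _ = set0) ?measure0//; apply/seteqP; split => // X [H1 H2].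
  by have := H2 n; rewrite addn0 leqnn/= => /(_ erefl); rewrite H1// Dx.
rewrite pevalS/=; case Dx : (D (x n)); last first.
  rewrite mulr0 (_ : _ `&` _ = set0) ?measure0//; apply/seteqP; split => // X [H1 H2].
  by have := H2 n; rewrite leq_addr leqnn/= => /(_ erefl); rewrite H1// Dx.
set E := cyl n x `&` _.
pose F l := cyl n.+1 (upd x n.+1 (x n + l)%R) `&` stays D n.+1 t.
have mE : measurable E by apply: measurableI; [exact: measurable_cyl|exact: measurable_stays].
have mF l : measurable (F l) by apply: measurableI; [exact: measurable_cyl|exact: measurable_stays].
have KF l : K w (F l) = (mono w (path_mono x n) * (w (x n) l *
    peval (apoly D xpred0 t (x n + l)%R) w))%:E.
  rewrite /F IH//= path_mono_upd -cats1 mono_cat {2}/mono big_seq1/= addrAC subrr add0r.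
  by rewrite /upd eqxx mulrA.
rewrite big_distrr/= !big_cons big_nil addr0 !EFinD -!KF.
pose J := [set X : Path | (X n.+1 - X n)%R \notin [:: -1; 1; 2]%R].
have mJ : measurable J by exact: measurable_jumps.
have FE l X : F l X <-> E X /\ X n.+1 = (x n + l)%R.
  split=> [[H1 H2]|[[H1 H2] H3]].
    have H1' : cyl n x X.
      by move=> k kn; rewrite H1 ?leqW// /upd ltn_eqF.
    split; last by rewrite H1// /upd eqxx.
    split => // j; rewrite leq_eqVlt => /andP[/orP[/eqP<- _|nj jt]].
      by rewrite H1'.
    by apply: H2; rewrite nj addSnnS.
  split=> [k|j].
    by rewrite leq_eqVlt /upd => /orP[/eqP->|kn]; [rewrite eqxx|rewrite ltn_eqF//; exact: H1].
  by rewrite addSnnS => /andP[nj jt]; apply: H2; rewrite (ltnW nj) jt.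
(* Outside the null set [J] of forbidden jumps the next step has one of three values, which gives
   three disjoint pieces. *)
have EU : E `\` J = F (-1)%R `|` (F 1%R `|` F 2%R).
  apply/seteqP; split => X /=.
    move=> [EX /negP]; rewrite negbK !inE.
    have xn : X n = x n by case: EX => + _; apply.
    by move=> /or3P[] /eqP; rewrite xn => jE; [left|right;left|right;right];
      apply/FE; split => //; rewrite -jE; ring.
  have xn : E X -> X n = x n by case => + _; apply.
  by case=> [|[]] /FE [EX XE]; split => //; rewrite /J /= XE (xn EX) addrAC subrr add0r.
have -> : K w E = K w (E `\` J).
  rewrite (measureDI (K w) mE mJ) [X in _ + X](_ : _ = 0) ?adde0//.
  apply/eqP; rewrite eq_le measure_ge0 andbT -(K_jumps w n).
  by apply: le_measure; rewrite ?inE//; exact: measurableI.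
have dis l l' : l != l' -> F l `&` F l' = set0.
  move=> ll; apply/seteqP; split => // X [/FE[_ e1] /FE[_ e2]].
  by move: e2; rewrite e1 => /addrI e; rewrite e eqxx in ll.
rewrite EU measureU//; last by rewrite setIUr !dis// setU0.
  by rewrite measureU//; exact: dis.
exact: measurableU.
Qed.

End quenched.

(** * Restricted image measures and uniqueness of measures on paths *)

Section restricted_image.
Context d d' (T : measurableType d) (U : measurableType d') (R : realType).
Variables (mu : {measure set T -> \bar R}) (E : set T) (F : T -> U).
Local Open Scope ereal_scope.

(** The two measurability proofs are arguments so that the measure structure can be attached to this
    function. *)
Definition restricted_image (mE : measurable E) (mF : measurable_fun [set: T] F)
  (H : set U) := mu (E `&` F @^-1` H).

Variables (mE : measurable E) (mF : measurable_fun [set: T] F).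

Let restricted_image0 : restricted_image mE mF set0 = 0.
Proof. by rewrite /restricted_image preimage_set0 setI0 measure0. Qed.

Let restricted_image_ge0 A : 0 <= restricted_image mE mF A.
Proof. exact: measure_ge0. Qed.

Let restricted_image_sigma_additive : semi_sigma_additive (restricted_image mE mF).
Proof.
have mEF A : measurable A -> measurable (E `&` F @^-1` A).
  by move=> mA; apply: measurableI => //; rewrite -[X in measurable X]setTI; exact: mF.
move=> G mG tG mUG; rewrite /restricted_image preimage_bigcup setI_bigcupr.
apply: measure_semi_sigma_additive => [i||]; first exact: mEF.
  apply/trivIsetP => i j _ _ ij; apply/seteqP; split => // x [[_ Gi] [_ Gj]].
  have GG0 : G i `&` G j = set0 by move/trivIsetP : tG; exact.
  by have : (G i `&` G j) (F x) by []; rewrite GG0.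
by rewrite -setI_bigcupr -preimage_bigcup; exact: mEF.
Qed.

HB.instance Definition _ := isMeasure.Build _ _ _ (restricted_image mE mF)
  restricted_image0 restricted_image_ge0 restricted_image_sigma_additive.

End restricted_image.

Section path_uniqueness.
Context (R : realType).
Local Open Scope ereal_scope.

(** Together with the empty and the full set, the cylinders are stable under intersection, since two
    of them are nested or disjoint, and they generate the sigma-algebra. *)
Lemma path_measure_unique (m1 m2 : {measure set Path -> \bar R}) :
  (forall n x, m1 (cyl n x) = m2 (cyl n x)) -> m1 [set: Path] = m2 [set: Path] ->
  m1 [set: Path] < +oo -> forall A, measurable A -> m1 A = m2 A.
Proof.
move=> H HT m1oo.
pose G : set (set Path) := [set A | [\/ A = set0, A = setT | exists n x, A = cyl n x]].
apply: (measure_unique G (fun=> [set: Path])) => //.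
- apply/seteqP; split => A; last first.
    apply: smallest_sub => [|B]; first exact: sigma_algebra_measurable.
    by case=> [->|->|[n [x ->]]]//; exact: measurable_cyl.
  apply: smallest_sub; first exact: smallest_sigma_algebra.
  move=> _ [n [k ->]].
  rewrite (_ : mkset _ = [set X | exists s : seq int, nth 0%R s n = k /\ cyl n (nth 0%R s) X]); last first.
    apply/seteqP; split => X /=; last by move=> [s [<-]] /(_ n (leqnn n)).
    have nthX j : (j <= n)%N -> nth 0%R (hist n X) j = X j.
      by move=> jn; rewrite (nth_map 0%N) ?size_iota ?ltnS// nth_iota ?ltnS// add0n.
    by move=> Xn; exists (hist n X); split => [|j jn]; rewrite nthX.
  apply: (@mset_existsc _ (g_sigma_algebraType G) (seq int)) => s.
  apply: (@mset_and _ (g_sigma_algebraType G)); first exact: mset_cst.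
  by apply: sub_sigma_algebra; constructor 3; exists n, (nth 0%R s).
- move=> A B [->|->|[n [x ->]]]; rewrite ?set0I ?setTI; [by constructor 1|by []|].
  move=> [->|->|[m [y ->]]]; rewrite ?setI0 ?setIT.
  + by constructor 1.
  + by constructor 3; exists n, x.
  + have aux n' m' x' y' : (n' <= m')%N -> G (cyl n' x' `&` cyl m' y').
      move=> nm; have [e|ne] := pselect (forall j, (j <= n')%N -> y' j = x' j).
        constructor 3; exists m', y'; apply/seteqP; split => [X [_ //]|X Xy].
        by split => // j jn; rewrite Xy ?e// (leq_trans jn).
      constructor 1; apply/seteqP; split => // X [Xx Xy]; apply: ne => j jn.
      by rewrite -Xx// -Xy// (leq_trans jn).
    by have [/aux//|/ltnW/aux] := leqP n m; rewrite setIC.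
- by move=> _; constructor 2.
- by rewrite bigcup_const.
- by move=> A [->|->|[n [x ->]]]; rewrite ?measure0.
Qed.

End path_uniqueness.

(** * Regeneration at a skipped site *)

Section regeneration.
Context (R : realType) (P : probability (Omega R) R) (Q : probability Path R).
Hypothesis hiid : iid_sites P.
Hypothesis Q0 : Q [set X | X 0%N = 0] = 1%E.
Hypothesis Q_stays : forall (D : int -> bool) t n x, x 0%N = 0 ->
  Q (cyl n x `&` stays D n t) =
  (\int[P]_w (mono w (path_mono x n) * peval (apoly D xpred0 t (x n)) w)%:E)%E.
Implicit Types (X x y : nat -> int) (n t r : nat) (k : int) (B H : set Path).

Definition em x n : R := fine (emono P (path_mono x n)).

Definition esc n k : set Path := [set X | forall j, (n <= j)%N -> k < X j].

(** Recentring puts the skipped site at 0, so the future of a skip starts at 1 and stays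
    positive. *)
Definition Phi n k (X : Path) : Path := fun j => X (n + j)%N - k.

Definition frst k n x := (forall i, (i < n)%N -> x i < k) /\ x n = k + 1.

Definition Reg n k : set Path := [set X | frst k n X /\ esc n k X].

Lemma measurable_esc n k : measurable (esc n k).
Proof.
apply: mset_forall => j; apply: mset_imply.
exact: (measurable_coord j (fun z => is_true (k < z))).
Qed.

Lemma measurable_frst n k : measurable [set X : Path | frst k n X].
Proof.
apply: mset_and.
  apply: mset_forall => j; apply: mset_imply.
  exact: (measurable_coord j (fun z => is_true (z < k))).
exact: (measurable_coord n (fun z => z = k + 1)).
Qed.

Lemma measurable_Reg n k : measurable (Reg n k).
Proof. by apply: mset_and; [exact: measurable_frst|exact: measurable_esc]. Qed.

Lemma measurable_Phi n k : measurable_fun [set: Path] (Phi n k).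
Proof.
apply: (@measurability _ _ Path Path setT (Phi n k) path_cylinders) => //.
move=> _ [_ [j [z ->]] <-]; rewrite setTI.
exact: (measurable_coord (n + j) (fun a => a - k = z)).
Qed.

Lemma measurable_preimage_Phi n k H : measurable H -> measurable (Phi n k @^-1` H).
Proof. by move=> mH; rewrite -[X in measurable X]setTI; exact: measurable_Phi. Qed.

Definition glue n k x y : nat -> int := fun i => if (i <= n)%N then x i else y (i - n)%N + k.

Lemma path_mono_glue n k x y r : x n = y 0%N + k ->
  path_mono (glue n k x y) (n + r) = path_mono x n ++ shift_mono k (path_mono y r).
Proof.
move=> xy; rewrite /path_mono iotaD map_cat add0n; congr (_ ++ _).
  apply/eq_in_map => i; rewrite mem_iota add0n => /= iN.
  by rewrite /glue iN ltnW.
rewrite /shift_mono -map_comp -[n in iota n]addn0 iotaDl -map_comp.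
apply/eq_in_map => i; rewrite mem_iota add0n => /= ir.
have ltf j : ((n + j.+1 <= n) = false)%N by lia.
have subE j : (n + j - n = j)%N by lia.
rewrite /glue -addnS ltf !subE.
case: i ir => [|i] ir; first by rewrite addn0 leqnn xy; congr (_, _); ring.
by rewrite ltf; congr (_, _); ring.
Qed.

(** Expanded product of the weight of [y] up to time [r] and the probability of staying positive for
    [t] further steps. *)
Definition block y r t :=
  [seq path_mono y r ++ L | L <- apoly (fun z => 0 < z) xpred0 t (y r)].

(** All jumps of the past start below [k], all jumps of the future above [k], so the expectation
    factors; translation by [k] then makes the second factor independent of [n], [k] and [x]. *)
Lemma Q_block t n k x r y : x 0%N = 0 -> frst k n x -> y 0%N = 1 ->
  (forall i, (i <= r)%N -> 0 < y i) ->
  Q (cyl (n + r) (glue n k x y) `&` stays (fun z => k < z) (n + r) t) =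
  (emono P (path_mono x n) * epoly P (block y r t))%E.
Proof.
move=> x0 [xk xn] y0 yr.
have gn : glue n k x y (n + r)%N = y r + k.
  rewrite /glue; case: r {yr} => [|r]; first by rewrite addn0 leqnn xn y0 addrC.
  by rewrite -[X in (_ <= X)%N]addn0 leq_add2l/= addnC addnK.
rewrite Q_stays; last by rewrite /glue leq0n.
rewrite gn (apoly_shift (D := fun z => 0 < z) (A := xpred0)) //; last first.
  by move=> i; rewrite -subr_gt0 addrK.
rewrite path_mono_glue; last by rewrite xn y0 addrC.
transitivity (\int[P]_w (mono w (path_mono x n) * peval (shift_poly k (block y r t)) w)%:E)%E.
  apply: eq_integral => w _; congr (_%:E).
  rewrite mono_cat -mulrA; congr (_ * _).
  rewrite /peval /shift_poly /block !big_map mulr_sumr; apply: eq_bigr => L _.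
  by rewrite -mono_cat /shift_mono map_cat.
rewrite (epoly_indep hiid) ?(epoly_shift hiid)//.
move=> i /mapP[a /mapP[j]]; rewrite mem_iota add0n => /= jn -> ->/=.
apply/negP => /flattenP[_ /mapP[_ /mapP[L' /mapP[L Lin ->] ->] ->]].
move=> /mapP [b /mapP[c cin ->]/= e].
have ck : c.1 + k < k by rewrite -e; exact: xk.
suff : 0 < c.1 by lia.
move: cin; rewrite mem_cat => /orP[/mapP[i']|cL].
  by rewrite mem_iota add0n => /= i'r -> /=; apply: yr; exact: ltnW.
apply: (@psites_apoly (fun z => 0 < z) xpred0 t (y r)).
by apply/flattenP; exists (map fst L); rewrite map_f.
Qed.

(** The last set does not depend on [X]: it is full or empty, and empty precisely when [y]
    contradicts the escape. Escaping for ever becomes a decreasing intersection over the horizon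
    [t]. *)
Lemma esc_block n k x r y : frst k n x -> y 0%N = 1 ->
  cyl n x `&` esc n k `&` (Phi n k @^-1` cyl r y) =
  \bigcap_t (cyl (n + r) (glue n k x y) `&` stays (fun z => k < z) (n + r) t `&`
    [set X | forall i, (i <= r)%N -> 0 < y i]).
Proof.
move=> [xk xn] y0; apply/seteqP; split => X.
  move=> [[/= H1 H2] H3] t _; split; last first.
    by move=> i ir; rewrite -H3// /Phi subr_gt0 H2// leq_addr.
  split; last by move=> j /andP[nj _]; apply: H2; rewrite (leq_trans _ nj)// leq_addr.
  move=> i inr; rewrite /glue; case: leqP => [/H1//|ni].
  rewrite -H3 /Phi; last by lia.
  by rewrite subnKC ?(ltnW ni)// subrK.
move=> H.
have Hc i : (i <= n + r)%N -> X i = glue n k x y i by have [[+ _] _] := H 0%N Logic.I; apply.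
have Hs j : (n + r <= j)%N -> k < X j.
  by move=> nrj; have [[_ + _]] := H j Logic.I; apply; rewrite nrj leq_addl.
have yr i : (i <= r)%N -> 0 < y i by have [_ +] := H 0%N Logic.I; apply.
have Xy i : (i <= r)%N -> X (n + i)%N = y i + k.
  move=> ir; rewrite Hc ?leq_add2l// /glue; case: i ir => [|i] ir.
    by rewrite addn0 leqnn xn y0 addrC.
  have -> : (n + i.+1 <= n)%N = false by lia.
  by congr (y _ + _); lia.
split; first split.
- by move=> i iN; rewrite Hc ?(leq_trans iN) ?leq_addr// /glue iN.
- move=> j nj; have [rj|rj] := leqP (n + r) j; first exact: Hs.
  rewrite -(subnKC nj) Xy; last by lia.
  by rewrite ltrDr yr//; lia.
- by move=> i ir; rewrite /Phi Xy// addrK.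
Qed.

Lemma emE x n : emono P (path_mono x n) = (em x n)%:E.
Proof. by rewrite /em fineK// emono_fin. Qed.

Lemma block_cvg n k x r y : x 0%N = 0 -> frst k n x -> y 0%N = 1 ->
  (forall i, (i <= r)%N -> 0 < y i) ->
  ((emono P (path_mono x n) * epoly P (block y r t))%E @[t --> \oo] -->
     Q (cyl n x `&` esc n k `&` (Phi n k @^-1` cyl r y))).
Proof.
move=> x0 xf y0 yr; rewrite esc_block//.
under eq_fun do rewrite -(Q_block _ x0 xf y0 yr).
have -> : [set X : Path | forall i, (i <= r)%N -> 0 < y i] = setT.
  by rewrite -subTset.
under eq_bigcapr do rewrite setIT.
apply: nonincreasing_cvg_mu.
- by rewrite (le_lt_trans (probability_le1 Q _)) ?ltry//; apply: measurableI;
    [exact: measurable_cyl|exact: measurable_stays].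
- by move=> t; apply: measurableI; [exact: measurable_cyl|exact: measurable_stays].
- by apply: bigcapT_measurable => t; apply: measurableI; [exact: measurable_cyl|exact: measurable_stays].
- move=> s t st; apply/subsetPset => X [H1 H2]; split => // i /andP[i1 i2].
  by apply: H2; rewrite i1 (leq_trans i2)// leq_add2l.
Qed.

Lemma esc_start m z j : frst j m z -> cyl m z `&` esc m j `&` Phi m j @^-1` setT =
    cyl m z `&` esc m j `&` Phi m j @^-1` cyl 0 (fun=> 1).
Proof.
move=> [_ zf]; apply/seteqP; split => X [[cX eX] _]; split => // i.
by rewrite leqn0 => /eqP ->; rewrite /Phi addn0 cX// zf addrAC subrr add0r.
Qed.

(** Both probabilities are limits with the same factor [epoly P (block y r t)]. Cross-multiplying
    avoids a division by a weight [em] that may vanish. *)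
Lemma ren_cyl n k x n' k' x' r y : x 0%N = 0 -> frst k n x ->
  x' 0%N = 0 -> frst k' n' x' ->
  ((em x' n')%:E * Q (cyl n x `&` esc n k `&` (Phi n k @^-1` cyl r y)) =
   (em x n)%:E * Q (cyl n' x' `&` esc n' k' `&` (Phi n' k' @^-1` cyl r y)))%E.
Proof.
move=> x0 xf x0' xf'.
have [y0|y0] := eqVneq (y 0%N) 1; last first.
  suff e m j z : frst j m z -> cyl m z `&` esc m j `&` (Phi m j @^-1` cyl r y) = set0.
    by rewrite !e// measure0 !mule0.
  move=> [_ zf]; apply/seteqP; split => // X [[H1 _] H2].
  move/eqP: y0; apply; rewrite -H2// /Phi addn0 H1// zf; ring.
have [yr|yr] := pselect (forall i, (i <= r)%N -> 0 < y i); last first.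
  suff e m j z : frst j m z -> cyl m z `&` esc m j `&` (Phi m j @^-1` cyl r y) = set0.
    by rewrite !e// measure0 !mule0.
  move=> [_ zf]; apply/seteqP; split => // X [[_ H1] H2].
  by apply: yr => i ir; rewrite -H2// /Phi subr_gt0 H1// leq_addr.
have := block_cvg x0 xf y0 yr; have := block_cvg x0' xf' y0 yr.
rewrite !emE => L1' L2'.
have L1 := cvgeZl (erefl : (em x n)%:E \is a fin_num) L1'.
have L2 := cvgeZl (erefl : (em x' n')%:E \is a fin_num) L2'.
rewrite -(cvg_lim _ L1)// -(cvg_lim _ L2)//.
by congr (limn _); apply/funext => t; rewrite muleCA.
Qed.

Definition x02 : nat -> int := fun i => if i == 0%N then 0 else 2.

Lemma frst_x02 : frst 1 1 x02.
Proof. by split => // i; rewrite ltnS leqn0 => /eqP ->. Qed.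

(* By [renewal] below the future of a skip has the same law for all skips, so the
   skip of site 1 by a first jump from 0 to 2 is enough to define it. *)
Definition palm (H : set Path) := Q (Reg 1 1 `&` (Phi 1 1 @^-1` H)).

Lemma Q_start (A : set Path) : measurable A -> Q A = Q (A `&` [set X | X 0%N = 0]).
Proof.
move=> mA; have mS := measurable_coord 0 (fun z => z = 0).
have mS' := measurable_coord 0 (fun z => z <> 0).
rewrite (measureDI Q mA mS) -[RHS]add0e; congr (_ + _)%E.
apply/eqP; rewrite eq_le measure_ge0 andbT.
have <- : Q (~` [set X : Path | X 0%N = 0]) = 0%E.
  by rewrite probability_setC// Q0 subee.
by apply: le_measure; rewrite ?inE; [exact: measurableD|exact: measurableC|move=> X []].
Qed.

Lemma palmE H : measurable H ->
  palm H = Q (cyl 1 x02 `&` esc 1 1 `&` (Phi 1 1 @^-1` H)).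
Proof.
move=> mH; have mP := measurable_preimage_Phi 1 1 mH.
rewrite /palm Q_start; last by apply: measurableI => //; exact: measurable_Reg.
rewrite [RHS]Q_start; last first.
  apply: measurableI => //; apply: measurableI; first exact: measurable_cyl.
  exact: measurable_esc.
congr (Q _); apply/seteqP; split => X.
  move=> [[[[_ X1] eX] HX] X0]; split => //; split => //; split => //.
  by move=> -[|[|i]]// _; rewrite ?X0 ?X1.
move=> [[[cX eX] HX] X0]; split => //; split => //; split => //; split.
  by move=> i; rewrite ltnS leqn0 => /eqP ->; rewrite X0.
by rewrite cX.
Qed.

(** As functions of [H] both sides are finite measures that agree on cylinders by [ren_cyl]. Their
    total masses agree because, by [esc_start], the full space may be replaced by the cylinder of
    paths from 1. *)
Lemma ren_meas n k x H : x 0%N = 0 -> frst k n x -> measurable H ->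
  ((em x02 1)%:E * Q (cyl n x `&` esc n k `&` (Phi n k @^-1` H)) =
   (em x n)%:E * palm H)%E.
Proof.
move=> x0 xf mH; rewrite palmE//.
have mE m z j : measurable (cyl m z `&` esc m j).
  by apply: measurableI; [exact: measurable_cyl|exact: measurable_esc].
have em0 z m : 0 <= em z m by rewrite -lee_fin -emE emono_ge0.
pose m1 := mscale (NngNum (em0 x02 1%N)) (restricted_image Q (mE n x k) (measurable_Phi n k)).
pose m2 := mscale (NngNum (em0 x n)) (restricted_image Q (mE 1%N x02 1) (measurable_Phi 1 1)).
have H12 r y : m1 (cyl r y) = m2 (cyl r y) by apply: ren_cyl => //; exact: frst_x02.
have ET := esc_start.
apply: (@path_measure_unique _ m1 m2) => //.
  transitivity (m1 (cyl 0 (fun=> 1))); first by congr (_ * Q _)%E; exact: ET.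
  transitivity (m2 (cyl 0 (fun=> 1))); first exact: H12.
  by congr (_ * Q _)%E; apply/esym/ET; exact: frst_x02.
rewrite /m1 /= /mscale /restricted_image /=; apply: lte_mul_pinfty => //.
  by rewrite lee_fin.
apply: (@le_lt_trans _ _ 1%E); last exact: ltry.
by apply: probability_le1; apply: measurableI => //; exact: measurable_preimage_Phi.
Qed.

Lemma palm_fin H : measurable H -> palm H \is a fin_num.
Proof.
move=> mH; apply: fin_num_measure; apply: measurableI; first exact: measurable_Reg.
exact: measurable_preimage_Phi.
Qed.

Hypothesis em02 : 0 < em x02 1.

(** On a single admissible history, [ren_meas] for [H] and for [setT] gives both sides with the same
    weight [em x n], and [em x02 1] cancels. Summing over histories inserts the past event [B]. *)
Lemma renewal n k B H : past n B -> measurable H ->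
  ((fine (palm setT))%:E * Q (B `&` Reg n k `&` (Phi n k @^-1` H)) =
   (fine (palm H))%:E * Q (B `&` Reg n k))%E.
Proof.
move=> pB mH.
have mB := measurable_past pB.
have mPH := measurable_preimage_Phi n k mH.
have mR := measurable_Reg n k.
apply: (@eq_measure_fibers _ _ _ _ Q Q (hist n) (hist n)).
- by apply: measurableI => //; exact: measurableI.
- exact: measurableI.
- exact: measurable_hist.
- exact: measurable_hist.
move=> s; rewrite hist_fiber; case: ifP => _; last by rewrite !setI0 measure0 !mule0.
suff H0 x : ((fine (palm setT))%:E * Q (B `&` Reg n k `&` (Phi n k @^-1` H) `&` cyl n x) =
   (fine (palm H))%:E * Q (B `&` Reg n k `&` cyl n x))%E by exact: H0.
have [x0|x0] := eqVneq (x 0%N) 0; last first.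
  suff e A : measurable A -> Q (A `&` cyl n x) = 0%E.
    by rewrite !e ?mule0//; apply: measurableI => //; exact: measurableI.
  move=> mA; rewrite Q_start; last by apply: measurableI => //; exact: measurable_cyl.
  rewrite (_ : _ `&` _ = set0) ?measure0//; apply/seteqP; split => // X [[_ cX] X0].
  by move: x0; rewrite -cX// X0 eqxx.
have [Bx|Bx] := pselect (B x); last first.
  suff e A : B `&` A `&` cyl n x = set0.
    by rewrite -(setIA B) !e measure0 !mule0.
  apply/seteqP; split => // X [[BX _] cX]; apply: Bx.
  by apply: (pB X) => // i iN; rewrite cX.
have [xf|xf] := pselect (frst k n x); last first.
  have e : Reg n k `&` cyl n x = set0.
    apply/seteqP; split => // X [[[X1 X2] _] cX]; apply: xf; split.
      by move=> i iN; rewrite -cX ?X1// ltnW.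
    by rewrite -cX.
  by rewrite setIAC -(setIA B) e setI0 set0I measure0 !mule0.
have eR : B `&` Reg n k `&` cyl n x = cyl n x `&` esc n k.
  apply/seteqP; split => X; first by move=> [[_ [_ ?]] ?].
  move=> [cX eX]; split => //; split; first by apply: (pB x) => // i iN; rewrite cX.
  split => //; case: xf => xf1 xf2; split; last by rewrite cX.
  by move=> i iN; rewrite cX ?xf1// ltnW.
rewrite setIAC eR.
have em0 : (em x02 1)%:E != 0%E by rewrite eqe gt_eqF.
have R1 := ren_meas x0 xf mH.
have R2 := ren_meas x0 xf (@measurableT _ Path).
rewrite preimage_setT setIT in R2.
have mE : measurable (cyl n x `&` esc n k).
  by apply: measurableI; [exact: measurable_cyl|exact: measurable_esc].
have mEP : measurable (cyl n x `&` esc n k `&` Phi n k @^-1` H) by exact: measurableI.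
move: R1 R2.
rewrite -(fineK (palm_fin mH)) -(fineK (palm_fin (@measurableT _ Path))).
rewrite -(fineK (fin_num_measure Q _ mE)) -(fineK (fin_num_measure Q _ mEP)).
rewrite -!EFinM => -[R1] -[R2]; congr (_%:E) => /=.
apply: (mulfI (lt0r_neq0 em02)).
by rewrite mulrCA R1 [RHS]mulrCA R2; ring.
Qed.

End regeneration.

(** * A maximal inequality for sums of i.i.d. gaps *)

Section maximal_inequality.
Context d (T : measurableType d) (R : realType) (M : probability T R).
Variables (theta : T -> T) (sigma : T -> nat).
Hypothesis mtheta : measurable_fun [set: T] theta.
Hypothesis msigma : measurable_fun [set: T] sigma.
Hypothesis indep : forall s H, measurable H ->
  M ([set x | sigma x = s] `&` theta @^-1` H) =
  (M [set x | sigma x = s] * M H)%E.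

Let mfib s : measurable [set x | sigma x = s].
Proof.
have := msigma measurableT (I : measurable [set s]).
by rewrite setTI.
Qed.

Let mpre H : measurable H -> measurable (theta @^-1` H).
Proof. by move=> mH; rewrite -[X in measurable X]setTI; exact: mtheta. Qed.

Let indepB (B : set nat) H : measurable H ->
  M (theta @^-1` H `&` (sigma @^-1` B)) = (M (sigma @^-1` B) * M H)%E.
Proof.
move=> mH; have mB : measurable (sigma @^-1` B).
  by rewrite -[X in measurable X]setTI; exact: msigma.
have fH : M H \is a fin_num by exact: fin_num_measure.
rewrite -[LHS]mul1e -(fineK fH) [RHS]muleC.
apply: (@eq_measure_fibers _ _ _ _ M M sigma sigma) => //.
  by apply: measurableI => //; exact: mpre.
move=> s.
suff H0 : (1%:E * M (theta @^-1` H `&` sigma @^-1` B `&` [set x | sigma x = s]) =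
    (fine (M H))%:E * M (sigma @^-1` B `&` [set x | sigma x = s]))%E by exact: H0.
have [Bs|Bs] := pselect (B s).
  rewrite mul1e (_ : _ `&` _ = [set x | sigma x = s] `&` theta @^-1` H).
    rewrite indep// muleC; congr (_ * _)%E; first by rewrite fineK.
    by congr (M _); apply/seteqP; split => [x /= xs|x []//]; split => //=; rewrite xs.
  by apply/seteqP; split => [x [[? _]]//|x [/= xs ?]]; split => //; split => //=; rewrite xs.
have e : sigma @^-1` B `&` [set x | sigma x = s] = set0.
  by apply/seteqP; split => // x [/= Bx xs]; apply: Bs; rewrite -xs.
by rewrite -setIA e setI0 measure0 !mule0.
Qed.

Let preserve H : measurable H -> M (theta @^-1` H) = M H.
Proof.
move=> mH; have := indepB setT mH.
have MT : M [set: T] = 1%E by exact: probability_setT.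
by rewrite preimage_setT setIT MT mul1e.
Qed.

Lemma integral_theta (u : T -> R) : measurable_fun [set: T] u ->
  (forall x, 0 <= u x) ->
  (\int[M]_x (u (theta x))%:E = \int[M]_x (u x)%:E)%E.
Proof.
move=> mu u0.
have mu' : measurable_fun [set: T] (EFin \o u) by exact/measurable_EFinP.
have u0' : {in [set: T], forall x, (0 <= (EFin \o u) x)%E}.
  by move=> x _ /=; rewrite lee_fin.
have := ge0_integral_pushforward mtheta M measurableT mu' u0'.
rewrite preimage_setT => /= <-.
by apply: eq_measure_integral => A mA _; apply: (preserve mA).
Qed.

Variable phi : nat -> R.
Let f x := phi (sigma x).
Hypothesis fint : M.-integrable [set: T] (EFin \o f).

Let mf : measurable_fun [set: T] f.
Proof. by apply/measurable_EFinP; exact: measurable_int fint. Qed.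

(** The maximum of the partial sums of [f] along [theta] with at most [n] terms, the empty sum
    included; splitting off the first term gives this recursion. *)
Fixpoint runmax n x : R :=
  if n is n'.+1 then Num.max 0 (f x + runmax n' (theta x)) else 0.

Let runmax_ge0 n x : 0 <= runmax n x.
Proof. by case: n => [|n] //=; rewrite le_max lexx. Qed.

Let measurable_runmax n : measurable_fun [set: T] (runmax n).
Proof.
elim: n => [|n IH] /=; first exact: measurable_cst.
apply: measurable_maxr; first exact: measurable_cst.
by apply: measurable_funD => //; exact: measurableT_comp.
Qed.

Let runmax_nondec n x : runmax n x <= runmax n.+1 x.
Proof.
elim: n x => [|n IH] x; first exact: runmax_ge0.
rewrite [leLHS]/= [leRHS]/= ge_max le_max lexx /= le_max; apply/orP; right.
by rewrite lerD2l IH.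
Qed.

Let runmax_abs n x : `|runmax n.+1 x - runmax n (theta x)| <= `|f x|.
Proof.
rewrite /=; have := runmax_ge0 n (theta x); set a := runmax _ _ => a0.
have [fa|fa] := leP 0 (f x + a); first by rewrite addrK.
rewrite sub0r normrN ger0_norm// ler0_norm; lra.
Qed.

Let integrable_theta (u : T -> R) : (forall x, 0 <= u x) ->
  M.-integrable [set: T] (EFin \o u) ->
  M.-integrable [set: T] (EFin \o (u \o theta)).
Proof.
move=> u0 /integrableP[mu uoo].
have mu' : measurable_fun [set: T] u by exact/measurable_EFinP.
apply/integrableP; split; first by apply/measurable_EFinP; exact: measurableT_comp.
move: uoo; under eq_integral => x _ do rewrite /= ger0_norm//.
by under [in X in _ -> X]eq_integral => x _ do rewrite /= ger0_norm//; rewrite integral_theta.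
Qed.

Let integrable_runmax n : M.-integrable [set: T] (EFin \o runmax n).
Proof.
elim: n => [|n IH].
  apply: (@eq_integrable _ _ _ M setT measurableT (cst 0%E)) => //.
  exact: integrable0.
have IHt := integrable_theta (runmax_ge0 n) IH.
pose af x := `|f x|.
have fabs : M.-integrable [set: T] ((EFin \o af) \+ (EFin \o (runmax n \o theta)))%E.
  apply: integrableD => //; exact: integrable_norm fint.
apply: le_integrable fabs => //; first by apply/measurable_EFinP.
move=> x _; rewrite /= lee_fin [leLHS]ger0_norm ?le_max ?lexx//.
rewrite [leRHS]ger0_norm ?addr_ge0 ?normr_ge0//.
by rewrite ge_max addr_ge0 ?normr_ge0//= lerD2r ler_norm.
Qed.

Definition unbounded : set T := [set x | forall K : nat, exists n, K%:R <= runmax n x].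

Lemma measurable_unbounded : measurable unbounded.
Proof.
apply: mset_forall => K; apply: mset_exists => n.
have := @measurable_runmax n measurableT `[K%:R, +oo[%classic (measurable_itv _).
rewrite setTI (_ : _ @^-1` _ = [set x | K%:R <= runmax n x])//.
by apply/seteqP; split => x /=; rewrite in_itv/= andbT.
Qed.

(** Removing the first term changes the running maximum by at most [|f x|], by [runmax_abs]. *)
Let unbounded_theta x : unbounded x <-> unbounded (theta x).
Proof.
split=> H K.
  have [m mK] : exists m : nat, K%:R + `|f x| <= m%:R.
    by exists (Num.bound (K%:R + `|f x|)); apply: ltW; apply: archi_boundP; rewrite addr_ge0.
  have [[|n] nK] := H m.+1.
    by move: nK; rewrite /= lern0.
  exists n; have := runmax_abs n x; rewrite ler_norml => /andP[_].
  by have := ler_norm (f x); move: nK; rewrite -natr1; lra.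
have [m mK] : exists m : nat, K%:R + `|f x| <= m%:R.
  by exists (Num.bound (K%:R + `|f x|)); apply: ltW; apply: archi_boundP; rewrite addr_ge0.
have [n nK] := H m; exists n.+1.
by have := runmax_abs n x; rewrite ler_norml => /andP[+ _]; lra.
Qed.

Let runmax_homo x : {homo (fun n => runmax n x) : m n / (m <= n)%N >-> m <= n}.
Proof. by apply: homo_leq => // a b c; exact: le_trans. Qed.

(** By invariance [unbounded] is the event that [theta x] lies in it, hence independent of [sigma].
    Positive and negative parts are treated separately because [ge0_integral_indep] needs a sign. *)
Let integral_unbounded :
  (\int[M]_(x in unbounded) f x = fine (M unbounded) * \int[M]_x f x)%R.
Proof.
have mU := measurable_unbounded.
pose pp := fun s => Num.max (phi s) 0; pose pm := fun s => Num.max (- phi s) 0.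
have phiE s : phi s = pp s - pm s.
    by rewrite /pp /pm; have [a|a] := leP (phi s) 0; have [b|b] := leP (- phi s) 0; lra.
have half (g : nat -> R) : (forall s, 0 <= g s <= `|phi s|) ->
    (\int[M]_(x in unbounded) g (sigma x) = fine (M unbounded) * \int[M]_x g (sigma x))%R /\
    M.-integrable [set: T] (EFin \o (g \o sigma)).
  move=> gb; have mg : measurable_fun [set: nat] g by [].
  have mgs : measurable_fun [set: T] (g \o sigma) by exact: measurableT_comp.
  have ig : M.-integrable [set: T] (EFin \o (g \o sigma)).
    apply: le_integrable fint => //; first exact/measurable_EFinP.
    by move=> x _; rewrite /= lee_fin; have /andP[g0 g1] := gb (sigma x); rewrite ger0_norm.
  split => //.
  have fU : M unbounded \is a fin_num by exact: fin_num_measure.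
  have U0 x : 0 <= (\1_unbounded : T -> R) x by rewrite indicE.
  have c0 : 0 <= fine (M unbounded) by rewrite fine_ge0.
  have g0 s : 0 <= g s by have /andP[] := gb s.
  have HB (B : set nat) : measurable B ->
      (\int[M]_(x in setT `&` sigma @^-1` B) (\1_unbounded x)%:E =
       (fine (M unbounded))%:E * M (sigma @^-1` B))%E.
    move=> mB; rewrite setTI integral_indic//; last first.
      by rewrite -[X in measurable X]setTI; exact: msigma.
    rewrite fineK// muleC -indepB//; congr (M (_ `&` _)).
    apply/seteqP; split => x Ux.
      exact: (proj1 (unbounded_theta x) Ux).
    exact: (proj2 (unbounded_theta x) Ux).
  have mI : measurable_fun [set: T] (\1_unbounded : T -> R) by exact: measurable_indic.
  have := ge0_integral_indep measurableT mI U0 msigma c0 HB mg g0.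
  move=> /(congr1 fine); rewrite fineM//; last exact: integrable_fin_num ig.
  rewrite /Rintegral /= => <-; congr fine.
  rewrite [LHS]integral_mkcond; apply: eq_integral => x _.
  by rewrite epatch_indic/= -EFinM mulrC.
have [|Hp ip] := half pp.
  by move=> s; rewrite /pp le_max lexx orbT ge_max ler_norm normr_ge0.
have [|Hm im] := half pm.
  by move=> s; rewrite /pm le_max lexx orbT ge_max -normrN ler_norm normr_ge0.
transitivity (\int[M]_(x in unbounded) (pp (sigma x) - pm (sigma x)))%R.
  by apply: eq_Rintegral => x _; exact: phiE.
rewrite RintegralB//; last 2 first.
- exact: integrableS ip.
- exact: integrableS im.
rewrite Hp Hm -mulrBr; congr (_ * _).
rewrite -RintegralB//; apply: eq_Rintegral => x _; exact/esym/phiE.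
Qed.

(** The integral of [f] over [unbounded] is nonnegative by the argument of the maximal ergodic
    theorem, yet equals [M unbounded] times a negative mean. *)
Theorem unbounded_null : (\int[M]_x f x < 0)%R -> M unbounded = 0%E.
Proof.
move=> fneg; have mU := measurable_unbounded.
have fU : M unbounded \is a fin_num by exact: fin_num_measure.
suff H : (0 <= \int[M]_(x in unbounded) f x)%R.
  move: H; rewrite integral_unbounded => H.
  have : 0 <= fine (M unbounded) by rewrite fine_ge0.
  rewrite le_eqVlt => /orP[/eqP U0|U0]; first by rewrite -(fineK fU) -U0.
  by move: H; rewrite pmulr_rge0// leNgt fneg.
pose g n x := runmax n.+1 x - runmax n (theta x).
have mg n : measurable_fun [set: T] (g n).
  by apply: measurable_funB => //; exact: measurableT_comp.
have irt n : M.-integrable [set: T] (EFin \o (runmax n \o theta)).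
  exact: integrable_theta.
(* Invariance of the measure and of [unbounded] removes [theta], and [runmax] increases with [n]. *)
have g_ge0 n : (0 <= \int[M]_(x in unbounded) g n x)%R.
  rewrite /g RintegralB//; last 2 first.
  - exact: integrableS (integrable_runmax n.+1).
  - exact: integrableS (irt n).
  have -> : \int[M]_(x in unbounded) runmax n (theta x) = \int[M]_(x in unbounded) runmax n x.
    rewrite /Rintegral; congr fine; rewrite integral_mkcond [RHS]integral_mkcond.
    under eq_integral do rewrite epatch_indic/= -EFinM.
    under [RHS]eq_integral do rewrite epatch_indic/= -EFinM.
    rewrite -(integral_theta (u := fun x => runmax n x * \1_unbounded x)).
    - apply: eq_integral => x _; congr ((_ * _)%:E).
      rewrite !indicE; congr ((nat_of_bool _) %:R); apply/idP/idP; rewrite !inE => Ux.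
        exact: (proj1 (unbounded_theta x) Ux).
      exact: (proj2 (unbounded_theta x) Ux).
    - by apply: measurable_funM.
    - by move=> x; rewrite mulr_ge0// indicE.
  rewrite subr_ge0; apply: le_Rintegral => //.
  - exact: integrableS (integrable_runmax n).
  - exact: integrableS (integrable_runmax n.+1).
(* On [unbounded] the maximum with 0 is eventually inactive, so [g n x = f x] for large [n]; [|f|]
   dominates throughout. *)
have cvgg : (\int[M]_(x in unbounded) (g n x)%:E)%E @[n --> \oo] -->
    (\int[M]_(x in unbounded) (f x)%:E)%E.
  pose af x := `|f x|.
  have mUf (h : T -> R) : measurable_fun [set: T] h -> measurable_fun unbounded (EFin \o h).
    by move=> mh; apply: (measurable_funS measurableT) => //; exact/measurable_EFinP.
  have [||||//|_ _ //] := @dominated_convergence _ _ _ M unbounded mU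
     (fun n => EFin \o g n) (EFin \o f) (EFin \o af).
  - by move=> n; exact: mUf.
  - exact: mUf.
  - apply: aeW => x Ux; apply: cvg_near_cst.
    have [n0 n0K] : exists n0, `|f x| <= runmax n0 (theta x).
      have [n0 H] := proj1 (unbounded_theta x) Ux (Num.bound `|f x|).
      exists n0; apply: le_trans H; apply: ltW; apply: archi_boundP; exact: normr_ge0.
    exists n0 => // n /= n0n; congr (_%:E); rewrite /g /=.
    have H : `|f x| <= runmax n (theta x) by apply: le_trans n0K _; exact: runmax_homo.
    have fx : 0 <= f x + runmax n (theta x) by move: H; rewrite ler_norml => /andP[]; lra.
    by rewrite (elimT max_idPr fx) addrK.
  - apply: (@integrableS _ _ _ _ setT) => //; exact: integrable_norm fint.
  - by apply: aeW => x n Ux; rewrite /= lee_fin runmax_abs.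
have fin_g : (\int[M]_(x in unbounded) (f x)%:E)%E \is a fin_num.
  by apply: integrable_fin_num => //; exact: integrableS fint.
rewrite /Rintegral fine_ge0//; apply: (cvge_ge _ cvgg); apply: nearW => n.
have ign : (\int[M]_(x in unbounded) (g n x)%:E)%E \is a fin_num.
  apply: integrable_fin_num => //; apply: (@integrableS _ _ _ _ setT) => //.
  exact: (@integrableB _ _ _ _ _ measurableT (EFin \o runmax n.+1) (EFin \o (runmax n \o theta))).
by rewrite -(fineK ign) lee_fin; exact: g_ge0.
Qed.

Lemma sum_le_runmax n x : \sum_(i < n) f (iter i theta x) <= runmax n x.
Proof.
elim: n x => [|n IH] x; first by rewrite big_ord0.
rewrite big_ord_recl /= le_max; apply/orP; right; rewrite lerD2l.
by under eq_bigr do rewrite -iterS iterSr; exact: IH.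
Qed.

Lemma bounded_sums x : ~ unbounded x ->
  exists C : R, forall n, \sum_(i < n) f (iter i theta x) <= C.
Proof.
move=> /existsNP[K H]; exists K%:R => n; rewrite leNgt; apply/negP => nK.
by apply: H; exists n; apply: ltW (lt_le_trans nK _); exact: sum_le_runmax.
Qed.

Lemma ae_bounded_sums : (\int[M]_x f x < 0)%R ->
  {ae M, forall x, exists C : R, forall n, \sum_(i < n) phi (sigma (iter i theta x)) <= C}.
Proof.
move=> fneg; exists unbounded; split; [exact: measurable_unbounded|exact: unbounded_null|].
by move=> x; apply: contra_notP => ub; exact: bounded_sums ub.
Qed.

End maximal_inequality.

Lemma mnormalize_EFin d (T : measurableType d) (R : realType)
    (mu : {measure set T -> \bar R}) (P : probability T R) (c : R) U :
  0 < c -> mu [set: T] = c%:E -> mnormalize mu P U = (mu U * (c^-1)%:E)%E.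
Proof. by move=> c0 E; rewrite /mnormalize E eqe gt_eqF. Qed.

(** * The Palm measure and its own regeneration property *)

Section palm_measure.
Context (R : realType) (Q : probability Path R).
Hypothesis hren : forall n k B H, past n B -> measurable H ->
  ((fine (palm Q setT))%:E * Q (B `&` Reg n k `&` (Phi n k @^-1` H)) =
   (fine (palm Q H))%:E * Q (B `&` Reg n k))%E.
Hypothesis palm_gt0 : 0 < fine (palm Q setT).
Implicit Types (n s : nat) (k : int) (B H : set Path).

(** The final [Q] is the default of [mnormalize] for a measure that cannot be normalized; [palm_gt0]
    rules this case out. *)
Definition Qpalm : probability Path R :=
  mnormalize (restricted_image Q (measurable_Reg 1 1) (measurable_Phi 1 1)) Q.

Lemma palm_fin_num H : measurable H -> palm Q H \is a fin_num.
Proof.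
move=> mH; apply: fin_num_measure; apply: measurableI; first exact: measurable_Reg.
exact: measurable_preimage_Phi.
Qed.

Lemma QpalmE H : measurable H -> Qpalm H = (fine (palm Q H) / fine (palm Q setT))%:E.
Proof.
move=> mH.
rewrite [LHS](@mnormalize_EFin _ _ _ _ _ (fine (palm Q setT)))//; last first.
  by rewrite fineK//; exact: palm_fin_num.
by rewrite EFinM fineK//; exact: palm_fin_num.
Qed.

Definition regen (M M0 : set Path -> \bar R) := forall n k B H, past n B ->
  measurable H ->
  M (B `&` Reg n k `&` (Phi n k @^-1` H)) = (M (B `&` Reg n k) * M0 H)%E.

Lemma regenQ : regen Q Qpalm.
Proof.
move=> n k B H pB mH; have := hren k pB mH.
have mBR : measurable (B `&` Reg n k).
  by apply: measurableI; [exact: measurable_past pB|exact: measurable_Reg].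
have mBRP : measurable (B `&` Reg n k `&` Phi n k @^-1` H).
  by apply: measurableI => //; exact: measurable_preimage_Phi.
rewrite QpalmE// -(fineK (fin_num_measure Q _ mBR)) -(fineK (fin_num_measure Q _ mBRP)).
rewrite -!EFinM => -[E]; congr (_%:E); move/lt0r_neq0: palm_gt0 => p0.
by apply: (mulfI p0); rewrite E; field.
Qed.

Lemma Phi_comp n k n' k' X : Phi n k (Phi n' k' X) = Phi (n' + n) (k' + k) X.
Proof. by apply/funext => j; rewrite /Phi addnA; ring. Qed.

(** A skip of [k] by the recentred path is a skip of [k + 1] by the original one, one step later, so
    the claim reduces to [regenQ]. *)
Lemma regen0 : regen Qpalm Qpalm.
Proof.
move=> n k B H pB mH.
(* The skip of site 1 is only recorded up to time [n.+1], which makes [B'] a past event; afterwards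
   the escape above [k + 1], with [k >= 0], keeps the path above 1. *)
pose B' : set Path := [set X | [/\ X 0%N < 1, X 1%N = 2,
  forall j, (1 <= j <= n.+1)%N -> 1 < X j & B (Phi 1 1 X)]].
have pB' : past n.+1 B'.
  move=> X Y XY [H1 H2 H3 H4]; split; rewrite -?XY//.
    by move=> j /andP[j1 j2]; rewrite -XY// H3// j1.
  by apply: (pB _ _ _ H4) => j jn; rewrite /Phi XY// add1n ltnS.
have mBR : measurable (B `&` Reg n k).
  by apply: measurableI; [exact: measurable_past pB|exact: measurable_Reg].
have mP := measurable_preimage_Phi n k mH.
have eR : Reg 1 1 `&` Phi 1 1 @^-1` (B `&` Reg n k) = B' `&` Reg n.+1 (k + 1).
  apply/seteqP; split => X.
    move=> [[[X0 X1] X2] [BX [[Y0 Y1] Y2]]].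
    have k0 : 0 <= k.
      have := X2 (1 + n)%N isT; move: Y1; rewrite /Phi; lia.
    split; first split.
    - by apply: X0.
    - by rewrite X1.
    - by move=> j /andP[j1 _]; apply: X2.
    - exact: BX.
    split; first split.
    - case=> [_|i]; first by have := X0 0%N isT; lia.
      by rewrite ltnS => /Y0; rewrite /Phi add1n; lia.
    - by move: Y1; rewrite /Phi add1n; lia.
    - by case=> // j; rewrite ltnS => /Y2; rewrite /Phi add1n; lia.
  move=> [[X0 X1 X2 BX] [[Y0 Y1] Y2]].
  have k0 : 0 <= k by have := X2 n.+1; rewrite Y1 leqnn/= => /(_ isT); lia.
  split; first split.
  - by split => [i|]; [rewrite ltnS leqn0 => /eqP ->|rewrite X1].
  - move=> j j1; have [jn|jn] := leqP j n.+1; first by rewrite X2// j1.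
    by have := Y2 j (ltnW jn); lia.
  split; first exact: BX.
  split; first split.
  - by move=> i iN; have := Y0 i.+1 iN; rewrite /Phi add1n; lia.
  - by rewrite /Phi add1n Y1; lia.
  - by move=> j nj; have := Y2 j.+1 nj; rewrite /Phi add1n; lia.
have eRP : Reg 1 1 `&` Phi 1 1 @^-1` (B `&` Reg n k `&` Phi n k @^-1` H) =
    B' `&` Reg n.+1 (k + 1) `&` Phi n.+1 (k + 1) @^-1` H.
  rewrite preimage_setI setIA eR; congr (_ `&` _).
  by apply/seteqP; split => X; rewrite /preimage /= Phi_comp add1n addrC.
rewrite QpalmE; last by apply: measurableI.
rewrite (QpalmE mBR) /palm eRP eR regenQ//.
rewrite fineM; last 2 first.
- apply: fin_num_measure; apply: measurableI; [exact: measurable_past pB'|exact: measurable_Reg].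
- exact: fin_num_measure.
by rewrite mulrAC EFinM fineK//; exact: fin_num_measure.
Qed.

End palm_measure.

(** * The first skipped site and the shift to it *)

Section first_gap.
Implicit Types (n s : nat) (X : Path) (H : set Path).

(** Asking for visits before time [n] makes this a past event. Nothing is lost, since after a skip
    of [s] at time [n] no site below [s] is visited. *)
Definition visits_below n s : set Path :=
  [set X | (0 < s)%N /\ forall j : nat, (0 < j < s)%N -> exists i, (i < n)%N /\ X i = j%:Z].

Definition Fst n s : set Path := visits_below n s `&` Reg n s%:Z.

Lemma past_visits_below n s : past n (visits_below n s).
Proof.
move=> X Y XY [s0 H]; split => // j /H [i [iN Xi]].
by exists i; split => //; rewrite -XY// ltnW.
Qed.

Lemma measurable_Fst n s : measurable (Fst n s).
Proof.
apply: measurableI; last exact: measurable_Reg.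
exact: measurable_past (past_visits_below (n := n) (s := s)).
Qed.

Lemma Reg_unvisited n k X : Reg n k X -> forall i, X i != k.
Proof.
move=> [[H1 _] H2] i; have [iN|iN] := ltnP i n.
  by rewrite lt_eqF// H1.
by rewrite gt_eqF// H2.
Qed.

Lemma Fst_inj n s n' s' X : Fst n s X -> Fst n' s' X -> (n, s) = (n', s').
Proof.
move=> [[s0 V] G] [[s0' V'] G'].
have es : s = s'.
  apply/eqP; rewrite eqn_leq; apply/andP; split; rewrite leqNgt; apply/negP => ss.
    have [|i [_ Xi]] := V s'; first by rewrite s0' ss.
    by have := Reg_unvisited G' i; rewrite Xi eqxx.
  have [|i [_ Xi]] := V' s; first by rewrite s0 ss.
  by have := Reg_unvisited G i; rewrite Xi eqxx.
subst s'; congr (_, _); apply/eqP; rewrite eqn_leq; apply/andP; split; rewrite leqNgt; apply/negP => nn.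
  by case: G => -[+ _] _ => /(_ _ nn); case: G' => -[_ ->] _; lia.
by case: G' => -[+ _] _ => /(_ _ nn); case: G => -[_ ->] _; lia.
Qed.

(* Time and site of the first skip, with junk value (0, 0) outside [has_gap]. *)
Definition gap_pair X : nat * nat := xget (0, 0)%N [set p | Fst p.1 p.2 X].
Definition sigma X : nat := (gap_pair X).2.
Definition theta X : Path := Phi (gap_pair X).1 (sigma X)%:Z X.
Definition has_gap : set Path := [set X | exists n s, Fst n s X].

Lemma gap_pairE n s X : Fst n s X -> gap_pair X = (n, s).
Proof.
move=> F; rewrite /gap_pair; case: xgetP => [[n' s'] _ /= F'|/(_ (n, s))//].
exact: (Fst_inj F' F).
Qed.

Lemma gap_pair0 X : ~ has_gap X -> gap_pair X = (0, 0)%N.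
Proof.
move=> F; rewrite /gap_pair; case: xgetP => [[n' s'] _ /= F'|//].
by exfalso; apply: F; exists n', s'.
Qed.

Lemma sigmaE n s X : Fst n s X -> sigma X = s.
Proof. by move=> F; rewrite /sigma (gap_pairE F). Qed.

Lemma thetaE n s X : Fst n s X -> theta X = Phi n s%:Z X.
Proof. by move=> F; rewrite /theta /sigma (gap_pairE F). Qed.

Lemma measurable_has_gap : measurable has_gap.
Proof. by apply: mset_exists => n; apply: mset_exists => s; exact: measurable_Fst. Qed.

Lemma gap_pair_fiber p : [set X | gap_pair X = p] =
  if p == (0, 0)%N then ~` has_gap else Fst p.1 p.2.
Proof.
apply/seteqP; split => X; case: eqP => /= [->|p0].
- by move=> e [n [s F]]; move: e; rewrite (gap_pairE F) => -[_ s0]; case: F => -[]; rewrite s0.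
- move=> e; have [[n [s F]]|] := pselect (has_gap X); last by move/gap_pair0; rewrite e.
  by move: e; rewrite (gap_pairE F) => <-.
- exact: gap_pair0.
- by move=> F; rewrite (gap_pairE F); case: p p0 F.
Qed.

Lemma measurable_gap_pair p : measurable [set X | gap_pair X = p].
Proof.
rewrite gap_pair_fiber; case: ifP => _; last exact: measurable_Fst.
by apply: measurableC; exact: measurable_has_gap.
Qed.

Lemma measurable_theta : measurable_fun [set: Path] theta.
Proof.
move=> _ H mH; rewrite setTI.
rewrite (_ : _ @^-1` _ = [set X | exists p : nat * nat, gap_pair X = p /\ H (Phi p.1 p.2%:Z X)]).
  apply: mset_existsc => p; apply: mset_and; first exact: measurable_gap_pair.
  exact: measurable_preimage_Phi.
by apply/seteqP; split => X /=; [exists (gap_pair X)|case => p [<-]].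
Qed.

Lemma measurable_sigma : measurable_fun [set: Path] sigma.
Proof.
move=> _ H mH; rewrite setTI.
rewrite (_ : _ @^-1` _ = [set X | exists p : nat * nat, H p.2 /\ gap_pair X = p]).
  apply: mset_existsc => p; apply: mset_and; first exact: mset_cst.
  exact: measurable_gap_pair.
by apply/seteqP; split => X /=; [exists (gap_pair X)|by case => p [Hp e]; rewrite /preimage /= /sigma e].
Qed.

(** On each fibre of [gap_pair] this is [regen] with the past event [visits_below]; the junk fibre
    is null by assumption. Hence [theta X] has law [M0] and is independent of [sigma X]. *)
Lemma regen_law (R : realType) (M M0 : probability Path R) : regen M M0 ->
  M (~` has_gap) = 0%E -> forall s H, measurable H ->
  M ([set X | sigma X = s] `&` theta @^-1` H) =
  (M [set X | sigma X = s] * M0 H)%E.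
Proof.
move=> rg hN s H mH.
have fH : M0 H \is a fin_num by exact: fin_num_measure.
have ms : measurable [set X | sigma X = s].
  have := measurable_sigma measurableT (I : measurable [set s]).
  by rewrite setTI.
have mt : measurable (theta @^-1` H).
  by rewrite -[X in measurable X]setTI; exact: measurable_theta.
rewrite -[LHS]mul1e -(fineK fH) [RHS]muleC.
apply: (@eq_measure_fibers _ _ _ _ M M gap_pair gap_pair) => //.
- exact: measurableI.
- exact: measurable_gap_pair.
- exact: measurable_gap_pair.
move=> p.
suff H0 : (1%:E * M ([set X | sigma X = s] `&` theta @^-1` H `&` [set X | gap_pair X = p]) =
    (fine (M0 H))%:E * M ([set X | sigma X = s] `&` [set X | gap_pair X = p]))%E by exact: H0.
have [sp|sp] := eqVneq p.2 s; last first.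
  have e : [set X | sigma X = s] `&` [set X | gap_pair X = p] = set0.
    by apply/seteqP; split => // X [/= Xs Xp]; move: sp; rewrite -Xs -Xp eqxx.
  by rewrite setIAC e set0I measure0 !mule0.
have e1 : [set X | sigma X = s] `&` [set X | gap_pair X = p] = [set X | gap_pair X = p].
  by apply/seteqP; split => [X []//|X /= Xp]; split => //=; rewrite /sigma Xp.
rewrite setIAC e1 gap_pair_fiber; case: ifP => p0.
  rewrite hN mule0 mul1e; apply/eqP; rewrite eq_le measure_ge0 andbT -hN.
  have mG : measurable (~` has_gap) by apply: measurableC; exact: measurable_has_gap.
  by apply: le_measure; rewrite ?inE//; exact: measurableI.
rewrite mul1e fineK// muleC -rg//; last exact: past_visits_below.
congr (M _); apply/seteqP; split => X [F HX]; split => //.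
  by move: HX; rewrite /preimage /= (thetaE F).
by rewrite /preimage /= (thetaE F).
Qed.

End first_gap.

(** * Matrix products and quenched harmonic functions *)

Section quenched_potential.
Context (R : realType) (w : env R).
Hypothesis wpos : forall i, 0 < w i (-1).
Implicit Types (i j : int) (k n m t : nat).

Definition Mx i k : 'M[R]_2 := \prod_(l < k) A_mx w (i + l%:Z).

Definition Dg i k : R := Mx i k 0 0.

Lemma Mx0 i : Mx i 0 = 1. Proof. by rewrite /Mx big_ord0. Qed.

Lemma Mx_cat i k m : Mx i (k + m) = Mx i k * Mx (i + k%:Z) m.
Proof.
rewrite /Mx big_split_ord /=; congr (_ * _); apply: eq_bigr => l _.
by rewrite PoszD addrA.
Qed.

Lemma Mx1 i : Mx i 1 = A_mx w i.
Proof. by rewrite /Mx big_ord1 addr0. Qed.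

Lemma MxS i k : Mx i k.+1 = A_mx w i * Mx (i + 1) k.
Proof. by have := Mx_cat i 1 k; rewrite Mx1 add1n. Qed.

Lemma a1_ge0 i : 0 <= a1 w i.
Proof. by rewrite /a1 divr_ge0 ?addr_ge0 ?jump_ge0. Qed.

Lemma a2_ge0 i : 0 <= a2 w i.
Proof. by rewrite /a2 divr_ge0 ?jump_ge0. Qed.

Lemma a2_le_a1 i : a2 w i <= a1 w i.
Proof. by rewrite /a1 /a2 ler_pM2r ?invr_gt0// lerDr jump_ge0. Qed.

Lemma mul2mxE (A B : 'M[R]_2) (a b : 'I_2) :
  (A * B) a b = A a 0 * B 0 b + A a 1 * B 1 b.
Proof. by rewrite mxE !big_ord_recl big_ord0 addr0; congr (_ + A _ _ * B _ _); apply/val_inj. Qed.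

Lemma A_mx_ge0 i a b : 0 <= A_mx w i a b.
Proof. by rewrite mxE; case: ifP => _; [case: ifP => _|]; rewrite ?a1_ge0 ?a2_ge0 ?ler0n. Qed.

Lemma Mx_ge0 i k a b : 0 <= Mx i k a b.
Proof.
elim: k i a b => [|k IH] i a b; first by rewrite Mx0 mxE ler0n.
by rewrite MxS mul2mxE addr_ge0// mulr_ge0 ?A_mx_ge0 ?IH.
Qed.

Lemma Dg0 i : Dg i 0 = 1. Proof. by rewrite /Dg Mx0 mxE. Qed.

Lemma Dg1 i : Dg i 1 = a1 w i. Proof. by rewrite /Dg Mx1 mxE. Qed.

Lemma Mx_row1 i k b : Mx i k.+1 1 b = Mx (i + 1) k 0 b.
Proof. by rewrite MxS mul2mxE !mxE/= mul1r mul0r addr0. Qed.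

Lemma DgSS i k : Dg i k.+2 = a1 w i * Dg (i + 1) k.+1 + a2 w i * Dg (i + 2) k.
Proof.
rewrite [LHS]/Dg MxS mul2mxE Mx_row1 [A_mx w i 0 0]mxE [A_mx w i 0 1]mxE/=.
by rewrite -addrA.
Qed.

Lemma Dg_ge0 i k : 0 <= Dg i k. Proof. exact: Mx_ge0. Qed.

Lemma Dg_supermul i k m : Dg i k * Dg (i + k%:Z) m <= Dg i (k + m).
Proof. by rewrite /Dg Mx_cat mul2mxE lerDl mulr_ge0// Mx_ge0. Qed.

Lemma Mx_col1 i k : Mx i k 0 1 <= Dg i k.
Proof.
case: k => [|k]; first by rewrite /Dg Mx0 !mxE.
rewrite /Dg; have := Mx_cat i k 1; rewrite addn1 Mx1 => ->; rewrite !mul2mxE !mxE/= mulr0 addr0 mulr1.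
have := Mx_ge0 i k 0 0; have := Mx_ge0 i k 0 1; have := a2_le_a1 (i + k%:Z).
by move=> H1 H2 H3; rewrite ler_wpDr// ler_wpM2l.
Qed.

Hypothesis wpos2 : forall i, 0 < w i 2.

Lemma a1_gt0 i : 0 < a1 w i.
Proof. by rewrite /a1 divr_gt0// ltr_wpDl ?jump_ge0. Qed.

Lemma Dg_gt0 i k : 0 < Dg i k.
Proof.
elim: k i => [|k IH] i; first by rewrite Dg0.
case: k IH => [|k] IH; first by rewrite Dg1 a1_gt0.
rewrite DgSS; apply: ltr_wpDr; first exact: mulr_ge0 (a2_ge0 _) (Dg_ge0 _ _).
exact: mulr_gt0 (a1_gt0 _) (IH _).
Qed.

(** The second column is dominated by the first because [a2 <= a1], and the second row is the first
    row of a shorter product, which supermultiplicativity compares with [Dg i k.+1]. So [Dg]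
    inherits the growth of the norm. *)
Lemma norm_Mx_le i k : `|Mx i k.+1| <= (1 + (a1 w i)^-1) * Dg i k.+1.
Proof.
have a0 := a1_gt0 i.
have D1 : Dg (i + 1) k <= (a1 w i)^-1 * Dg i k.+1.
  have := Dg_supermul i 1 k; rewrite Dg1 add1n => H.
  by rewrite -(ler_pM2l a0) mulrA divff ?gt_eqF// mul1r.
have D0 := Dg_ge0 i k.+1; have ia0 : 0 <= (a1 w i)^-1 by rewrite invr_ge0 ltW.
have le0 : Dg i k.+1 <= (1 + (a1 w i)^-1) * Dg i k.+1.
  by rewrite mulrDl mul1r lerDl mulr_ge0.
have le1 : Dg (i + 1) k <= (1 + (a1 w i)^-1) * Dg i k.+1.
  by rewrite mulrDl mul1r (le_trans D1)// lerDr.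
have row (a : 'I_2) : a = 0 \/ a = 1.
  by case: a => [[|[|a]]// ha]; [left|right]; apply/val_inj.
rewrite [leLHS]/Num.norm /= mx_normrE; apply: bigmax_le; first exact: le_trans le0.
move=> [a b] _ /=; rewrite ger0_norm ?Mx_ge0//.
case: (row a) => ->; last first.
  by rewrite Mx_row1; case: (row b) => ->; apply: le_trans le1; rewrite ?Mx_col1.
by case: (row b) => ->; apply: le_trans le0; rewrite ?Mx_col1.
Qed.

Lemma Dg_summable (gamma : R) : 0 < gamma ->
  (n%:R^-1 * ln `|Mx 0 n|) @[n --> \oo] --> gamma ->
  exists S, forall n, \sum_(j < n) (Dg 0 j)^-1 <= S.
Proof.
move=> g0 lim.
have g2 : gamma / 2 < gamma by rewrite ltr_pdivrMr// ltr_pMr// ltr1n.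
have := cvgr_gt _ lim _ g2 => -[n0 _ H].
(* [C] is the constant of [norm_Mx_le]; half of the exponent is given up to obtain a geometric bound
   from the limit. *)
pose C := 1 + (a1 w 0)^-1; pose r := expR (- (gamma / 2)).
have C0 : 0 <= C by rewrite addr_ge0// invr_ge0 a1_ge0.
have r0 : 0 < r := expR_gt0 _.
have r1 : 0 < 1 - r by rewrite subr_gt0 expR_lt1 oppr_lt0 divr_gt0.
have bnd n : (n0 <= n)%N -> (Dg 0 n.+1)^-1 <= C * r ^+ n.+1.
  move=> nn; have := H n.+1 (leqW nn); rewrite /= => Hn.
  have lnb : n.+1%:R * (gamma / 2) < ln `|Mx 0 n.+1|.
    by rewrite mulrC -ltr_pdivlMr ?ltr0n// [ltRHS]mulrC.
  have Npos : 0 < `|Mx 0 n.+1|.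
    rewrite ltNge; apply/negP => /ln0 e; move: lnb; rewrite e.
    by rewrite ltNge mulr_ge0// divr_ge0// ltW.
  have : expR (n.+1%:R * (gamma / 2)) <= C * Dg 0 n.+1.
    apply: le_trans (norm_Mx_le 0 n); rewrite -[leRHS]lnK ?posrE// ler_expR; exact: ltW.
  rewrite expRM_natl => H1.
  rewrite /r expRN exprVn -[leRHS]/(C / _) ler_pdivlMr ?exprn_gt0 ?expR_gt0//.
  by rewrite ler_pdivrMl ?Dg_gt0// [leRHS]mulrC.
have geo n : \sum_(j < n) r ^+ j <= (1 - r)^-1.
  rewrite -[leRHS]mul1r ler_pdivlMr//.
  suff -> : (\sum_(j < n) r ^+ j) * (1 - r) = 1 - r ^+ n by rewrite gerBl exprn_ge0// ltW.
  elim: n => [|n IH]; first by rewrite big_ord0 mul0r expr0 subrr.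
  by rewrite big_ord_recr/= mulrDl IH exprS; ring.
exists (\sum_(j < n0.+1) (Dg 0 j)^-1 + C / (1 - r)) => n.
have pos (j : nat) : 0 <= (Dg 0 j)^-1 by rewrite invr_ge0 Dg_ge0.
have step m : \sum_(j < n0.+1 + m) (Dg 0 j)^-1 <=
   \sum_(j < n0.+1) (Dg 0 j)^-1 + C * \sum_(j < n0.+1 + m) r ^+ j.
  elim: m => [|m IH].
    by rewrite addn0 lerDl mulr_ge0// sumr_ge0// => j _; rewrite exprn_ge0// ltW.
  rewrite addnS [leLHS]big_ord_recr [X in _ + _ * X]big_ord_recr /= mulrDr addrA lerD//.
  exact: (bnd (n0 + m)%N (leq_addr _ _)).
apply: (@le_trans _ _ (\sum_(j < n0.+1 + n) (Dg 0 j)^-1)).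
  by rewrite addnC big_split_ord/= lerDl sumr_ge0.
apply: (le_trans (step n)); rewrite lerD2l ler_wpM2l//.
Qed.

Lemma Dg_inv_cvg0 : (exists S, forall n, \sum_(j < n) (Dg 0 j)^-1 <= S) ->
  (Dg 0 n)^-1 @[n --> \oo] --> (0 : R).
Proof.
move=> [S HS]; apply: cvg_series_cvg_0.
apply: nondecreasing_is_cvgn.
  by apply: nondecreasing_series => n _ _; rewrite invr_ge0 Dg_ge0.
by exists S => _ [n _ <-]; rewrite /series/= big_mkord.
Qed.

(** Harmonicity rewritten for increments: read from right to left it is the recursion [DgSS]. *)
Lemma harmonic_step (b : int -> R) (x : int) :
  b x = \sum_(l <- [:: -1; 1; 2]) w x l * b (x + l) ->
  b (x - 1) - b x =
    a1 w x * (b x - b (x + 1)) + a2 w x * (b (x + 1) - b (x + 2)).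
Proof.
rewrite !big_cons big_nil addr0 => H.
have S := jump_sum1 w x.
have w0 := lt0r_neq0 (wpos x).
have w1E : w x 1 = (a1 w x - a2 w x) * w x (-1) by rewrite /a1 /a2 mulrBl !divfK//; ring.
have w2E : w x 2 = a2 w x * w x (-1) by rewrite /a2 divfK.
have E : w x (-1) * b (x - 1) = b x - w x 1 * b (x + 1) - w x 2 * b (x + 2).
  by rewrite [in RHS]H; ring.
apply: (mulfI w0); transitivity (w x 1 * (b x - b (x + 1)) + w x 2 * (b x - b (x + 2))).
  have wm : w x (-1) = 1 - w x 1 - w x 2 by rewrite -S; ring.
  by rewrite mulrBr E wm; ring.
by rewrite w1E w2E; ring.
Qed.

Lemma harmonic_Dg (b : int -> R) (a : int) (N : nat) :
  b a = 0 -> b (a + 1) = 0 ->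
  (forall x, a - N%:Z <= x < a -> b x = \sum_(l <- [:: -1; 1; 2]) w x l * b (x + l)) ->
  forall k, (k <= N)%N ->
    b (a - k%:Z - 1) - b (a - k%:Z) = b (a - 1) * Dg (a - k%:Z) k.
Proof.
move=> ba ba1 H.
(* The recursion has order two, so the induction carries two consecutive increments; at [k = 0] the
   second one is replaced by the boundary values at [a] and [a + 1]. *)
suff : forall k, (k <= N)%N ->
    b (a - k%:Z - 1) - b (a - k%:Z) = b (a - 1) * Dg (a - k%:Z) k /\
    (k = 0%N \/ b (a - k%:Z) - b (a - k%:Z + 1) = b (a - 1) * Dg (a - k%:Z + 1) k.-1).
  by move=> H' k /H' [].
elim=> [|k IH] kN; first by split; [rewrite subr0 Dg0 mulr1 ba subr0|left].
have [I1 I2] := IH (ltnW kN).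
have e1 : a - k.+1%:Z + 1 = a - k%:Z by lia.
have e1' : a - k%:Z - 1 = a - k.+1%:Z by lia.
have e2 : a - k.+1%:Z + 2 = a - k%:Z + 1 by lia.
split; last first.
  by right; rewrite e1 /= -I1 e1'.
rewrite harmonic_step; last by apply: H; lia.
rewrite e1 e2 -e1' I1; case: k I1 I2 e1 e1' e2 kN {IH} => [|k] I1 I2 e1 e1' e2 kN.
  by rewrite subr0 ba ba1 subr0 mulr0 addr0 Dg1 Dg0 mulr1 mulrC.
case: I2 => [//|I2]; rewrite I2/= DgSS.
have -> : a - k.+1%:Z - 1 + 1 = a - k.+1%:Z by ring.
have -> : a - k.+1%:Z - 1 + 2 = a - k.+1%:Z + 1 by ring.
by ring.
Qed.

Lemma harmonic_sum (b : int -> R) (a : int) (N : nat) :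
  b a = 0 -> b (a + 1) = 0 ->
  (forall x, a - N%:Z <= x < a -> b x = \sum_(l <- [:: -1; 1; 2]) w x l * b (x + l)) ->
  forall k, (k <= N)%N ->
  b (a - k%:Z - 1) = b (a - 1) * \sum_(j < k.+1) Dg (a - j%:Z) j.
Proof.
move=> ba ba1 H; elim => [|k IH] kN.
  by rewrite big_ord1 !subr0 Dg0 mulr1.
rewrite big_ord_recr/= mulrDr -IH; last exact: ltnW.
rewrite -(harmonic_Dg ba ba1 H kN).
have -> : a - k.+1%:Z = a - k%:Z - 1 by lia.
by rewrite [RHS]addrC subrK.
Qed.

(* [upot n] vanishes at -1, is harmonic on [0, n) and constant on [n, n + 1]. *)
Definition upot n (x : nat) : R := \sum_(j < x) (if (j <= n)%N then Dg j%:Z (n - j) else 0).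

(** The argument is shifted: [upot n x.+1] is the value at site [x]. The increment from site [j - 1]
    to [j] is [Dg j (n - j)], and [DgSS] is exactly harmonicity; beyond [n] the increments are 0. *)
Lemma upot_harmonic n x : (x < n)%N ->
  upot n x.+1 = w x%:Z (-1) * upot n x + w x%:Z 1 * upot n x.+2 + w x%:Z 2 * upot n x.+3.
Proof.
move=> xn; have S := jump_sum1 w x%:Z.
rewrite /upot !big_ord_recr /=.
set u := \sum_(_ < _) _.
have -> : (x <= n)%N by exact: ltnW.
rewrite xn.
have w0 := lt0r_neq0 (wpos x%:Z).
have w1 : w x%:Z 1 = a1 w x%:Z * w x%:Z (-1) - a2 w x%:Z * w x%:Z (-1).
  by rewrite /a1 /a2 !divfK//; ring.
have w2 : w x%:Z 2 = a2 w x%:Z * w x%:Z (-1) by rewrite /a2 divfK.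
have DE : Dg x%:Z (n - x) = a1 w x%:Z * Dg x.+1%:Z (n - x.+1) +
    a2 w x%:Z * (if (x.+2 <= n)%N then Dg x.+2%:Z (n - x.+2) else 0).
  have [xn2|xn2] := leqP x.+2 n.
    have -> : (n - x = (n - x.+2).+2)%N by lia.
    have -> : (n - x.+1 = (n - x.+2).+1)%N by lia.
    by rewrite DgSS; congr (_ * Dg _ _ + _ * Dg _ _); lia.
  have -> : n = x.+1 by lia.
  by rewrite subSnn subnn Dg0 Dg1; ring.
set D2 := (if _ then _ else 0) in DE *.
have w1' : w x%:Z (-1) = 1 - w x%:Z 1 - w x%:Z 2 by rewrite -S; ring.
have W : w x%:Z (-1) * Dg x%:Z (n - x) = (w x%:Z 1 + w x%:Z 2) * Dg x.+1%:Z (n - x.+1) + w x%:Z 2 * D2.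
  by rewrite DE w1 w2; ring.
move: W; rewrite w1'; set D1 := Dg _ (n - x.+1); set D0 := Dg _ (n - x); move=> W.
lra.
Qed.

Lemma peval_stay1 t x : t%:Z <= x -> peval (apoly (fun z => -1 < z) xpred0 t x) w = 1.
Proof.
elim: t x => [|t IH] x tx; first by rewrite peval0/= (_ : -1 < x)//; lia.
rewrite pevalS (_ : -1 < x); last by lia.
rewrite -(jump_sum w x); apply: eq_big_seq => l; rewrite !inE => /or3P[] /eqP ->;
  by rewrite IH ?mulr1//; lia.
Qed.

Lemma upot_gt0 n : 0 < upot n n.+1.
Proof.
rewrite /upot big_ord_recr/= leqnn; apply: ltr_wpDl; last exact: Dg_gt0.
by apply: sumr_ge0 => j _; case: ifP => // _; exact: Dg_ge0.
Qed.

(** By supermultiplicativity [Dg j (n - j)] is at most [Dg 0 n / Dg 0 j]. *)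
Lemma upot_le S n : (forall m, \sum_(j < m) (Dg 0 j)^-1 <= S) ->
  upot n n.+1 <= Dg 0 n * S.
Proof.
move=> HS; apply: (@le_trans _ _ (Dg 0 n * \sum_(j < n.+1) (Dg 0 j)^-1)); last first.
  by rewrite ler_wpM2l ?Dg_ge0.
rewrite mulr_sumr; apply: ler_sum => j _.
have jn : (j <= n)%N by rewrite -ltnS.
rewrite jn ler_pdivlMr ?Dg_gt0// mulrC.
by have := Dg_supermul 0 j (n - j); rewrite add0r subnKC.
Qed.

(** A gambler's ruin bound, by comparison with a harmonic function in an induction on [t]. From a
    site at or above [n], fewer than [n + 1] steps cannot lead below 0. At [x = 0], [upot_le] makes
    the bound uniform in [n]. *)
Lemma peval_escape_lb n t x : (t <= n)%N -> (x <= n.+1)%N ->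
  upot n x.+1 / upot n n.+1 <= peval (apoly (fun z => -1 < z) xpred0 t x%:Z) w.
Proof.
have term0 (j : nat) : 0 <= (if (j <= n)%N then Dg j%:Z (n - j) else 0 : R).
  by case: ifP => // _; exact: Dg_ge0.
have u0 := upot_gt0 n.
have u1 (y : nat) : (y <= n.+1)%N -> upot n y.+1 / upot n n.+1 <= 1.
  move=> yn; rewrite ler_pdivrMr// mul1r.
  have [yn'|yn'] := leqP y n; last first.
    have -> : y = n.+1 by lia.
    by rewrite [leLHS]/upot big_ord_recr/= ltnn addr0.
  rewrite /upot -(subnKC yn') -addSn big_split_ord /= lerDl sumr_ge0// => j _.
  by case: ifP => // _; exact: Dg_ge0.
elim: t x => [|t IH] x tn xn.
  have px : -1 < x%:Z by lia.
  by rewrite peval0 (_ : (_ || _) = true) ?u1.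
have [nx|nx] := leqP n x; first by rewrite peval_stay1 ?u1//; lia.
have px : -1 < x%:Z by lia.
rewrite pevalS (_ : (-1 < x%:Z) = true)// !big_cons big_nil addr0.
rewrite upot_harmonic// !mulrDl -addrA.
have l1 : upot n x.+2 / upot n n.+1 <= peval (apoly (fun z => -1 < z) xpred0 t (x%:Z + 1)) w.
  by have := IH x.+1; rewrite -addn1 PoszD; apply; lia.
have l2 : upot n x.+3 / upot n n.+1 <= peval (apoly (fun z => -1 < z) xpred0 t (x%:Z + 2)) w.
  by have := IH x.+2; rewrite -addn2 PoszD; apply; lia.
have lm : upot n x / upot n n.+1 <= peval (apoly (fun z => -1 < z) xpred0 t (x%:Z + -1)) w.
  case: x {l1 l2 xn px} nx => [|x] nx; first by rewrite /upot big_ord0 mul0r peval_ge0.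
  by have -> : x.+1%:Z + -1 = x%:Z; [lia|apply: IH; lia].
by rewrite -!mulrA !lerD// ler_wpM2l// jump_ge0.
Qed.

End quenched_potential.

(** * Positivity of the jump probabilities *)

Section ellipticity.
Context (R : realType) (P : probability (Omega R) R).
Hypothesis hiid : iid_sites P.

(** The logarithm is nonpositive here, so the bound makes it integrable, hence almost everywhere
    finite, whereas [lne 0] is infinite. Stationarity carries this to all sites, which are countably
    many. *)
Lemma ae_jump_gt0 (l : int) : (-oo < \int[P]_w lne (w 0 l)%:E)%E ->
  {ae P, forall w : Omega R, forall i, 0 < w i l}.
Proof.
move=> hl.
have mlne : measurable_fun [set: Omega R] (fun w : Omega R => lne (w 0 l)%:E).
  rewrite /lne; apply: measurable_fun_ifT.
  - by apply: measurable_fun_ler => //; exact: measurable_jump.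
  - exact: measurable_cst.
  - apply/measurable_EFinP; apply: (measurableT_comp (@measurable_ln R)).
    exact: measurable_jump.
have lne0 (w : Omega R) : (lne (w 0 l)%:E <= 0)%E by rewrite lne_le0 lee_fin jump_le1.
have ilne : P.-integrable [set: Omega R] (fun w : Omega R => lne (w 0 l)%:E).
  apply/integrableP; split => //.
  under eq_integral do rewrite lee0_abs//.
  have g0 (w : Omega R) : setT w -> (0 <= - lne (w 0 l)%:E)%E.
    by move=> _; have := lne0 w; rewrite -leeN2 oppe0.
  have H := @integral_ge0N _ _ R P setT (fun w : Omega R => - lne (w 0 l)%:E)%E g0.
  rewrite -[X in (X < _)%E]oppeK -H.
  by under eq_integral do rewrite oppeK; rewrite lteNl.
have ae0 : {ae P, forall w : Omega R, 0 < w 0 l}.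
  apply: filterS (integrable_ae measurableT ilne) => w /(_ Logic.I).
  by apply: contraPT => /=; rewrite -leNgt => ->.
have aei i : {ae P, forall w : Omega R, 0 < w i l}.
  pose B := [set p : R * R * R | coordm l p <= 0].
  have mB : measurable B.
    have := measurable_coordm l measurableT (measurable_itv `]-oo, 0 : R]).
    by rewrite setTI; congr measurable; apply/seteqP; split => p; rewrite /B /= in_itv.
  have BE j : site j @^-1` B = [set w : Omega R | ~ (0 < w j l)].
    by apply/seteqP; split => w; rewrite /B /preimage /= -coordm_site leNgt => /negP.
  have mS j : measurable (site j @^-1` B : set (Omega R)).
    by rewrite -[X in measurable X]setTI; exact: measurable_site.
  exists (site i @^-1` B); split => //; last by rewrite BE.
  rewrite hiid.1//; apply: measure_negligible => //.
  by rewrite BE.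
have a1 : {ae P, forall w : Omega R, forall n : nat, 0 < w n%:Z l}.
  by apply: ae_foralln => n; exact: aei.
have a2 : {ae P, forall w : Omega R, forall n : nat, 0 < w (Negz n) l}.
  by apply: ae_foralln => n; exact: aei.
by apply: filterS2 a1 a2 => w H1 H2 [n|n].
Qed.

Lemma em_x02_gt0 : {ae P, forall w : Omega R, forall i, 0 < w i 2} ->
  0 < em P x02 1.
Proof.
move=> ae2; rewrite /em fine_gt0//; apply/andP; split; last first.
  by have := emono_fin P (path_mono x02 1); rewrite fin_numElt => /andP[].
rewrite lt_neqAle emono_ge0 andbT; apply/eqP => e.
have mm : measurable_fun [set: Omega R] (fun w : Omega R => (mono w (path_mono x02 1))%:E).
  by apply/measurable_EFinP; apply: measurable_mono.
have [+ _] := ae_eq_integral_abs P measurableT mm.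
have -> : (\int[P]_w `|(mono w (path_mono x02 1))%:E| = 0)%E.
  under eq_integral => w _ do rewrite gee0_abs ?lee_fin ?mono_ge0//.
  by rewrite e.
move=> /(_ erefl) ae0.
have : {ae P, forall w : Omega R, False}.
  apply: filterS2 ae0 ae2 => w /(_ Logic.I) /= e0 /(_ 0) w2.
  move: e0; rewrite /mono /path_mono /= big_seq1 /x02/= subr0 => -[e0].
  by move: w2; rewrite e0 ltxx.
move=> /(@negligibleS _ _ _ P _ setT) H.
have : P.-negligible [set: Omega R].
  apply: H => w _ /=; tauto.
move=> /(measure_negligible measurableT) PT.
have : P [set: Omega R] = 1%E by exact: probability_setT.
by rewrite PT => /eqP; rewrite eqe eq_sym oner_eq0.
Qed.

End ellipticity.

Lemma probability_ae_false d (T : measurableType d) (R : realType)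
  (P : probability T R) : {ae P, forall w, False} -> False.
Proof.
move=> [N [mN N0 TN]].
have : P [set: T] = 1%E by exact: probability_setT.
have -> : [set: T] = N by apply/seteqP; split => w // _; apply: TN => /=.
by rewrite N0 => /eqP; rewrite eqe eq_sym oner_eq0.
Qed.

(** * Infinite-horizon limits *)

Section limit_potential.
Context (R : realType).
Implicit Types (w : env R) (D A : int -> bool).

(** Staying in [D] for ever counts as success, like entering [A]; with [A = xpred0] only staying
    remains. *)
Definition apot D A x w : R := limn (fun t => peval (apoly D A t x) w).

Lemma peval_homo D A x w m n : (m <= n)%N ->
  peval (apoly D A n x) w <= peval (apoly D A m x) w.
Proof.
move=> /subnKC <-; elim: (n - m)%N => [|k IH]; first by rewrite addn0.
by rewrite addnS; apply: le_trans IH; exact: peval_nonincr.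
Qed.

Lemma apot_cvg D A x w : peval (apoly D A t x) w @[t --> \oo] --> apot D A x w.
Proof.
apply: nonincreasing_is_cvgn => [m n mn|]; first exact: peval_homo.
by exists 0 => _ [n _ <-]; exact: peval_ge0.
Qed.

Lemma apot_ge0 D A x w : 0 <= apot D A x w.
Proof.
by apply: limr_ge; [exact: cvgP (@apot_cvg D A x w)|apply: nearW => t; exact: peval_ge0].
Qed.

Lemma apot_le_peval D A x w t : apot D A x w <= peval (apoly D A t x) w.
Proof.
apply: limr_le; first exact: cvgP (@apot_cvg D A x w).
by exists t => // n /= tn; exact: peval_homo.
Qed.

Lemma apot_eq D A x w : apot D A x w = if A x then 1 else if D x then
  \sum_(l <- [:: -1; 1; 2]) w x l * apot D A (x + l) w else 0.
Proof.
have := @apot_cvg D A x w; rewrite -(cvg_shiftS _) /=.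
under eq_fun do rewrite pevalS !big_cons big_nil.
case: (A x) => [c1|]; first by rewrite -(cvg_lim _ c1)// lim_cst.
case: (D x) => [c1|c1]; last by rewrite -(cvg_lim _ c1)// lim_cst.
apply: (cvg_unique _ c1) => //.
rewrite !big_cons big_nil.
do 3 (apply: cvgD; first by apply: cvgMl_tmp; exact: apot_cvg).
exact: cvg_cst.
Qed.

Lemma apot_absorbed D A x w : A x -> apot D A x w = 1.
Proof. by move=> Ax; rewrite apot_eq Ax. Qed.

Lemma apot_killed D A x w : ~~ A x -> ~~ D x -> apot D A x w = 0.
Proof. by move=> /negbTE Ax /negbTE Dx; rewrite apot_eq Ax Dx. Qed.

Lemma apot_harmonic D A x w : ~~ A x -> D x ->
  apot D A x w = \sum_(l <- [:: -1; 1; 2]) w x l * apot D A (x + l) w.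
Proof. by move=> /negbTE Ax Dx; rewrite apot_eq Ax Dx. Qed.

Lemma peval_absorb_le D A t x w :
  peval (apoly D xpred0 t x) w <= peval (apoly D A t x) w.
Proof.
elim: t x => [|t IH] x.
  by rewrite !peval0 ler_nat /=; case: (D x); rewrite ?orbT//; case: (A x).
rewrite pevalS [leRHS]pevalS /=; case: (A x).
  by case: ifP => // _; rewrite -(jump_sum w x); apply: ler_sum => l _;
    rewrite ler_piMr ?jump_ge0 ?peval_le1.
by case: ifP => // _; apply: ler_sum => l _; rewrite ler_wpM2l ?jump_ge0.
Qed.

Lemma apot_absorb_le D A x w : apot D xpred0 x w <= apot D A x w.
Proof.
apply: ler_lim; [exact: cvgP (@apot_cvg D xpred0 x w)|exact: cvgP (@apot_cvg D A x w)|].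
by apply: nearW => t; exact: peval_absorb_le.
Qed.

Variable P : probability (Omega R) R.
Hypothesis hiid : iid_sites P.

Lemma integrable_one : P.-integrable [set: Omega R] (EFin \o (fun=> 1 : R)).
Proof. exact: finite_measure_integrable_cst. Qed.

Lemma cvg_epoly D A x :
  epoly P (apoly D A t x) @[t --> \oo] --> (\int[P]_w (apot D A x w)%:E)%E.
Proof.
apply: (dominated_cvg measurableT (g := EFin \o (fun=> 1))) => //.
- by move=> t; apply/measurable_EFinP; apply: measurable_peval.
- by move=> w _; apply: cvg_EFin; [exact: nearW|exact: apot_cvg].
- exact: integrable_one.
- by move=> n w _; rewrite /= lee_fin ger0_norm ?peval_ge0 ?peval_le1.
Qed.

Lemma measurable_apot D A x : measurable_fun [set: Omega R] (apot D A x).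
Proof.
apply: (@measurable_fun_cvg _ (Omega R) R setT
  (fun t (w : Omega R) => peval (apoly D A t x) w) (apot D A x)) => //.
- by move=> t; apply: measurable_peval.
- by move=> w _; exact: apot_cvg.
Qed.

End limit_potential.

(** * Passing every level and escaping with positive probability *)

Section passage.
Context (R : realType) (P : probability (Omega R) R).
Hypothesis hiid : iid_sites P.
Hypothesis pm1 : {ae P, forall w : Omega R, forall i, 0 < w i (-1)}.
Hypothesis p2 : {ae P, forall w : Omega R, forall i, 0 < w i 2}.
Variable gamma2 : R.
Hypothesis gamma2_gt0 : 0 < gamma2.
Hypothesis hgamma2 : top_lyapunov P gamma2.

Lemma ae_summable : {ae P, forall w : Omega R,
  exists S, forall n, \sum_(j < n) (Dg w 0 j)^-1 <= S}.
Proof.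
apply: filterS3 pm1 p2 hgamma2 => w H1 H2 H3.
apply: (Dg_summable H1 H2 gamma2_gt0); apply: cvg_trans H3.
by apply: near_eq_cvg; apply: nearW => n; congr (_ * ln `|_|).
Qed.

(** The value 1 at site -1 is the value at [n - 1] times a sum of nonnegative terms, one of which is
    [Dg w 0 n]. *)
Lemma absorb_le (w : env R) n : (forall i, 0 < w i (-1)) -> (forall i, 0 < w i 2) ->
  apot (fun z => z < n%:Z) (fun z => z < 0) (n%:Z - 1) w <= (Dg w 0 n)^-1.
Proof.
move=> H1 H2; set b := apot _ _.
pose b' x := b x w.
have ba : b' n%:Z = 0 by apply: apot_killed; lia.
have ba1 : b' (n%:Z + 1) = 0 by apply: apot_killed; lia.
have bm1 : b' (-1) = 1 by exact: apot_absorbed.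
have hb x : n%:Z - n%:Z <= x < n%:Z -> b' x = \sum_(l <- [:: -1; 1; 2]) w x l * b' (x + l).
  by move=> hx; apply: apot_harmonic; lia.
have := harmonic_sum H1 ba ba1 hb (leqnn n).
rewrite subrr sub0r bm1 => E.
have D0 := Dg_gt0 H1 H2 0 n.
rewrite -[leRHS]mul1r ler_pdivlMr// [leRHS]E.
rewrite -/(b' _) ler_wpM2l ?apot_ge0// big_ord_recr/= subrr lerDr sumr_ge0// => j _.
exact: Dg_ge0.
Qed.

(** Allowing absorption below [a - n] only increases the probability. Translating the window to
    start at 0, where the growth of the products is known, gives the mean of [v n], which tends to 0
    by [absorb_le]. *)
Lemma passage_top (a : int) :
  (\int[P]_w (apot (fun z => z < a) xpred0 (a - 1) w)%:E = 0)%E.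
Proof.
pose v n := apot (fun z => z < n%:Z) (fun z => z < 0) (n%:Z - 1) : Omega R -> R.
have lev n : (\int[P]_w (apot (fun z => z < a) xpred0 (a - 1) w)%:E <= \int[P]_w (v n w)%:E)%E.
  have -> : (\int[P]_w (v n w)%:E =
      \int[P]_w (apot (fun z => z < a) (fun z => (z < a - n%:Z)) (a - 1) w)%:E)%E.
    have c1 := @cvg_epoly R P (fun z => z < n%:Z) (fun z => z < 0) (n%:Z - 1).
    have c2 := @cvg_epoly R P (fun z => z < a) (fun z => z < a - n%:Z) (a - 1).
    apply: (cvg_unique _ c1) => //; move: c2; apply: cvg_trans.
    apply: near_eq_cvg; apply: nearW => t.
    have e : epoly P (apoly (fun z => z < n%:Z) (fun z => z < 0) t (n%:Z - 1)) =
        epoly P (apoly (fun z => z < a) (fun z => z < a - n%:Z) t (a - 1)).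
      rewrite -(epoly_shift hiid (a - n%:Z) (apoly _ _ _ (n%:Z - 1))).
      rewrite -(apoly_shift (D' := fun z => z < a) (A' := fun z => z < a - n%:Z)).
      - by congr (epoly _ (apoly _ _ _ _)); ring.
      - by move=> i; lia.
      - by move=> i; lia.
    by rewrite e.
  apply: ge0_le_integral => //.
  - by move=> w _; rewrite lee_fin apot_ge0.
  - by apply/measurable_EFinP; apply: measurable_apot.
  - by apply/measurable_EFinP; apply: measurable_apot.
  - by move=> w _; rewrite lee_fin apot_absorb_le.
have : (\int[P]_w (v n w)%:E)%E @[n --> \oo] --> (\int[P]_w (cst 0%E w))%E.
  have [|||||_ _ //] := @dominated_convergence _ _ R P setT measurableT
     (fun n => EFin \o v n) (cst 0%E) (EFin \o (fun=> 1)).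
  - by move=> n; apply/measurable_EFinP; apply: measurable_apot.
  - exact: measurable_cst.
  - apply: filterS3 pm1 p2 ae_summable => w H1 H2 H3 _.
    apply: cvg_EFin; first exact: nearW.
    apply: (squeeze_cvgr (f := cst 0) (h := fun n => (Dg w 0 n)^-1)).
    - by apply: nearW => n /=; rewrite apot_ge0 absorb_le.
    - exact: cvg_cst.
    - exact: (Dg_inv_cvg0 H3).
  - exact: integrable_one.
  - apply: aeW => w n _; rewrite /= lee_fin ger0_norm ?apot_ge0//.
    apply: le_trans (apot_le_peval _ _ _ _ 0) _; exact: peval_le1.
rewrite integral0 => c0; apply/eqP; rewrite eq_le; apply/andP; split; last first.
  by apply: integral_ge0 => w _; rewrite lee_fin apot_ge0.
by apply: (cvge_ge _ c0); apply: nearW => n; exact: lev.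
Qed.

(** By [harmonic_sum] the value at 0 is a multiple of the value at [a - 1], which vanishes almost
    surely by [passage_top]. *)
Lemma passage_from0 (a : nat) : (0 < a)%N ->
  (\int[P]_w (apot (fun z => z < a%:Z) xpred0 0 w)%:E = 0)%E.
Proof.
move=> a0.
have mtop : measurable_fun [set: Omega R]
    (fun w : Omega R => (apot (fun z => z < a%:Z) xpred0 (a%:Z - 1) w)%:E).
  by apply/measurable_EFinP; apply: measurable_apot.
have [+ _] := ae_eq_integral_abs P measurableT mtop.
have -> : (\int[P]_w `|(apot (fun z => z < a%:Z) xpred0 (a%:Z - 1) w)%:E| = 0)%E.
  under eq_integral => w _ do rewrite gee0_abs ?lee_fin ?apot_ge0//.
  exact: passage_top.
move=> /(_ erefl) top0.
have m0 : measurable_fun [set: Omega R]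
    (fun w : Omega R => (apot (fun z => z < a%:Z) xpred0 0 w)%:E).
  by apply/measurable_EFinP; apply: measurable_apot.
rewrite (ae_eq_integral (cst 0%E))//; first exact: integral0.
apply: filterS2 pm1 top0 => w H1 /(_ Logic.I) /= [top_w] _.
pose b' x := apot (fun z => z < a%:Z) xpred0 x w.
have ba : b' a%:Z = 0 by apply: apot_killed => //; lia.
have ba1 : b' (a%:Z + 1) = 0 by apply: apot_killed => //; lia.
have hb x : a%:Z - a%:Z <= x < a%:Z -> b' x = \sum_(l <- [:: -1; 1; 2]) w x l * b' (x + l).
  by move=> hx; apply: apot_harmonic => //; lia.
have := harmonic_sum H1 ba ba1 hb (leq_pred a).
have -> : a%:Z - a.-1%:Z - 1 = 0 by lia.
by rewrite /b' top_w mul0r => ->.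
Qed.

(** The quenched escape probability is almost surely bounded below for all horizons at once, by the
    inverse of the sum of the [1 / Dg]. Some bound [1 / m.+1] therefore holds on a set of positive
    probability. *)
Lemma escape_lb : exists2 delta : R, 0 < delta & forall t,
  (delta%:E <= epoly P (apoly (fun z => (0 < z)%R) xpred0 t 1))%E.
Proof.
pose F t (w : Omega R) := peval (apoly (fun z => -1 < z) xpred0 t 0) w.
pose G m : set (Omega R) := [set w | forall t, m.+1%:R^-1 <= F t w].
have mG m : measurable (G m).
  apply: mset_forall => t.
  have := measurable_peval (apoly (fun z => -1 < z) xpred0 t 0)
    measurableT (measurable_itv `[m.+1%:R^-1 : R, +oo[).
  by rewrite setTI; congr measurable; apply/seteqP; split => w; rewrite /preimage /= in_itv/= andbT.
have aeG : {ae P, forall w : Omega R, exists m, G m w}.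
  apply: filterS3 pm1 p2 ae_summable => w H1 H2 [S HS].
  have [m mS] : exists m : nat, S <= m.+1%:R.
    exists (Num.bound `|S|); apply: le_trans (ler_norm S) _; apply: ltW.
    by apply: lt_trans (archi_boundP (normr_ge0 _)) _; rewrite ltr_nat.
  exists m => t; apply: le_trans (peval_escape_lb H1 H2 (leqnn t) (leq0n _)).
  have D0 := Dg_gt0 H1 H2 0 t.
  rewrite ler_pdivlMr; last exact: upot_gt0.
  have -> : upot w t 1 = Dg w 0 t by rewrite /upot big_ord1 subn0.
  rewrite ler_pdivrMl ?ltr0n//.
  apply: le_trans (upot_le H1 H2 t HS) _.
  by rewrite mulrC ler_wpM2r// ltW.
have [m PG] : exists m, (0 < P (G m))%E.
  apply: contrapT => /forallNP H.
  apply: (@probability_ae_false _ _ _ P).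
  have aeN : {ae P, forall w : Omega R, forall m, ~ G m w}.
    apply: ae_foralln => m; exists (G m); split => //; last by move=> w /= /contrapT.
    by apply/eqP; rewrite eq_le measure_ge0 andbT leNgt; apply/negP/H.
  by apply: filterS2 aeG aeN => w [m Gm] /(_ m).
have PGf : P (G m) \is a fin_num by exact: fin_num_measure.
exists (m.+1%:R^-1 * fine (P (G m))) => [|t].
  by rewrite mulr_gt0 ?invr_gt0 ?ltr0n// fine_gt0// PG -ge0_fin_numE.
have -> : epoly P (apoly (fun z => 0 < z) xpred0 t 1) = (\int[P]_w (F t w)%:E)%E.
  rewrite -(epoly_shift hiid (-1)) -(apoly_shift (D' := fun z => -1 < z) (A' := xpred0))//.
  by move=> i; lia.
rewrite EFinM fineK// -(setIT (G m)) -integral_indic// -ge0_integralZl_EFin//.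
- apply: ge0_le_integral => //.
  + by apply/measurable_EFinP; apply: measurable_funM => //; exact: measurable_indic.
  + by apply/measurable_EFinP; apply: measurable_peval.
  + move=> w _; rewrite -EFinM lee_fin indicE; case: (boolP (w \in G m)).
      by rewrite inE mulr1 => /(_ t).
    by rewrite mulr0 peval_ge0.
- by apply/measurable_EFinP; exact: measurable_indic.
Qed.

End passage.

(** * First passage and the escape probability at a new maximum *)

Section first_passage.
Implicit Types (n a : nat) (X : Path).

Definition pass (n a : nat) : set Path :=
  [set X | (forall i, (i < n)%N -> X i < a%:Z) /\ (a%:Z <= X n <= a.+1%:Z)].

Lemma past_pass n a : past n (pass n a).
Proof.
move=> X Y XY [H1 H2]; split; last by rewrite -XY.
by move=> i iN; rewrite -XY ?H1// ltnW.
Qed.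

Lemma pass_exists (X : Path) (a : nat) : X 0%N <= 1 ->
  (forall n, (X n.+1 - X n) \in [:: -1; 1; 2]) ->
  (forall a : nat, exists i, a%:Z <= X i) -> (0 < a)%N -> exists n, pass n a X.
Proof.
move=> X0 Xj Xu a0; have ex := Xu a.
pose n := ex_minn ex; exists n; rewrite /n; case: ex_minnP => m am mmin; split.
  by move=> i im; rewrite ltNge; apply/negP => /mmin; rewrite leqNgt im.
rewrite am /=; case: m am mmin => [|m] am mmin; first by lia.
have Xm : X m < a%:Z by rewrite ltNge; apply/negP => /mmin; rewrite ltnn.
by have := Xj m; rewrite !inE => /or3P[] /eqP; lia.
Qed.

Lemma pass_inj a n n' X : pass n a X -> pass n' a X -> n = n'.
Proof.
move=> [H1 H2] [H1' H2']; apply/eqP; rewrite eqn_leq; apply/andP; split; rewrite leqNgt; apply/negP.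
  by move=> /H1; move: H2' => /andP[]; lia.
by move=> /H1'; move: H2 => /andP[]; lia.
Qed.

End first_passage.

Section escape_probability.
Context (R : realType) (P : probability (Omega R) R) (Q : probability Path R).
Hypothesis hiid : iid_sites P.
Hypothesis Q0 : Q [set X | X 0%N = 0] = 1%E.
Hypothesis Q_stays : forall (D : int -> bool) t n (x : nat -> int), x 0%N = 0 ->
  Q (cyl n x `&` stays D n t) =
  (\int[P]_w (mono w (path_mono x n) * peval (apoly D xpred0 t (x n)) w)%:E)%E.
Hypothesis Q_jumps : forall n, Q [set X | (X n.+1 - X n) \notin [:: -1; 1; 2]] = 0%E.
Hypothesis em02 : 0 < em P x02 1.
Hypothesis escape : exists2 delta : R, 0 < delta & forall t,
  (delta%:E <= epoly P (apoly (fun z => (0 < z)%R) xpred0 t 1))%E.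
Hypothesis below0 : forall a : nat, (0 < a)%N ->
  (\int[P]_w (apot (fun z => (z < a%:Z)%R) xpred0 0 w)%:E = 0)%E.
Implicit Types (n k t m : nat).

Let rho := fine (palm Q setT).

Let palmT : palm Q setT = rho%:E.
Proof. by rewrite /rho fineK//; exact: palm_fin. Qed.

(** The weight of the first jump from 0 to 2 times the bound of [escape_lb]: recentred at the
    skipped site 1, the walk has to stay positive from 1. *)
Lemma palm_gt0 : 0 < rho.
Proof.
have [delta d0 dP] := escape.
rewrite -lte_fin -palmT (palmE Q0)// esc_start; last exact: frst_x02.
have c := block_cvg hiid Q_stays (x := x02) (k := 1) erefl frst_x02
   (y := fun=> 1) (r := 0%N) erefl (fun=> ltac:(by [])).
apply: (@lt_le_trans _ _ ((em P x02 1)%:E * delta%:E)%E).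
  by rewrite -EFinM lte_fin mulr_gt0.
apply: (cvge_ge _ c); apply: nearW => t; rewrite emE; apply: lee_wpmul2l.
  by rewrite lee_fin ltW.
by rewrite /block /= map_id; exact: dP.
Qed.

Lemma ae_start : {ae Q, forall X : Path, X 0%N = 0}.
Proof.
have mS := measurable_coord 0 (fun z => z = 0).
exists (~` [set X : Path | X 0%N = 0]); split => //; first exact: measurableC.
by rewrite probability_setC// Q0 subee.
Qed.

Lemma ae_jumps : {ae Q, forall X : Path, forall n, (X n.+1 - X n) \in [:: -1; 1; 2]}.
Proof.
apply: ae_foralln => n; exists [set X : Path | (X n.+1 - X n) \notin [:: -1; 1; 2]].
by split; [exact: measurable_jumps|exact: Q_jumps|move=> X /= /negP].
Qed.

Lemma Q_below a : (0 < a)%N -> Q [set X | forall i, X i < a%:Z] = 0%E.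
Proof.
move=> a0; have mst t : measurable (stays (fun z => z < a%:Z) 0 t) by exact: measurable_stays.
have -> : [set X : Path | forall i, X i < a%:Z] = \bigcap_t stays (fun z => z < a%:Z) 0 t.
  apply/seteqP; split => X H; first by move=> t _ j _; exact: H.
  by move=> i; apply: (H i Logic.I); rewrite add0n leqnn.
have c1 : Q (stays (fun z => z < a%:Z) 0 t) @[t --> \oo] -->
    Q (\bigcap_t stays (fun z => z < a%:Z) 0 t).
  apply: nonincreasing_cvg_mu => //.
  - by rewrite (le_lt_trans (probability_le1 Q _)) ?ltry.
  - exact: bigcapT_measurable.
  - move=> s t st; apply/subsetPset => X H i /andP[i1 i2].
    by apply: H; rewrite i1 (leq_trans i2)// leq_add2l.
have c2 := @cvg_epoly R P (fun z => z < a%:Z) xpred0 0; rewrite below0// in c2.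
apply: (cvg_unique _ c1) => //; move: c2; apply: cvg_trans.
apply: near_eq_cvg; apply: nearW => t.
rewrite (Q_start Q0)// setIC.
transitivity (Q (cyl 0 (fun=> 0) `&` stays (fun z => z < a%:Z) 0 t)); last first.
  congr (Q (_ `&` _)); apply/seteqP; split => X /=; first by move=> /(_ 0%N (leqnn _)).
  by move=> X0 k; rewrite leqn0 => /eqP->.
rewrite Q_stays//; apply: eq_integral => w _.
by rewrite /mono big_nil mul1r.
Qed.

Lemma ae_unbounded : {ae Q, forall X : Path, forall a : nat, exists i, a%:Z <= X i}.
Proof.
have H a : {ae Q, forall X : Path, exists i, a.+1%:Z <= X i}.
  exists [set X : Path | forall i, X i < a.+1%:Z]; split.
  - apply: mset_forall => i; exact: (measurable_coord i (fun z => is_true (z < a.+1%:Z))).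
  - exact: Q_below.
  - by move=> X /= /forallNP H i; rewrite ltNge; apply/negP/H.
apply: filterS (ae_foralln H) => X HX a.
by have [i Hi] := HX a; exists i; lia.
Qed.

(** The skipped site is read off the path, since a first passage of a level may land on either of
    two sites. *)
Definition jump_esc n : set Path := [set X | Reg n.+1 (X n + 1) X].

Lemma measurable_jump_esc n : measurable (jump_esc n).
Proof.
rewrite (_ : jump_esc n = [set X : Path | exists k : int, X n = k /\ Reg n.+1 (k + 1) X]).
  apply: mset_existsc => k; apply: mset_and; last exact: measurable_Reg.
  exact: (measurable_coord n (fun z => z = k)).
by apply/seteqP; split => X /=; [exists (X n)|case=> k [<-]].
Qed.

Lemma Q_cyl n (x : nat -> int) : x 0%N = 0 -> Q (cyl n x) = (em P x n)%:E.
Proof.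
move=> x0; rewrite -emE -[in LHS](setIT (cyl n x)).
have -> : [set: Path] = stays xpredT n 0 by apply/seteqP; split.
rewrite Q_stays//; apply: eq_integral => w _.
by rewrite peval0 orbT mulr1.
Qed.

(** At a first passage the present site has never been left before, so the jump of length 2 and the
    following escape have the same probability [rho] whatever the history. *)
Lemma hist_escape n a B : past n B -> B `<=` pass n a ->
  Q (B `&` jump_esc n) = (rho%:E * Q B)%E.
Proof.
move=> pB Bp; have mB := measurable_past pB.
rewrite -[LHS]mul1e.
apply: (@eq_measure_fibers _ _ _ _ Q Q (hist n) (hist n)).
- by apply: measurableI => //; exact: measurable_jump_esc.
- exact: mB.
- exact: measurable_hist.
- exact: measurable_hist.
move=> s; rewrite hist_fiber; case: ifP => _; last by rewrite !setI0 measure0 !mule0.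
suff H0 x : (1%:E * Q (B `&` jump_esc n `&` cyl n x) = rho%:E * Q (B `&` cyl n x))%E.
  exact: H0.
rewrite mul1e.
have [Bx|Bx] := pselect (B x); last first.
  suff e : B `&` cyl n x = set0 by rewrite setIAC e set0I measure0 mule0.
  apply/seteqP; split => // X [BX cX]; apply: Bx.
  by apply: (pB X) => // i iN; rewrite cX.
have eB : B `&` cyl n x = cyl n x.
  by apply/seteqP; split => [X []//|X cX]; split => //; apply: (pB x) => // i iN; rewrite cX.
rewrite setIAC eB; have [xa xn] := Bp _ Bx.
have [x0|x0] := eqVneq (x 0%N) 0; last first.
  suff e A : measurable A -> Q (cyl n x `&` A) = 0%E.
    rewrite e; last exact: measurable_jump_esc.
    by rewrite -(setIT (cyl n x)) e// mule0.
  move=> mA; rewrite (Q_start Q0); last by apply: measurableI => //; exact: measurable_cyl.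
  rewrite (_ : _ `&` _ = set0) ?measure0//; apply/seteqP; split => // X [[cX _] X0].
  by move: x0; rewrite -cX// X0 eqxx.
pose z := upd x n.+1 (x n + 2).
have zf : frst (x n + 1) n.+1 z.
  split; last by rewrite /z /upd eqxx; ring.
  move=> i; rewrite ltnS /z /upd leq_eqVlt => /orP[/eqP->|iN].
    by rewrite ltn_eqF//; lia.
  by rewrite ltn_eqF ?ltnS ?(ltnW iN)//; have := xa _ iN; lia.
have -> : cyl n x `&` jump_esc n = cyl n.+1 z `&` esc n.+1 (x n + 1).
  apply/seteqP; split => X.
    move=> [cX [[_ X1] eX]]; have Xn : X n = x n by rewrite cX.
    rewrite Xn in X1 eX; split; last exact: eX.
    move=> i; rewrite leq_eqVlt => /orP[/eqP->|iN].
      by rewrite X1 /z /upd eqxx; ring.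
    by rewrite /z /upd ltn_eqF// cX.
  move=> [cX eX]; have cXn : cyl n x X.
    by move=> i iN; rewrite cX ?leqW// /z /upd ltn_eqF.
  split => //; rewrite /jump_esc /= cXn//; split => //.
  case: zf => z1 z2; split; last by rewrite cX.
  by move=> i iN; rewrite cX ?z1// ltnW.
have z0 : z 0%N = 0 by [].
have := ren_meas hiid Q0 Q_stays z0 zf (@measurableT _ Path).
rewrite preimage_setT setIT palmT Q_cyl//.
have mE : measurable (cyl n.+1 z `&` esc n.+1 (x n + 1)).
  by apply: measurableI; [exact: measurable_cyl|exact: measurable_esc].
(* All earlier jumps start below [a], the last one at [x n >= a]; independence and translation to
   site 0 split off its weight. *)
have -> : em P z n.+1 = em P x n * em P x02 1.
  apply: EFin_inj; rewrite EFinM -!emE /z path_mono_upd -cats1.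
  rewrite emono_indep//; last first.
    move=> i /mapP[c /mapP[j]]; rewrite mem_iota add0n => /= jn -> ->/=.
    by rewrite inE; have := xa _ jn; lia.
  congr (_ * _)%E; rewrite -(emono_shift hiid (x n) (path_mono x02 1)).
  by congr (emono P [:: (_, _)]); rewrite /x02/=; ring.
rewrite -(fineK (fin_num_measure Q _ mE)) -!EFinM => -[E]; congr (_%:E).
by apply: (mulfI (lt0r_neq0 em02)); rewrite E; ring.
Qed.

End escape_probability.

(** * Typical paths have infinitely many skipped sites *)

Section ae_lemmas.
Context d (T : measurableType d) (R : realType) (mu : {measure set T -> \bar R}).

Lemma le_measure_ae (A B : set T) : measurable A -> measurable B ->
  {ae mu, forall x, A x -> B x} -> (mu A <= mu B)%E.
Proof.
move=> mA mB [N [mN N0 AB]]; rewrite -(measureU0 mB mN N0).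
apply: le_measure; rewrite ?inE//; first exact: measurableU.
move=> x Ax; have [Nx|Nx] := pselect (N x); [by right|left].
by apply: contrapT => Bx; apply: Nx; apply: AB => /= /(_ Ax).
Qed.

Lemma ae_measure0 (A : set T) : measurable A -> {ae mu, forall x, ~ A x} -> mu A = 0%E.
Proof.
move=> mA aeA; apply/eqP; rewrite eq_le measure_ge0 andbT.
by rewrite -(measure0 mu); exact: le_measure_ae.
Qed.
End ae_lemmas.

Definition unvisited (X : Path) (j : int) := forall i, X i <> j.

Lemma measurable_unvisited j : measurable [set X | unvisited X j].
Proof. by apply: mset_forall => i; exact: (measurable_coord i (fun z => z <> j)). Qed.

(** The bound on the start covers both the walk from 0 and a recentred path from 1, so that the
    class is stable under [theta]. *)
Definition typical : set Path := [set X | [/\ X 0%N <= 1,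
  forall n, (X n.+1 - X n) \in [:: -1; 1; 2],
  forall a : nat, exists i, a%:Z <= X i &
  forall m : nat, exists j : nat, (m <= j)%N /\ unvisited X j%:Z]].

Lemma measurable_typical : measurable typical.
Proof.
rewrite (_ : typical = [set X | X 0%N <= 1] `&`
  [set X : Path | forall n, (X n.+1 - X n) \in [:: -1; 1; 2]] `&`
  [set X : Path | forall a : nat, exists i, a%:Z <= X i] `&`
  [set X : Path | forall m : nat, exists j : nat, (m <= j)%N /\ unvisited X j%:Z]); last first.
  by apply/seteqP; split => X; [case=> ? ? ? ?; do 3 (split => //)|case=> [[[? ?] ?] ?]].
apply: measurableI; first apply: measurableI; first apply: measurableI.
- exact: (measurable_coord 0 (fun z => is_true (z <= 1))).
- apply: mset_forall => n.
  have := measurableC (measurable_jumps n); congr measurable.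
  by apply/seteqP; split => X /=; [move=> /negP; rewrite negbK|move=> xj /negP; apply].
- apply: mset_forall => a; apply: mset_exists => i.
  exact: (measurable_coord i (fun z => is_true (a%:Z <= z))).
- apply: mset_forall => m; apply: mset_exists => j; apply: mset_and; first exact: mset_cst.
  exact: measurable_unvisited.
Qed.

(** The least unvisited positive site is jumped over at first passage. Downward jumps have length 1,
    so the path could only get below it again through it. *)
Lemma typical_has_gap X : typical X -> has_gap X.
Proof.
move=> [X0 Xj Xu Xun].
have ex : exists s : nat, (0 < s)%N && `[< unvisited X s%:Z >].
  by have [s [s0 us]] := Xun 1%N; exists s; rewrite s0; apply/asboolP.
pose s := ex_minn ex; have : s = ex_minn ex by []; case: ex_minnP => m /andP[m0 /asboolP um] mmin _.
have [n [n1 n2]] := pass_exists X0 Xj Xu m0.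
have Xn : X n = m%:Z + 1 by have := um n; move: n2; lia.
have aft j : (n <= j)%N -> m%:Z < X j.
  elim: j => [|j IH]; first by rewrite leqn0 => /eqP e; rewrite e in Xn; lia.
  rewrite leq_eqVlt => /orP[/eqP<-|/IH]; first by lia.
  move=> mX; have := um j.+1; have := Xj j; rewrite !inE => /or3P[] /eqP; lia.
exists n, m; split; last by split.
split => // j /andP[j0 jm].
have : ~ unvisited X j%:Z.
  by move=> uj; have := mmin j; rewrite j0 (asboolT uj) => /(_ isT); rewrite leqNgt jm.
move=> /existsNP[i /contrapT Xi]; exists i; split => //.
by rewrite ltnNge; apply/negP => /aft; rewrite Xi; lia.
Qed.

Lemma typical_Phi n k X : 0 <= k -> typical X -> Reg n k X -> typical (Phi n k X).
Proof.
move=> k0 [X0 Xj Xu Xun] [[R1 R2] R3]; split.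
- by rewrite /Phi addn0 R2; lia.
- move=> j; rewrite /Phi addnS.
  by have -> : X (n + j).+1 - k - (X (n + j)%N - k) = X (n + j).+1 - X (n + j)%N by ring.
(* A level of at least [k] is not reached before time [n]. *)
- move=> a; have [i Hi] := Xu (a + `|X n| + `|k|)%N.
  have [iN|iN] := ltnP i n; first by have := R1 _ iN; lia.
  by exists (i - n)%N; rewrite /Phi subnKC//; lia.
- move=> m; have [j [jm uj]] := Xun (m + `|k|)%N.
  exists `|j%:Z - k|%N; split; first by lia.
  by move=> i; rewrite /Phi => e; apply: (uj (n + i)%N); lia.
Qed.

Lemma typical_theta X : typical X -> typical (theta X).
Proof.
move=> tX; have [n [s F]] := typical_has_gap tX.
by rewrite (thetaE F); apply: typical_Phi => //; case: F.
Qed.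

Section almost_sure.
Context (R : realType) (Q Qp : probability Path R) (rho : R).
Hypothesis rho0 : 0 < rho.
Hypothesis hist : forall n a B, past n B -> B `<=` pass n a ->
  Q (B `&` jump_esc n) = (rho%:E * Q B)%E.
Hypothesis start : {ae Q, forall X : Path, X 0%N = 0}.
Hypothesis jumps : {ae Q, forall X : Path, forall n, (X n.+1 - X n) \in [:: -1; 1; 2]}.
Hypothesis unbd : {ae Q, forall X : Path, forall a : nat, exists i, a%:Z <= X i}.
Hypothesis QpE : forall H, measurable H -> Qp H = (fine (palm Q H) / rho)%:E.

Let W m M : set Path := [set X | forall j : nat, (m <= j <= M)%N -> exists i, X i = j%:Z].
Let V m : set Path := [set X | forall j : nat, (m <= j)%N -> exists i, X i = j%:Z].
Let F m M N : set Path :=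
  [set X | forall j : nat, (m <= j <= M)%N -> exists i, (i <= N)%N /\ X i = j%:Z].

Let mW m M : measurable (W m M).
Proof.
apply: mset_forall => j; apply: mset_imply; apply: mset_exists => i.
exact: (measurable_coord i (fun z => z = j%:Z)).
Qed.

Let mV m : measurable (V m).
Proof.
apply: mset_forall => j; apply: mset_imply; apply: mset_exists => i.
exact: (measurable_coord i (fun z => z = j%:Z)).
Qed.

Let mF m M N : measurable (F m M N).
Proof.
apply: mset_forall => j; apply: mset_imply; apply: mset_exists => i.
apply: mset_and; first exact: mset_cst.
exact: (measurable_coord i (fun z => z = j%:Z)).
Qed.

Lemma hist_escape_sum a (B : nat -> set Path) : (forall n, past n (B n)) ->
  (forall n, B n `<=` pass n a) ->
  Q (\bigcup_n (B n `&` jump_esc n)) = (rho%:E * Q (\bigcup_n B n))%E.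
Proof.
move=> pB Bp.
have mB n : measurable (B n) by exact: measurable_past (pB n).
have tB : trivIset setT B.
  apply/trivIsetP => i j _ _; apply: contra_neqP => /eqP/set0P [X [Bi Bj]].
  exact: (pass_inj (Bp _ _ Bi) (Bp _ _ Bj)).
rewrite !measure_semi_bigcup//.
- rewrite -nneseriesZl//; apply: eq_eseriesr => n _.
  exact: (hist (pB n) (Bp n)).
- exact: bigcup_measurable.
- by move=> n; apply: measurableI => //; exact: measurable_jump_esc.
- apply/trivIsetP => i j _ _ ij; apply/seteqP; split => // X [[Bi _] [Bj _]].
  by move: ij; rewrite (pass_inj (Bp _ _ Bi) (Bp _ _ Bj)) eqxx.
- by apply: bigcup_measurable => n _; apply: measurableI => //; exact: measurable_jump_esc.
Qed.

(** Once all sites from [m] to [M] are visited, the next new maximum still leaves a site beyond [m]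
    unvisited for ever with probability [rho]. *)
Let escape_F m M N : (rho%:E * Q (F m M N) <= Q (W m M `\` V m))%E.
Proof.
(* From 0 the walk is at most at [2 * N] at time [N], so level [a] is passed later; the skipped site
   is then above [m]. *)
pose a := (maxn m (N.*2).+1).
pose B n : set Path := pass n a `&`
  [set X | forall j : nat, (m <= j <= M)%N -> exists i, (i <= n)%N /\ X i = j%:Z].
have pB n : past n (B n).
  move=> X Y XY [H1 H2]; split; first exact: (past_pass XY).
  by move=> j /H2 [i [iN Xi]]; exists i; rewrite -XY.
have Bp n : B n `<=` pass n a by move=> X [].
have mB n : measurable (B n) by exact: measurable_past (pB n).
apply: (@le_trans _ _ (rho%:E * Q (\bigcup_n B n))%E).
  apply: lee_wpmul2l; first by rewrite lee_fin ltW.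
  apply: le_measure_ae => //; first exact: bigcup_measurable.
  apply: filterS3 start jumps unbd => X X0 Xj Xu HF.
  have a0 : (0 < a)%N by rewrite /a leq_max orbT.
  have X1 : X 0%N <= 1 by rewrite X0.
  have [n Pn] := pass_exists X1 Xj Xu a0.
  exists n => //; split => // j /HF [i [iN Xi]]; exists i; split => //.
  have X2 q : X q <= (q.*2)%:Z.
    elim: q => [|q IH]; first by rewrite X0.
    by have := Xj q; rewrite !inE => /or3P[] /eqP; lia.
  have nN : (N < n)%N.
    rewrite ltnNge; apply/negP => nN; have := X2 n; case: Pn => _ /andP[+ _].
    by rewrite /a; lia.
  exact: leq_trans iN (ltnW nN).
rewrite -(hist_escape_sum pB Bp); apply: le_measure; rewrite ?inE.
- by apply: bigcup_measurable => n _; apply: measurableI => //; exact: measurable_jump_esc.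
- exact: measurableD.
move=> X [n _ [[[_ Xa] Bn] je]]; split.
  by move=> j /Bn [i [_ Xi]]; exists i.
have un := Reg_unvisited je.
move=> HV; have [|i Xi] := HV `|(X n + 1)%R|%N; first by rewrite /a in Xa; lia.
by have := un i; rewrite Xi; lia.
Qed.

Let escape_W m M : (rho%:E * Q (W m M) <= Q (W m M `\` V m))%E.
Proof.
have c : Q (F m M N) @[N --> \oo] --> Q (\bigcup_N F m M N).
  apply: nondecreasing_cvg_mu => //; first exact: bigcup_measurable.
  move=> N N' NN; apply/subsetPset => X H j /H [i [iN Xi]].
  by exists i; split => //; exact: leq_trans iN NN.
have e : \bigcup_N F m M N = W m M.
  apply/seteqP; split => X; first by move=> [N _ H] j /H [i [_ Xi]]; exists i.
  move=> HW; have H j : exists i, (m <= j <= M)%N -> X i = j%:Z.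
    have [jb|jb] := boolP (m <= j <= M)%N; last by exists 0%N.
    by have [i Xi] := HW j jb; exists i.
  have [f Hf] := choice H.
  exists (\max_(j < M.+1) f j)%N => // j jb; exists (f j); split; last exact: Hf.
  have jM : (j < M.+1)%N by case/andP: jb.
  exact: (leq_bigmax (Ordinal jM)).
rewrite e in c.
have c' : (rho%:E * Q (F m M N))%E @[N --> \oo] --> (rho%:E * Q (W m M))%E by exact: cvgeZl.
by apply: (cvge_le _ c'); apply: nearW => N; exact: escape_F.
Qed.

(** [rho * Q (V m)] is at most [Q (W m M)] with [V m] removed, and these differences decrease to the
    empty set as [M] grows. *)
Lemma all_visited_null m : Q (V m) = 0%E.
Proof.
have c : Q (W m M `\` V m) @[M --> \oo] --> Q (\bigcap_M (W m M `\` V m)).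
  apply: nonincreasing_cvg_mu.
  - by rewrite (le_lt_trans (probability_le1 Q _)) ?ltry//; exact: measurableD.
  - by move=> M; exact: measurableD.
  - by apply: bigcapT_measurable => M; exact: measurableD.
  - move=> M M' MM; apply/subsetPset => X [H1 H2]; split => // j /andP[j1 j2].
    by apply: H1; rewrite j1 (leq_trans j2).
have e0 : \bigcap_M (W m M `\` V m) = set0.
  apply/seteqP; split => // X H; have [_ nV] := H 0%N Logic.I; apply: nV => j mj.
  by have [+ _] := H j Logic.I; apply; rewrite mj leqnn.
rewrite e0 measure0 in c.
have : (rho%:E * Q (V m) <= 0)%E.
  apply: (cvge_ge _ c); apply: nearW => M; apply: le_trans (escape_W m M).
  apply: lee_wpmul2l; first by rewrite lee_fin ltW.
  apply: le_measure; rewrite ?inE//.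
  by move=> X HV j /andP[mj _]; exact: HV.
have := measure_ge0 Q (V m); rewrite le_eqVlt => /orP[/eqP <-//|V0].
by rewrite leNgt mule_gt0.
Qed.

Lemma ae_typical : {ae Q, forall X, typical X}.
Proof.
have inf : {ae Q, forall X : Path, forall m : nat, exists j : nat, (m <= j)%N /\ unvisited X j%:Z}.
  apply: ae_foralln => m; exists (V m); split => //; first exact: all_visited_null.
  move=> X /= /forallNP H j mj; apply: contrapT => nX; apply: (H j); split => //.
  by move=> i Xi; apply: nX; exists i.
have H : {ae Q, forall X : Path, X 0%N = 0 /\
  (forall m : nat, exists j : nat, (m <= j)%N /\ unvisited X j%:Z)}.
  by apply: filterS2 start inf => X.
by apply: filterS3 H jumps unbd => X [X0 Xi] Xj Xu; split => //; rewrite X0.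
Qed.

Let palm_null H : measurable H -> {ae Q, forall X, Reg 1 1 X -> ~ H (Phi 1 1 X)} ->
  Qp H = 0%E.
Proof.
move=> mH aeH; rewrite QpE// (_ : palm Q H = 0%E) ?mul0r//.
apply: ae_measure0.
  by apply: measurableI; [exact: measurable_Reg|exact: measurable_preimage_Phi].
by apply: filterS aeH => X HX [RX]; exact: HX.
Qed.

Lemma ae_typical_palm : {ae Qp, forall X, typical X}.
Proof.
have mC := measurableC measurable_typical.
exists (~` typical); split => //; apply: palm_null => //.
by apply: filterS ae_typical => X tX RX; apply: contrapT => /contrapT; apply; exact: typical_Phi.
Qed.

Lemma ae_start_palm : {ae Qp, forall X : Path, X 0%N = 1}.
Proof.
have mC : measurable [set X : Path | X 0%N <> 1] by exact: (measurable_coord 0 (fun z => z <> 1)).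
exists [set X : Path | X 0%N <> 1]; split => //.
apply: palm_null => //; apply: aeW => X [[_ X1] _] /=; apply.
by rewrite /Phi addn0 X1; ring.
Qed.

Lemma no_gap_null : Qp (~` has_gap) = 0%E.
Proof.
apply: ae_measure0; first by apply: measurableC; exact: measurable_has_gap.
by apply: filterS ae_typical_palm => X /typical_has_gap H; apply.
Qed.

End almost_sure.

(** * The renewal inequality and the finiteness of the mean gap *)

Section mean_gap.
Context (R : realType) (Q Qp : probability Path R) (rho : R).
Hypothesis rho0 : 0 < rho.
Hypothesis rgQ : regen Q Qp.
Hypothesis hist : forall n a B, past n B -> B `<=` pass n a ->
  Q (B `&` jump_esc n) = (rho%:E * Q B)%E.
Hypothesis start : {ae Q, forall X : Path, X 0%N = 0}.
Hypothesis jumps : {ae Q, forall X : Path, forall n, (X n.+1 - X n) \in [:: -1; 1; 2]}.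
Hypothesis unbd : {ae Q, forall X : Path, forall a : nat, exists i, a%:Z <= X i}.

Definition regen_at (k : nat) : set Path := \bigcup_n Reg n k%:Z.

Lemma measurable_regen_at k : measurable (regen_at k).
Proof. by apply: bigcupT_measurable => n; exact: measurable_Reg. Qed.

Lemma Reg_inj n n' k X : Reg n k X -> Reg n' k X -> n = n'.
Proof.
move=> [[H1 H2] H3] [[H1' H2'] H3']; apply/eqP; rewrite eqn_leq.
apply/andP; split; rewrite leqNgt; apply/negP.
  by move=> /H1; rewrite H2'; lia.
by move=> /H1'; rewrite H2; lia.
Qed.

Lemma regen_at_future k H : measurable H ->
  Q (\bigcup_n (Reg n k%:Z `&` Phi n k%:Z @^-1` H)) = (Q (regen_at k) * Qp H)%E.
Proof.
move=> mH; have mR n : measurable (Reg n k%:Z) by exact: measurable_Reg.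
have mP n : measurable (Reg n k%:Z `&` Phi n k%:Z @^-1` H).
  by apply: measurableI => //; exact: measurable_preimage_Phi.
have fH : Qp H \is a fin_num by exact: fin_num_measure.
rewrite /regen_at !measure_semi_bigcup//.
- rewrite muleC -(fineK fH) -nneseriesZl//; apply: eq_eseriesr => n _.
  rewrite fineK//; have := rgQ (B := setT) k%:Z (n := n) (fun X Y _ _ => I) mH.
  by rewrite !setTI muleC.
- apply/trivIsetP => i j _ _ ij; apply/seteqP; split => // X [Ri Rj].
  by move: ij; rewrite (Reg_inj Ri Rj) eqxx.
- exact: bigcup_measurable.
- apply/trivIsetP => i j _ _ ij; apply/seteqP; split => // X [[Ri _] [Rj _]].
  by move: ij; rewrite (Reg_inj Ri Rj) eqxx.
- exact: bigcup_measurable.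
Qed.

Let mtail j : measurable [set X | (j < sigma X)%N].
Proof.
have := measurable_sigma measurableT (I : measurable [set s | (j < s)%N]).
by rewrite setTI.
Qed.

(** The [i]-th term is the probability that [i.+1] is skipped and the next gap leads beyond [N].
    These events are disjoint: within a gap every site is visited, so no later site up to [N] is
    skipped. *)
Lemma renewal_sum N :
  (\sum_(i < N) Q (regen_at i.+1) * Qp [set X | (N - i.+1 < sigma X)%N] <= 1)%E.
Proof.
pose A i : set Path := if (i < N)%N then
  \bigcup_n (Reg n i.+1%:Z `&` Phi n i.+1%:Z @^-1` [set X | (N - i.+1 < sigma X)%N]) else set0.
have mA i : measurable (A i).
  rewrite /A; case: ifP => // _; apply: bigcupT_measurable => n.
  by apply: measurableI; [exact: measurable_Reg|exact: measurable_preimage_Phi].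
have tA : trivIset setT A.
  have dis i j X : (i < j)%N -> A i X -> A j X -> False.
    move=> ij; rewrite /A; case: ifP => // iN; case: ifP => // jN.
    move=> [n _ [Ri si]] [n' _ [Rj _]].
    have uj := Reg_unvisited Rj.
    rewrite /preimage /= in si.
    have [[n1 [s F]]|ng] := pselect (has_gap (Phi n i.+1%:Z X)); last first.
      by move: si; rewrite /sigma gap_pair0//.
    move: si; rewrite (sigmaE F) => si; case: F => -[s0 vb] _.
    have [|q [_ Xq]] := vb (j - i)%N; first by lia.
    by have := uj (n + q)%N; move: Xq; rewrite /Phi => Xq; lia.
  apply/trivIsetP => i j _ _ ij; apply/seteqP; split => // X [Ai Aj].
  by have [/dis|/dis|e] := ltngtP i j; [move/(_ _ Ai Aj)|move/(_ _ Aj Ai)|move: ij; rewrite e eqxx].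
have := measure_bigsetU Q mA tA N.
have -> : (\sum_(i < N) Q (A i) =
    \sum_(i < N) Q (regen_at i.+1) * Qp [set X | (N - i.+1 < sigma X)%N])%E.
  by apply: eq_bigr => i _; rewrite /A ltn_ord regen_at_future.
move=> <-; apply: probability_le1; exact: bigsetU_measurable.
Qed.

(** Passage of level [a] lands on [a] or [a + 1]; with probability [rho] the site just above is then
    skipped. *)
Lemma regen_pair a : (0 < a)%N ->
  (rho%:E <= Q (regen_at a.+1) + Q (regen_at a.+2))%E.
Proof.
move=> a0; have H := hist_escape_sum hist (fun n => @past_pass n a) (fun n => @subset_refl _ (pass n a)).
have m1 : measurable (\bigcup_n (pass n a `&` jump_esc n)).
  apply: bigcupT_measurable => n; apply: measurableI; last exact: measurable_jump_esc.
  exact: measurable_past (@past_pass n a).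
have P1 : Q (\bigcup_n pass n a) = 1%E.
  have mp : measurable (\bigcup_n pass n a).
    by apply: bigcupT_measurable => n; exact: measurable_past (@past_pass n a).
  apply/eqP; rewrite eq_le probability_le1//=.
  have <- : Q [set: Path] = 1%E by exact: probability_setT.
  apply: le_measure_ae => //; apply: filterS3 start jumps unbd => X X0 Xj Xu _.
  have X1 : X 0%N <= 1 by rewrite X0.
  by have [n Pn] := pass_exists X1 Xj Xu a0; exists n.
rewrite P1 mule1 in H; rewrite -H.
apply: (@le_trans _ _ (Q (regen_at a.+1 `|` regen_at a.+2))).
  apply: le_measure; rewrite ?inE//; first by apply: measurableU; exact: measurable_regen_at.
  move=> X [n _ [[_ Xa] je]].
  have [e|e] : X n + 1 = a.+1%:Z \/ X n + 1 = a.+2%:Z by lia.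
    by left; exists n.+1 => //; rewrite -e.
  by right; exists n.+1 => //; rewrite -e.
by apply: measureU2; exact: measurable_regen_at.
Qed.

(** The term [j = 0] is at most 1. Elsewhere [rho] is replaced by a sum of two consecutive renewal
    probabilities, and monotonicity of the tail turns the result into two renewal sums, each at most
    1. *)
Lemma tail_sum M :
  \sum_(j < M) fine (Qp [set X | (j < sigma X)%N]) <= 1 + 2 / rho.
Proof.
pose f j := fine (Qp [set X | (j < sigma X)%N]); pose r k := fine (Q (regen_at k)).
have f0 j : 0 <= f j by rewrite fine_ge0.
have r0 k : 0 <= r k by rewrite fine_ge0.
have fin_f j : Qp [set X | (j < sigma X)%N] \is a fin_num by exact: fin_num_measure.
have fin_r k : Q (regen_at k) \is a fin_num by apply: fin_num_measure; exact: measurable_regen_at.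
have fle i j : (i <= j)%N -> f j <= f i.
  move=> ij; rewrite /f fine_le//; apply: le_measure; rewrite ?inE//.
  by move=> X /=; exact: leq_ltn_trans.
have f1 j : f j <= 1 by rewrite /f -lee_fin fineK//; exact: probability_le1.
have S N : \sum_(i < N) r i.+1 * f (N - i.+1)%N <= 1.
  rewrite -lee_fin -sumEFin; apply: le_trans (renewal_sum N).
  by apply: lee_sum => i _; rewrite EFinM !fineK.
have pr a : (0 < a)%N -> rho <= r a.+1 + r a.+2.
  by move=> a0; rewrite -lee_fin EFinD !fineK//; exact: regen_pair.
case: M => [|M]; first by rewrite big_ord0 addr_ge0// divr_ge0// ltW.
rewrite big_ord_recl lerD//; first exact: f1.
rewrite ler_pdivlMr// mulrC mulr_sumr.
have SM := S M.+2.
rewrite big_ord_recl/= in SM.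
have SM1 : \sum_(i < M.+1) r i.+2 * f (M - i)%N <= 1.
  by apply: le_trans SM; rewrite -[leLHS]add0r lerD ?mulr_ge0.
have H1 : \sum_(i < M) r i.+2 * f (M - i)%N <= 1.
  by apply: le_trans SM1; rewrite big_ord_recr/= lerDl mulr_ge0.
have H2 : \sum_(i < M) r i.+3 * f (M - i.+1)%N <= 1.
  apply: le_trans SM1; rewrite big_ord_recl/= -[leLHS]add0r lerD ?mulr_ge0//.
(* Reversing the order of summation brings the tails into the form of a convolution. *)
have -> : \sum_(i < M) rho * fine (Qp [set X | (lift ord0 i < sigma X)%N]) =
    \sum_(i < M) rho * f (M - i)%N.
  rewrite (reindex_inj rev_ord_inj) /=; apply: eq_bigr => i _.
  congr (_ * f _); rewrite /bump /= add1n.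
  have := ltn_ord i; lia.
apply: (@le_trans _ _ (\sum_(i < M) r i.+2 * f (M - i)%N + \sum_(i < M) r i.+3 * f (M - i.+1)%N)).
  rewrite -big_split/=; apply: ler_sum => i _.
  apply: (@le_trans _ _ ((r i.+2 + r i.+3) * f (M - i)%N)).
    by rewrite ler_wpM2r// pr.
  by rewrite mulrDl lerD2l ler_wpM2l// fle// leq_sub2l.
by rewrite (_ : 2 = 1 + 1 :> R)// lerD.
Qed.

Lemma integral_sigma_le : (\int[Qp]_X ((sigma X)%:R)%:E <= (1 + 2 / rho)%:E)%E.
Proof.
(* The layer-cake form of [sigma] truncated at [n]; its integral is a partial sum of tails. *)
pose g n (X : Path) : \bar R := (\sum_(j < n) (\1_[set X | (j < sigma X)%N] X : R)%:E)%E.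
have gE n X : g n X = ((minn (sigma X) n)%:R : R)%:E.
  rewrite /g sumEFin; congr (_%:E); elim: n => [|n IH]; first by rewrite big_ord0 minn0.
  rewrite big_ord_recr/= IH indicE mem_setE /= -natrD; congr (_%:R).
  by rewrite /minn; case: (ltnP n (sigma X)) => h; case: (ltnP (sigma X) n) => h1;
    case: (ltnP (sigma X) n.+1) => h2; lia.
have mg n : measurable_fun [set: Path] (g n).
  by apply: emeasurable_sum => j; apply/measurable_EFinP; exact: measurable_indic.
have gc X : g n X @[n --> \oo] --> ((sigma X)%:R : R)%:E.
  apply: cvg_near_cst; exists (sigma X) => // n /= sn.
  by rewrite gE (minn_idPl sn).
have -> : (\int[Qp]_X ((sigma X)%:R)%:E = \int[Qp]_X limn (g^~ X))%E.
  by apply: eq_integral => X _; apply/esym/cvg_lim => //; exact: gc.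
have c := @cvg_monotone_convergence _ _ R Qp setT measurableT g mg.
have {}c : (\int[Qp]_X g n X)%E @[n --> \oo] --> (\int[Qp]_X limn (g^~ X))%E.
  apply: c.
  - by move=> n X _; rewrite gE lee_fin.
  - move=> X _ m n mn; rewrite !gE lee_fin ler_nat leq_min geq_minl/=.
    by rewrite (leq_trans (geq_minr _ _)).
apply: (cvge_le _ c); apply: nearW => n.
rewrite /g ge0_integral_sum//; last by move=> j; apply/measurable_EFinP; exact: measurable_indic.
apply: (@le_trans _ _ ((\sum_(j < n) fine (Qp [set X | (j < sigma X)%N]))%:E)).
  rewrite -sumEFin; apply: lee_sum => j _.
  by rewrite integral_indic// setIT fineK// fin_num_measure.
by rewrite lee_fin tail_sum.
Qed.

End mean_gap.

(** * Counting skipped sites by the sums of gaps *)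

Section counting.
Implicit Types (X : Path) (n s m q : nat).

Definition cnt X n : nat := count (fun j => `[< unvisited X j%:Z >]) (iota 1 n).

Definition gap_sum X m : nat := (\sum_(i < m) sigma (iter i theta X))%N.

Lemma gap_sumS X m : gap_sum X m.+1 = (sigma X + gap_sum (theta X) m)%N.
Proof.
rewrite /gap_sum big_ord_recl; congr (_ + _)%N.
by apply: eq_bigr => i _; rewrite /= -iterS iterSr.
Qed.

Lemma unvisited_theta n s q X : Fst n s X ->
  unvisited X (s + q)%:Z <-> unvisited (theta X) q%:Z.
Proof.
move=> F; rewrite (thetaE F); case: F => _ [[R1 _] _]; split=> H i.
  by have := H (n + i)%N; rewrite /Phi; lia.
have [iN|iN] := ltnP i n; first by have := R1 _ iN; lia.
by have := H (i - n)%N; rewrite /Phi subnKC//; lia.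
Qed.

Lemma cnt_before_gap n s q X : Fst n s X -> (q < s)%N -> cnt X q = 0%N.
Proof.
move=> [[_ V] _] qs; apply/eqP; rewrite -leqn0 leqNgt -has_count; apply/hasPn => j.
rewrite mem_iota => jq; apply/asboolPn => H.
have [|i [_ Xi]] := V j; first by lia.
exact: (H i).
Qed.

Lemma cnt_after_gap n s q X : Fst n s X -> cnt X (s + q) = (cnt (theta X) q).+1.
Proof.
move=> F; have [[s0 _] R] := F; have [p Ep] : exists p, s = p.+1 by exists s.-1; rewrite prednK.
rewrite /cnt (_ : s + q = p + (1 + q))%N; last by rewrite Ep; lia.
rewrite iotaD count_cat.
have -> : count (fun j => `[< unvisited X j%:Z >]) (iota 1 p) = 0%N.
  by apply: (cnt_before_gap F); rewrite Ep.
have us : unvisited X s%:Z by move=> i; apply/eqP; exact: Reg_unvisited R i.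
rewrite [iota _ (1 + q)]/= add1n -Ep /= asboolT// add0n add1n; congr S.
rewrite -addn1 iotaDl count_map; apply: eq_count => j /=.
by apply/asboolP/asboolP => /(unvisited_theta j F).
Qed.

(** [gap_sum X m] is the position of the [m]-th skipped site, so counting function and positions are
    inverse to each other. The induction removes the first gap. *)
Lemma cnt_ge X m n : typical X -> (m <= cnt X n)%N = (gap_sum X m <= n)%N.
Proof.
elim: m X n => [|m IH] X n tX; first by rewrite /gap_sum big_ord0 !leq0n.
have [k [s F]] := typical_has_gap tX.
rewrite gap_sumS (sigmaE F); have [ns|sn] := ltnP n s.
  by rewrite (cnt_before_gap F ns) ltn0; symmetry; apply/negbTE; rewrite -ltnNge ltn_addr.
rewrite -[in LHS](subnKC sn) (cnt_after_gap _ F) ltnS IH; first by rewrite leq_subRL.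
exact: typical_theta.
Qed.

Lemma cnt_le X n : (cnt X n <= n)%N.
Proof. by rewrite (leq_trans (count_size _ _)) ?size_iota. Qed.

End counting.

Section gap_sum_limit.
Context (R : realType) (mu : R).

(** This encodes [gap_sum X m / m --> mu] with countably many error rates and an additive constant,
    which is stable under removing a gap and is what the maximal inequality delivers. *)
Definition linear_gaps (X : Path) := forall k : nat, exists C : R, forall m : nat,
  `|(gap_sum X m)%:R - mu * m%:R| <= m%:R / k.+1%:R + C.

Lemma linear_gaps_theta X : linear_gaps (theta X) -> linear_gaps X.
Proof.
move=> H k; have [C HC] := H k.
exists (`|C| + `|(sigma X)%:R - mu|) => -[|m].
  by rewrite /gap_sum big_ord0 !mulr0 subr0 mul0r normr0 add0r addr_ge0.
rewrite gap_sumS natrD -natr1 mulrDr mulr1.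
rewrite (_ : _ - _ = ((gap_sum (theta X) m)%:R - mu * m%:R) + ((sigma X)%:R - mu)); last by ring.
apply: (le_trans (ler_normD _ _)); rewrite addrA lerD2r; apply: (le_trans (HC m)).
by rewrite lerD ?ler_norm// ler_wpM2r ?invr_ge0// lerDl.
Qed.

Lemma linear_cnt X : 1 <= mu -> typical X -> linear_gaps X ->
  forall k : nat, exists C : R, forall n : nat,
  `|(cnt X n)%:R - n%:R / mu| <= n%:R / k.+1%:R + C.
Proof.
move=> mu1 tX H k; have [C HC] := H k.
(* For [m = cnt X n], [n] lies between the positions of the skipped sites [m] and [m.+1]; the extra
   index costs one [mu] and one error [e <= 1]. *)
exists (`|C| + mu + 1) => n.
have mu0 : 0 < mu by apply: lt_le_trans mu1.
set e : R := k.+1%:R^-1; have e0 : 0 <= e by rewrite invr_ge0.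
have e1 : e <= 1 by rewrite invf_le1// ler1n.
set m := cnt X n; have mn : (m <= n)%N by exact: cnt_le.
have T1 : (gap_sum X m <= n)%N by rewrite -cnt_ge.
have T2 : (n < gap_sum X m.+1)%N by rewrite ltnNge -cnt_ge// ltnn.
have := HC m; have := HC m.+1; rewrite !ler_norml => /andP[_ h1] /andP[h2 _].
have Cn : C <= `|C| by exact: ler_norm.
have C0 : 0 <= `|C| by [].
have t1 : (gap_sum X m)%:R <= n%:R :> R by rewrite ler_nat.
have t2 : n%:R <= (gap_sum X m.+1)%:R :> R by rewrite ler_nat ltnW.
have mn' : m%:R <= n%:R :> R by rewrite ler_nat.
have m0 : 0 <= m%:R :> R by [].
rewrite -natr1 -/e in h1; rewrite -/e in h2.
have en : m%:R * e <= n%:R * e by rewrite ler_wpM2r.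
have D : n%:R / mu * mu = n%:R by rewrite divfK// gt_eqF.
set y := n%:R / mu in D *.
have E0 : 0 <= n%:R * e by rewrite mulr_ge0.
have F : `|(m%:R - y) * mu| <= n%:R * e + (`|C| + mu + 1).
  by rewrite mulrBl D ler_norml; apply/andP; split; nra.
rewrite -ler_norml; apply: le_trans _ F; rewrite normrM (gtr0_norm mu0) ler_peMr//.
Qed.

End gap_sum_limit.

(** * The strong law for the positions of the skipped sites *)

Section law_of_large_numbers.
Context (R : realType) (Q Qp : probability Path R).
Hypothesis rgQ : regen Q Qp.
Hypothesis rgQp : regen Qp Qp.
Hypothesis gapQ : Q (~` has_gap) = 0%E.
Hypothesis gapQp : Qp (~` has_gap) = 0%E.
Hypothesis startQp : {ae Qp, forall X : Path, X 0%N = 1}.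
Variable B : R.
Hypothesis sigma_int : (\int[Qp]_X ((sigma X)%:R)%:E <= B%:E)%E.

Definition mean_gap : R := \int[Qp]_X (sigma X)%:R.

Let mS : measurable_fun [set: Path] (fun X => (sigma X)%:R : R).
Proof. exact: (measurableT_comp (f := fun s : nat => s%:R : R)) measurable_sigma. Qed.

Lemma integrable_sigma : Qp.-integrable [set: Path] (EFin \o (fun X => (sigma X)%:R : R)).
Proof.
apply/integrableP; split; first exact/measurable_EFinP.
apply: (@le_lt_trans _ _ B%:E); last by rewrite ltry.
apply: le_trans sigma_int; apply: ge0_le_integral => //.
- by apply: measurableT_comp => //; apply/measurable_EFinP; exact: mS.
- by apply/measurable_EFinP; exact: mS.
- by move=> X _; rewrite /= lee_fin normr_nat.
Qed.

(** After a skip the recentred path starts at 1, so site 1 is visited and the next skipped site is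
    at least 2. *)
Lemma mean_gap_ge2 : 2 <= mean_gap.
Proof.
have fin := integrable_fin_num measurableT integrable_sigma.
rewrite -lee_fin /mean_gap /Rintegral fineK//.
have <- : (\int[Qp]_(X in [set: Path]) (cst 2%:E X) = 2%:E :> \bar R)%E.
  rewrite integral_cst// -[RHS]mule1; congr (_ * _)%E; exact: probability_setT.
apply: ae_ge0_le_integral => //.
- by move=> X _; rewrite lee_fin.
- by apply/measurable_EFinP; exact: mS.
have gap : {ae Qp, forall X, has_gap X}.
  by exists (~` has_gap); split => //; apply: measurableC; exact: measurable_has_gap.
apply: filterS2 startQp gap => X X0 [n [s F]] _.
rewrite (sigmaE F) lee_fin ler_nat; case: F => -[s0 _] /Reg_unvisited /(_ 0%N).
by rewrite X0; lia.
Qed.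

Let drift_bounded (phi : nat -> R) : Qp.-integrable [set: Path] (EFin \o (phi \o sigma)) ->
  \int[Qp]_X phi (sigma X) < 0 ->
  {ae Qp, forall X, exists C : R, forall n, \sum_(i < n) phi (sigma (iter i theta X)) <= C}.
Proof.
move=> ip neg.
have ind s H : measurable H -> Qp ([set x | sigma x = s] `&` theta @^-1` H) =
    (Qp [set x | sigma x = s] * Qp H)%E by apply: regen_law.
exact: (ae_bounded_sums measurable_theta measurable_sigma ind ip neg).
Qed.

(** The maximal inequality is applied to the gaps minus [mean_gap + e] and to [mean_gap - e] minus
    the gaps, both of mean [- e]. *)
Lemma ae_linear_gaps_palm : {ae Qp, forall X, linear_gaps mean_gap X}.
Proof.
have ic c : Qp.-integrable [set: Path] (EFin \o cst (c : R)).
  exact: finite_measure_integrable_cst.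
apply: ae_foralln => k.
set e : R := k.+1%:R^-1; have e0 : 0 < e by rewrite invr_gt0.
have Qp1 : fine (Qp [set: Path]) = 1 by have -> : Qp [set: Path] = 1%E by exact: probability_setT.
have up : {ae Qp, forall X, exists C : R, forall n,
    \sum_(i < n) ((sigma (iter i theta X))%:R - (mean_gap + e)) <= C}.
  apply: (drift_bounded (phi := fun s => s%:R - (mean_gap + e))).
    exact: (integrableB measurableT integrable_sigma (ic (mean_gap + e))).
  rewrite RintegralB//; last 2 first.
  - exact: integrable_sigma.
  - exact: ic.
  rewrite Rintegral_cst// Qp1 mulr1 -/mean_gap; lra.
have dn : {ae Qp, forall X, exists C : R, forall n,
    \sum_(i < n) ((mean_gap - e) - (sigma (iter i theta X))%:R) <= C}.
  apply: (drift_bounded (phi := fun s => (mean_gap - e) - s%:R)).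
    exact: (integrableB measurableT (ic (mean_gap - e)) integrable_sigma).
  rewrite RintegralB//; last 2 first.
  - exact: ic.
  - exact: integrable_sigma.
  rewrite Rintegral_cst// Qp1 mulr1 -/mean_gap; lra.
apply: filterS2 up dn => X [C HC] [D HD].
exists (Num.max C D) => m; have := HC m; have := HD m.
rewrite !big_split/= !sumrN !sumr_const card_ord -natr_sum -/(gap_sum X m).
rewrite -(mulr_natr (mean_gap + e)) -(mulr_natr mean_gap) -(mulr_natr e) ler_norml -/e.
have CM : C <= Num.max C D by rewrite le_max lexx.
have DM : D <= Num.max C D by rewrite le_max lexx orbT.
move=> h1 h2; apply/andP; split; lra.
Qed.

(** The first gap has another law under [Q], but [theta X] has the Palm law and one gap does not
    affect [linear_gaps]. *)
Lemma ae_linear_gaps : {ae Q, forall X, linear_gaps mean_gap X}.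
Proof.
have [N [mN N0 HN]] := ae_linear_gaps_palm.
have mt : measurable (theta @^-1` N).
  by rewrite -[X in measurable X]setTI; exact: measurable_theta.
have msig s : measurable [set X | sigma X = s].
  by have := measurable_sigma measurableT (I : measurable [set s]); rewrite setTI.
have null : Q.-negligible (\bigcup_s ([set X | sigma X = s] `&` theta @^-1` N)).
  apply: negligible_bigcup => s; exists ([set X | sigma X = s] `&` theta @^-1` N); split => //.
    exact: measurableI.
  by have := regen_law rgQ gapQ s mN; rewrite N0 mule0.
apply: negligibleS null => X; apply: contra_notP => HX.
apply: linear_gaps_theta; apply: contrapT => ng; apply: HX.
by exists (sigma X) => //; split => //; exact: HN.
Qed.

End law_of_large_numbers.

(** * From skipped sites to the density of visited sites *)

Section visited_sites.
Import finmap.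

(** [cnt] only looks at positive sites; the successor accounts for site 0, which is visited at time
    0. *)
Lemma num_visitedE (R : realType) (X : Path) (x : R) : X 0%N = 0 -> 0 <= x ->
  num_visited X x = (Num.truncn x - cnt X (Num.truncn x)).+1.
Proof.
move=> X0 x0; set n := Num.truncn x.
pose v (j : nat) : bool := `[< exists i, X i = j%:Z >].
pose s := [seq Posz j | j <- iota 0 n.+1 & v j].
have us : uniq s by rewrite map_inj_uniq ?filter_uniq ?iota_uniq// => ? ? [].
have -> : num_visited X x = size s.
  rewrite /num_visited (_ : visited X x = [set` seq_fset tt s]); last first.
    apply/seteqP; split => y.
      move=> [i [<- [Xi0 Xix]]]; rewrite /mkset seq_fsetE; apply/mapP.
      exists `|X i|%N; last by lia.
      rewrite mem_filter mem_iota /= add0n ltnS truncn_ge_nat//; apply/andP; split.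
        by apply/asboolP; exists i; lia.
      by rewrite -[_%:R]/((`|X i|%N)%:~R) gez0_abs.
    rewrite /mkset seq_fsetE => /mapP[j]; rewrite mem_filter mem_iota add0n ltnS.
    move=> /andP[/asboolP[i Xi] jn] ->; exists i; rewrite Xi; do 2 split => //.
    by move: jn; rewrite /= truncn_ge_nat.
  by rewrite set_fsetK size_seq_fset undup_id.
have v0 : v 0%N by apply/asboolP; exists 0%N.
rewrite size_map size_filter /= v0 add1n.
congr S; apply: (@addIn (cnt X n)); rewrite subnK ?cnt_le//.
have -> : cnt X n = count (predC v) (iota 1 n).
  apply: eq_count => j /=; apply/asboolP/asboolPn; first by move=> u [i]; exact: u.
  by move=> u i Xi; apply: u; exists i.
by rewrite count_predC size_iota.
Qed.

End visited_sites.

Lemma num_visited_cvg (R : realType) (mu : R) (X : Path) : 1 <= mu -> X 0%N = 0 ->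
  typical X -> linear_gaps mu X ->
  (num_visited X x)%:R / x @[x --> +oo] --> 1 - mu^-1.
Proof.
move=> mu1 X0 tX lX; have mu0 : 0 < mu by apply: lt_le_trans mu1.
have i1 : mu^-1 <= 1 by rewrite invf_le1.
have i0 : 0 < mu^-1 by rewrite invr_gt0.
suff H (e : R) : 0 < e ->
    \forall x \near +oo, `|1 - mu^-1 - (num_visited X x)%:R / x| < e.
  by apply/cvgrPdist_lt.
move=> e0.
have [k ke] : exists k : nat, k.+1%:R^-1 <= e / 2.
  have [k _ Hk] := near_infty_natSinv_lt (PosNum (divr_gt0 e0 (ltr0Sn _ 1))).
  by exists k; apply: ltW; apply: Hk => /=.
have [C HC] := linear_cnt mu1 tX lX k.
(* One half of [e] absorbs the error [n / k.+1], the other the bounded errors: [C], the rounding of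
   [x] and of [x / mu], and the site 0. *)
exists (Num.max 1 ((`|C| + 3) / (e / 2))); split; first exact: num_real.
move=> x; rewrite gt_max => /andP[x1 xC].
have x0 : 0 < x by apply: lt_trans x1.
rewrite num_visitedE ?ltW//; set n := Num.truncn x.
have /andP[nx xn] := truncn_itv (ltW x0); rewrite -/n in nx xn.
have cn : (cnt X n <= n)%N by exact: cnt_le.
rewrite -natr1 natrB//; rewrite -natr1 in xn.
have := HC n; rewrite ler_norml => /andP[h1 h2].
have xC' : `|C| + 3 < x * (e / 2) by rewrite -ltr_pdivrMr ?divr_gt0.
have CC : C <= `|C| by exact: ler_norm.
have nk : n%:R / k.+1%:R <= x * (e / 2).
  by apply: ler_pM => //; rewrite invr_ge0.

have nmu : n%:R / mu <= x / mu by rewrite ler_wpM2r// ltW.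
have xmu : x / mu <= n%:R / mu + 1.

  apply: (@le_trans _ _ ((n%:R + 1) / mu)); first by rewrite ler_wpM2r// ltW.
  by rewrite mulrDl lerD2l mul1r.
have D : `|(1 - mu^-1) * x - (n%:R - (cnt X n)%:R + 1)| < e * x.
  have -> : (1 - mu^-1) * x = x - x / mu by rewrite mulrBl mul1r mulrC.
  have -> : e * x = x * (e / 2) + x * (e / 2) by field.
  rewrite ltr_norml; apply/andP.
  move: (x / mu) (n%:R / mu) (n%:R / k.+1%:R) (x * (e / 2)) nmu xmu h1 h2 nk xC'.
  by move=> a b c d nmu xmu h1 h2 nk xC'; split; lra.
rewrite -(ltr_pM2r x0); apply: le_lt_trans D.
have -> : (1 - mu^-1) * x - (n%:R - (cnt X n)%:R + 1) =
    (1 - mu^-1 - (n%:R - (cnt X n)%:R + 1) / x) * x.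
  by rewrite [RHS]mulrBl divfK ?gt_eqF.
by rewrite normrM (gtr0_norm x0).
Qed.

Lemma annealed_stays (R : realType) (P : probability (Omega R) R)
    (K : R.-pker (Omega R) ~> Path) : quenched_law K 0 ->
  forall (D : int -> bool) t n (x : nat -> int), x 0%N = 0 ->
  annealed P K (cyl n x `&` stays D n t) =
  (\int[P]_w (mono w (path_mono x n) * peval (apoly D xpred0 t (x n)) w)%:E)%E.
Proof. by move=> hK D t n x x0; apply: eq_integral => w _; exact: K_stays. Qed.

Theorem theorem1 (R : realType) (P : probability (Omega R) R)
    (K : R.-pker (Omega R) ~> Path) (gamma2 : R)
    (hiid : iid_sites P)
    (hK : quenched_law K 0)
    (hm1 : (-oo < \int[P]_w lne (w 0 (-1))%:E)%E)
    (h2 : (-oo < \int[P]_w lne (w 0 2)%:E)%E)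
    (hgamma2 : top_lyapunov P gamma2)
    (gamma2_gt0 : 0 < gamma2) :
  exists theta : R, 0 < theta < 1 /\
    {ae annealed P K, forall X : Path,
      (num_visited X x)%:R / x @[x --> +oo] --> theta}.
Proof.
have pm1 := ae_jump_gt0 hiid hm1.
have p2 := ae_jump_gt0 hiid h2.
have em02 := em_x02_gt0 p2.
have escape := escape_lb hiid pm1 p2 gamma2_gt0 hgamma2.
have below0 a a0 := @passage_from0 R P hiid pm1 p2 gamma2 gamma2_gt0 hgamma2 a a0.
pose Q : probability Path R := annealed P K.
have Q0 : Q [set X | X 0%N = 0] = 1%E.
  rewrite /Q /= /annealed (eq_integral (cst 1%E)) => [|w _]; last exact: (hK w).1.
  by rewrite integral_cst//= mul1e probability_setT.
have Q_stays := @annealed_stays R P K hK.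
have Q_jumps n : Q [set X | (X n.+1 - X n) \notin [:: -1; 1; 2]] = 0%E.
  by rewrite /Q /= /annealed integral0_eq// => w _; exact: K_jumps.
have rho0 : 0 < fine (palm Q setT) by exact: palm_gt0 Q_stays em02 escape.
have hren n k B H := @renewal R P Q hiid Q0 Q_stays em02 n k B H.
have start := ae_start Q0.
have jumps := ae_jumps Q_jumps.
have unbd := ae_unbounded Q0 Q_stays em02 below0.
have hist n a B := @hist_escape R P Q hiid Q0 Q_stays em02 n a B.
have QpE H := @QpalmE R Q rho0 H.
have rgQ := regenQ hren rho0.
have rgQp := regen0 hren rho0.
have gapQp := no_gap_null rho0 hist start jumps unbd QpE.
have startQp := ae_start_palm QpE.
have tQ := ae_typical rho0 hist start jumps unbd.
have gapQ : Q (~` has_gap) = 0%E.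
  apply: ae_measure0; first by apply: measurableC; exact: measurable_has_gap.
  by apply: filterS tQ => X /typical_has_gap H; apply.
have sint := integral_sigma_le rho0 rgQ hist start jumps unbd.
have lin := ae_linear_gaps rgQ rgQp gapQ gapQp sint.
have mu2 := mean_gap_ge2 gapQp startQp sint.
set mu := mean_gap (Qpalm Q) in lin mu2.
(* Positivity needs [mu > 1], which [mu2] gives; [theta < 1] holds because [mu] is a positive real
   number. *)
exists (1 - mu^-1); split.
  have mu0 : 0 < mu by apply: lt_le_trans mu2.
  by rewrite subr_gt0 invf_lt1// ltrBlDr ltrDl invr_gt0 mu0 (lt_le_trans _ mu2) ?ltr1n.
apply: filterS3 start tQ lin => X X0 tX lX.
by apply: num_visited_cvg => //; apply: le_trans mu2; rewrite ler1n.
Qed.
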